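(* For each integer $n \geq 4$ there exists a bounded degree acyclic Borel graph $\mathcal{H}_n$ (on a Polish space) such that $\chi_{BM}(\mathcal{H}_n)\leq 3$, $\chi_\mu(\mathcal{H}_n)\leq 3$ for every Borel probability measure $\mu$ on the vertex space, and $3<\chi_B(\mathcal{H}_n)=n$. Moreover, the collection of (codes of) Borel subgraphs of $\mathcal{H}_n$ with Borel chromatic number $<n$ is $\mathbf{\Sigma}^1_2$-complete.
   Context: A Borel graph on a Polish space $X$ is a graph on $X$ whose edge set is a Borel subset of $X^2$. The Borel chromatic number $\chi_B(\mathcal{G})$ is the least $n\in\{1,2,\dots,\aleph_0\}$ such that $\mathcal{G}$ admits a Borel measurable proper coloring with $n$ colors. $\chi_{BM}(\mathcal{G})$ (resp. $\chi_\mu(\mathcal{G})$) is defined in the same way, requiring the coloring only to be Baire measurable (resp. $\mu$-measurable). A graph is acyclic if it contains no cycles, and has bounded degree if there is a uniform finite bound on the degrees of its vertices. Borel subgraphs are coded via a standard coding of Borel sets; $\mathbf{\Sigma}^1_2$-completeness is in the usual sense of descriptive set theory. *)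

(* Defs.v *)
From HB Require Import structures.
From mathcomp Require Import all_boot all_order all_algebra.
From mathcomp Require Import all_classical all_reals all_analysis.
From mathcomp Require Import measurable_realfun.
Set Implicit Arguments.
Unset Strict Implicit.
Unset Printing Implicit Defensive.
Import Order.TTheory GRing.Theory Num.Theory.
Local Open Scope classical_set_scope.

Definition separable (T : topologicalType) : Prop :=
  exists2 D : set T, countable D & dense D.

Definition completely_metrizable (R : realType) (T : topologicalType) : Prop :=
  exists (M : metricType R) (f : T -> M) (g : M -> T),
    [/\ continuous f, continuous g, cancel f g, cancel g f
      & forall u : nat -> M, cauchy (u @ \oo) -> exists l : M, u @ \oo --> l].

Definition polish (R : realType) (T : topologicalType) : Prop :=
  separable T /\ completely_metrizable R T.

Definition borel (T : topologicalType) : set (set T) := <<s @open T >>.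

Definition nowhere_dense (T : topologicalType) (A : set T) : Prop :=
  interior (closure A) = set0.

Definition meager (T : topologicalType) (A : set T) : Prop :=
  exists2 F : nat -> set T, (forall i, nowhere_dense (F i)) & A = \bigcup_i F i.

Definition baire_property (T : topologicalType) : set (set T) :=
  [set A | exists2 U : set T, open U & meager ((A `\` U) `|` (U `\` A))].

Definition borel_space (X : ptopologicalType) := g_sigma_algebraType (@open X).

Section Graphs.
Variable X : topologicalType.
Implicit Type E : set (X * X).

Definition borel_graph E : Prop :=
  [/\ borel E, (forall x y, E (x, y) -> E (y, x)) & forall x, ~ E (x, x)].

Definition bounded_degree E : Prop :=
  exists d : nat, forall x, ([set y | E (x, y)] #<= `I_d)%card.

(* [ucycle] also accepts sequences of length at most 2, which are not cycles
   of a simple graph. *)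
Definition acyclic E : Prop :=
  forall s : seq X, (2 < size s)%N -> ~ ucycle [rel x y | (x, y) \in E] s.

(* [Uncountable] is the value given to chromatic numbers of graphs without any
   admissible coloring by countably many colors. *)
Inductive color_count := Fin of nat | Aleph0 | Uncountable.

HB.instance Definition _ := gen_eqMixin color_count.
HB.instance Definition _ := gen_choiceMixin color_count.

Definition cc_le (k l : color_count) : bool :=
  match k, l with
  | Fin m, Fin n => (m <= n)%N
  | Fin _, _ => true
  | Aleph0, Fin _ => false
  | Aleph0, _ => true
  | Uncountable, Uncountable => true
  | Uncountable, _ => false
  end.

Definition cc_lt (k l : color_count) : bool := ~~ cc_le l k.

Definition candidate (k : color_count) : bool :=
  match k with Fin m => (0 < m)%N | Aleph0 => true | Uncountable => false end.

Definition colors (k : color_count) : set nat :=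
  match k with Fin m => `I_m | _ => setT end.

(* [M] is the class of sets in which the preimages of sets of colors must
   lie. *)
Definition colorable (M : set (set X)) E (k : color_count) : Prop :=
  exists c : X -> nat,
    [/\ forall x, colors k (c x),
        forall A : set nat, M (c @^-1` A)
      & forall x y, E (x, y) -> c x <> c y].

Definition chromatic_number (M : set (set X)) E : color_count :=
  xget Uncountable
    [set k | [/\ candidate k, colorable M E k
      & forall l, candidate l -> colorable M E l -> cc_le k l]].

Definition chi_B E : color_count := chromatic_number (@borel X) E.

Definition chi_BM E : color_count := chromatic_number (@baire_property X) E.

End Graphs.

Definition chi_mu (R : realType) (X : ptopologicalType)
    (mu : probability (borel_space X) R) (E : set (X * X)) : color_count :=
  @chromatic_number X (completed_algebra_gen mu) E.

Definition baire_space : Type := prod_topology (fun _ : nat => nat).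
HB.instance Definition _ := Pointed.on baire_space.
HB.instance Definition _ := Topological.on baire_space.

Definition shift (c : baire_space) : baire_space := fun n => c n.+1.

Definition code_section (c : baire_space) (i : nat) : baire_space :=
  fun n => c (pickle (i, n)).

(* Solovay's coding: [borel_code U c A] says that [c] is a Borel code, relative
   to the enumerated basis [U], and that it codes the set [A]. *)
Inductive borel_code (T : Type) (U : nat -> set T) :
    baire_space -> set T -> Prop :=
| code_basic c : c 0%N = 0%N -> borel_code U c (U (c 1%N))
| code_compl c A :
    c 0%N = 1%N -> borel_code U (shift c) A -> borel_code U c (~` A)
| code_union c (A : nat -> set T) :
    (1 < c 0)%N -> (forall i, borel_code U (code_section (shift c) i) (A i)) ->
    borel_code U c (\bigcup_i A i).

Definition sigma11 (T : topologicalType) (A : set T) : Prop :=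
  exists2 F : set (T * baire_space), closed F & A = fst @` F.

Definition pi11 (T : topologicalType) (A : set T) : Prop := sigma11 (~` A).

Definition sigma12 (T : topologicalType) (A : set T) : Prop :=
  exists2 P : set (T * baire_space), pi11 P & A = fst @` P.

(* The library's [zero_dimensional] only asks that points be separated by
   clopen sets, which is weaker on Polish spaces that are not compact. *)
Definition clopen_basis (T : topologicalType) : Prop :=
  basis [set U : set T | clopen U].

Definition sigma12_hard (R : realType) (T : topologicalType) (A : set T) :
    Prop :=
  forall Z : topologicalType, polish R Z -> clopen_basis Z ->
  forall B : set Z, sigma12 B ->
  exists2 f : Z -> T, continuous f & B = f @^-1` A.

Definition sigma12_complete (R : realType) (T : topologicalType) (A : set T) :
    Prop :=
  sigma12 A /\ sigma12_hard R A.

Definition borel_subgraph (X : topologicalType) (G H : set (X * X)) : Prop :=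
  borel_graph G /\ G `<=` H.

(* Main.v *)
(** The vertices are sequences of natural numbers that carry a digit sequence,
    two parameters [d] and [T] that the edges preserve, and labels that tell, for
    every path in a [D]-regular tree ([D = n - 1]), whether its last edge shifts
    the digits or puts a new one in front. Only the vertices with eventually
    increasing digits and a component without cycles are kept, so that an edge
    always joins a digit sequence and its shift.

    Upper bounds: a greedy Borel coloring uses [D + 1] colors, and three colors
    suffice where the digits fail, infinitely often, to dominate a fixed real, as
    in the shift graph on increasing sequences. Lower bound: a Borel coloring
    with [D] colors gives, for each color [i], a Borel game in which one player
    builds the branch [i] and the other player the remaining branches, while the
    digits come from sets of a nonprincipal ultrafilter. By Borel determinacy
    either the first player wins all the games and some point has no color, or
    the second player wins one of them and two adjacent points have the same
    color.

    Hardness: a Sigma12 set consists of the [s] for which some tree [TT s x] is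
    well-founded. Let [RR (d, T)] search for a proof that [d] does not code a
    coloring with [D] colors of the section of the graph with parameters [d] and
    [T], and let [T] itself be, by self-reference, the tree of attempts to find
    [x] and a level-preserving map from [TT s x] to [RR (d, T)]. Keep the points
    whose digits do not dominate a branch of [T]. If no [TT s x] is well-founded
    then a coloring [d] makes [RR (d, T)], hence [T], well-founded, so that a full
    section is kept, which has no coloring. If [TT s x] is well-founded then
    either it maps to [RR (d, T)], which gives a branch of [T] and a coloring with
    three colors, or [RR (d, T)] is well-founded and [d] itself provides the
    colors; this is a Borel distinction by recursion on [TT s x]. *)

Require Import Defs.
From HB Require Import structures.
From mathcomp Require Import all_boot all_order all_algebra.
From mathcomp Require Import all_classical all_reals all_analysis.
Set Implicit Arguments.
Unset Strict Implicit.
Unset Printing Implicit Defensive.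

(** * Strategies and open games *)

(** The moves of the coloring games are whole label functions and sets of natural numbers, so
    determinacy is needed over an arbitrary type of moves. It is proved by Martin's unraveling, with
    quasi-strategies (trees of positions) in place of strategies; moves are chosen only at the end.
    The ultrafilter serves both outcomes: finitely many of its sets have a common element, so the
    games won by the first player can share their digits, and the possible answers of the second
    player to its sets again form a set of the ultrafilter, so two copies of his strategy can be
    made to produce equal digits. The games do not control cycles, so a conflict might fall into a
    discarded component; there every vertex points along an edge, in a Borel way, such that no two
    neighbours point at each other, and this extends a coloring beyond [V]. In the reduction the
    vertices carry [d] because a coloring has to be refuted inside a section that names it. Coloring
    by [d] means evaluating varying Borel codes; this is Borel where all of them are known to be
    well-founded, by Suslin's theorem. *)

Definition epso (T : Type) (Q : T -> Prop) : option T :=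
  match pselect (exists t, Q t) with
  | left h => Some (projT1 (cid h))
  | right _ => None
  end.

Lemma epso_some (T : Type) (Q : T -> Prop) t : epso Q = Some t -> Q t.
Proof. by rewrite /epso; case: pselect => // h [<-]; case: cid. Qed.

Lemma epsoP (T : Type) (Q : T -> Prop) :
  (exists t, Q t) -> exists2 t, Q t & epso Q = Some t.
Proof.
move=> h; rewrite /epso; case: pselect => // h'.
by exists (projT1 (cid h')) => //; case: cid.
Qed.

Section Plays.
Context {A : Type}.
Implicit Types (T S V O : seq A -> Prop) (s p q : seq A) (x : nat -> A).

Definition pre x n : seq A := mkseq x n.

Lemma size_pre x n : size (pre x n) = n. Proof. exact: size_mkseq. Qed.

Lemma preS x n : pre x n.+1 = rcons (pre x n) (x n).
Proof. exact: mkseqS. Qed.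

Lemma take_pre x m n : m <= n -> take m (pre x n) = pre x m.
Proof. by move=> mn; rewrite /pre /mkseq -map_take take_iota (minn_idPl mn). Qed.

Definition ext p s : Prop := take (size p) s = p.

Lemma ext_size p s : ext p s -> size p <= size s.
Proof. by move=> e; have := congr1 size e; rewrite size_take_min => <-; exact: geq_minr. Qed.

Lemma ext0 s : ext [::] s. Proof. by rewrite /ext take0. Qed.

Lemma ext_refl s : ext s s. Proof. exact: take_size. Qed.

Lemma take_rcons_le s a n : n <= size s -> take n (rcons s a) = take n s.
Proof. by move=> ns; rewrite -cats1 takel_cat. Qed.

Lemma ext_rcons p s a : ext p s -> ext p (rcons s a).
Proof. by move=> e; rewrite /ext take_rcons_le ?(ext_size e). Qed.

Lemma ext_rconsl p s a : ext (rcons p a) s -> ext p s.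
Proof.
move=> e; rewrite /ext.
have -> : take (size p) s = take (size p) (take (size (rcons p a)) s).
  by rewrite size_rcons take_takel.
by rewrite e take_rcons_le// take_size.
Qed.

Lemma ext_rcons_inv p s a : ext p (rcons s a) -> p = rcons s a \/ ext p s.
Proof.
move=> e; have := ext_size e; rewrite size_rcons leq_eqVlt => /orP[/eqP es|ps].
  by left; rewrite -e es -(size_rcons s a) take_size.
by right; rewrite /ext -(take_rcons_le a ps).
Qed.

Lemma ext_take s n : ext (take n s) s.
Proof.
rewrite /ext; have [ns|sn] := leqP n (size s); first by rewrite size_takel.
by rewrite (take_oversize (ltnW sn)) take_size.
Qed.

Lemma ext_trans p q s : ext p q -> ext q s -> ext p s.
Proof.
move=> e1 e2; rewrite /ext -[RHS]e1 -e2 take_takel//; exact: ext_size.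
Qed.

(* [tree_at p T] and [qsat P p T S] only constrain the positions extending [p];
   lengths of positions are absolute, so that parities need no shift. *)
Record tree_at p T : Prop := TreeAt {
  tree_root : T p;
  tree_rcons : forall s a, ext p s -> T (rcons s a) -> T s;
  tree_pruned : forall s, ext p s -> T s -> exists a, T (rcons s a) }.

Record qsat (P : bool) p T S : Prop := Qsat {
  qs_sub : forall s, S s -> T s;
  qs_ext : forall s, S s -> ext p s;
  qs_root : S p;
  qs_rcons : forall s a, ext p s -> S (rcons s a) -> S s;
  qs_own : forall s, S s -> odd (size s) = P -> exists a, S (rcons s a);
  qs_opp : forall s a, S s -> odd (size s) <> P -> T (rcons s a) ->
    S (rcons s a) }.

Lemma qsat_tree P p T S : tree_at p T -> qsat P p T S -> tree_at p S.
Proof.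
move=> [T1 T2 T3] hS; split; [exact: qs_root hS|exact: qs_rcons hS|] => s ps Ss.
have [sP|sP] := pselect (odd (size s) = P); first exact: qs_own hS _ Ss sP.
have [a Ta] := T3 _ ps (qs_sub hS Ss).
by exists a; apply: qs_opp hS _ _ Ss sP Ta.
Qed.

Lemma tree_at_take p T s n : tree_at p T -> ext p s -> T s -> size p <= n ->
  T (take n s).
Proof.
move=> hT; elim/last_ind: s => [|s a IH] ps Ts pn; first by [].
have [sn|ns] := leqP (size (rcons s a)) n; first by rewrite take_oversize.
rewrite size_rcons ltnS in ns; rewrite take_rcons_le//.
have [ep|ps'] := ext_rcons_inv ps.
  by move: pn ns; rewrite ep size_rcons => /leq_trans h/h; rewrite ltnn.
by apply: IH => //; apply: tree_rcons hT _ _ ps' Ts.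
Qed.

Lemma tree_atW p q T : tree_at p T -> T q -> ext p q -> tree_at q T.
Proof.
move=> hT Tq pq; split => // [s a qs|s qs]; have ps := ext_trans pq qs.
  exact: tree_rcons hT _ _ ps.
exact: tree_pruned hT _ ps.
Qed.

(* Gale-Stewart: [Win] is the set of positions from which [P] can force the
   play into [O]. *)
Inductive Win (P : bool) T O : seq A -> Prop :=
| Win_here s : O s -> Win P T O s
| Win_own s a : odd (size s) = P -> T (rcons s a) -> Win P T O (rcons s a) ->
    Win P T O s
| Win_opp s : odd (size s) <> P ->
    (forall a, T (rcons s a) -> Win P T O (rcons s a)) -> Win P T O s.

(** No prefix from [q] on may be winning for [P]. Excluding only [s] itself would not give a set
    closed under prefixes, as a quasi-strategy of the opponent has to be. *)
Definition nowin P T O q s : Prop :=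
  [/\ T s, ext q s & forall n, size q <= n -> ~ Win P T O (take n s)].

Lemma nowin_qs P T O q : tree_at q T -> ~ Win P T O q ->
  qsat (~~ P) q T (nowin P T O q).
Proof.
move=> hT nW.
have step s a : nowin P T O q s -> T (rcons s a) -> ~ Win P T O (rcons s a) ->
    nowin P T O q (rcons s a).
  move=> [Ts qs nWs] Ta nWa; split => //; first exact: ext_rcons.
  move=> n qn; have [ns|sn] := leqP n (size s).
    by rewrite take_rcons_le//; apply: nWs.
  by rewrite take_oversize// size_rcons.
have last s : nowin P T O q s -> ~ Win P T O s.
  by move=> [_ qs /(_ _ (ext_size qs))]; rewrite take_size.
split=> [s []//|s []//||s a qs [Ta _ nWa]|s Ss sP|s a Ss sP Ta].
- split => //; [exact: tree_root hT|exact: ext_refl|].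
  by move=> n qn; rewrite take_oversize.
- split => //; first exact: tree_rcons hT _ _ qs Ta.
  move=> n qn; have [ns|sn] := leqP n (size s).
    by rewrite -(take_rcons_le a ns); apply: nWa.
  by rewrite take_oversize ?(ltnW sn)// -(take_size s) -(take_rcons_le a (leqnn _));
    apply: nWa; apply: ext_size.
- apply: contrapT => /forallNP h; apply: (last _ Ss).
  apply: Win_opp => [/esym e|a Ta]; first by move: sP; rewrite e; case: (odd _).
  by apply: contrapT => nWa; apply: (h a); apply: step.
- apply: step => // Wa; apply: (last _ Ss); apply: Win_own Ta Wa.
  by case: (P) (odd _) sP => -[].
Qed.

Definition winstrat P T O q V : Prop :=
  qsat P q T V /\
  forall x, pre x (size q) = q -> (forall n, size q <= n -> V (pre x n)) ->
    exists2 n, size q <= n & O (pre x n).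

(** Induction on the derivation: inside [O] every move is allowed, at a position of [P] the
    quasi-strategy after the chosen move is kept, and at a position of the opponent those after all
    his moves are glued. *)
Lemma Win_strat P T O q : tree_at q T -> Win P T O q -> exists V, winstrat P T O q V.
Proof.
move=> hT W; elim: W hT => {q} [s Os|s a sP Ta _ IH|s sP _ IH] hT.
- exists (fun t => T t /\ ext s t); split; last first.
    by move=> x xs _; exists (size s); rewrite ?xs.
  split=> [t []//|t []//||t a st [Ta _]|t [Tt st] _|t a [Tt st] _ Ta].
  + by split; [exact: tree_root hT|exact: ext_refl].
  + by split => //; apply: tree_rcons hT _ _ st Ta.
  + have [a Ta] := tree_pruned hT st Tt; exists a; split => //; exact: ext_rcons.
  + by split => //; apply: ext_rcons.
- have [V [hV Vw]] := IH (tree_atW hT Ta (ext_rcons a (ext_refl s))).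
  exists (fun t => t = s \/ V t); split; last first.
    move=> x xs xV; have xa : x (size s) = a.
      have [||e] := xV (size s).+1; first by [].
      - by move=> /(congr1 size); rewrite size_pre => /esym/n_Sn.
      - have := qs_ext hV e; rewrite /ext size_rcons take_pre// preS xs.
        by rewrite -!cats1; move/(congr1 (drop (size s))); rewrite !drop_size_cat// => -[].
    have xsa : pre x (size (rcons s a)) = rcons s a.
      by rewrite size_rcons preS xs xa.
    have [|n] := Vw _ xsa; last first.
      by rewrite size_rcons => /ltnW sn On; exists n.
    move=> n; rewrite size_rcons => sn; have [e|//] := xV n (ltnW sn).
    by move/(congr1 size): e sn; rewrite size_pre => ->; rewrite ltnn.
  split=> [t [->|/(qs_sub hV)//]|t [->|/(qs_ext hV)/ext_rconsl//]|||t|].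
  + exact: tree_root hT.
  + exact: ext_refl.
  + by left.
  + move=> t b st [e|Vb].
      by move/(congr1 size): e (ext_size st); rewrite size_rcons => <-; rewrite ltnn.
    have [e|e] := ext_rcons_inv (qs_ext hV Vb).
      by left; case/rcons_inj: e.
    by right; apply: qs_rcons hV _ _ e Vb.
  + move=> [->|Vt] tP; first by exists a; right; exact: qs_root hV.
    by have [b Vb] := qs_own hV Vt tP; exists b; right.
  + move=> t b [->//|Vt] tP Tb; right; exact: qs_opp hV _ _ Vt tP Tb.
- have : forall a, exists V, T (rcons s a) -> winstrat P T O (rcons s a) V.
    move=> a; have [Ta|nTa] := pselect (T (rcons s a)); last by exists T.
    by have [V hV] := IH a Ta (tree_atW hT Ta (ext_rcons a (ext_refl s))); exists V.
  move=> /boolp.choice[V hV].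
  exists (fun t => t = s \/ exists2 a, T (rcons s a) & V a t); split; last first.
    move=> x xs xV; have Ta : T (rcons s (x (size s))).
      have [||[a Ta Va]] := xV (size s).+1; first by [].
      - by move=> /(congr1 size); rewrite size_pre => /esym/n_Sn.
      - have [h _] := hV a Ta; have := qs_ext h Va; rewrite /ext size_rcons take_pre// preS xs.
        by move=> ->.
    have [h Vw] := hV _ Ta.
    have xsa : pre x (size (rcons s (x (size s)))) = rcons s (x (size s)).
      by rewrite size_rcons preS xs.
    have [|n] := Vw _ xsa; last first.
      by rewrite size_rcons => /ltnW sn On; exists n.
    move=> n; rewrite size_rcons => sn; have [e|] := xV n (ltnW sn).
      by move/(congr1 size): e sn; rewrite size_pre => ->; rewrite ltnn.
    move=> [b Tb Vb]; suff -> : x (size s) = b by [].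
    have [hb _] := hV b Tb; have := qs_ext hb Vb; rewrite /ext size_rcons take_pre// preS xs.
    by rewrite -!cats1; move/(congr1 (drop (size s))); rewrite !drop_size_cat// => -[].
  split=> [t [->|[a Ta Va]]|t [->|[a Ta Va]]|||t|].
  + exact: tree_root hT.
  + by have [h _] := hV _ Ta; apply: qs_sub h _ Va.
  + exact: ext_refl.
  + by have [h _] := hV _ Ta; have /ext_rconsl := qs_ext h Va.
  + by left.
  + move=> t b st [e|[a Ta Vb]].
      by move/(congr1 size): e (ext_size st); rewrite size_rcons => <-; rewrite ltnn.
    have [h _] := hV _ Ta; have [e|e] := ext_rcons_inv (qs_ext h Vb).
      by left; case/rcons_inj: e.
    by right; exists a => //; apply: qs_rcons h _ _ e Vb.
  + move=> [->//|[a Ta Vt]] tP; have [h _] := hV _ Ta.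
    by have [b Vb] := qs_own h Vt tP; exists b; right; exists a.
  + move=> t b [->|[a Ta Vt]] tP Tb.
      by right; exists b => //; have [h _] := hV _ Tb; exact: qs_root h.
    by right; exists a => //; have [h _] := hV _ Ta; exact: qs_opp h _ _ Vt tP Tb.
Qed.

End Plays.

(** * Memory states along a position *)

Section Simulation.
Context {A Tag : Type} (T : seq A -> Prop) (t0 : Tag).
Implicit Types (J : seq A -> Tag -> A -> Tag -> Prop).

(** [epso] picks the next tag as a function of the predicate [J s t a] alone. Hence a position has
    at most one tag, and relations [J] that agree on short positions give the same tags there, which
    yields the locality demanded of coverings. *)
Inductive simr J : seq A -> Tag -> Prop :=
| simr_nil : simr J [::] t0
| simr_rcons s t a t' : simr J s t -> T (rcons s a) -> epso (J s t a) = Some t' ->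
    simr J (rcons s a) t'.

Lemma simr_inv J s a t' : simr J (rcons s a) t' ->
  exists t, [/\ simr J s t, T (rcons s a) & epso (J s t a) = Some t'].
Proof.
move=> h; inversion h as [e|s1 t a1 t1 hs hT he e e'].
  by case: s e {h}.
by case/rcons_inj: e => e1 e2; subst; exists t.
Qed.

Lemma simr_nil_inv J t : simr J [::] t -> t = t0.
Proof. by move e : [::] => s h; case: h e => // s1 t1 a t' _ _ _; case: s1. Qed.

Lemma simr_fun J s t t' : simr J s t -> simr J s t' -> t = t'.
Proof.
elim/last_ind: s t t' => [|s a IH] t t'.
  by move=> /simr_nil_inv-> /simr_nil_inv->.
move=> /simr_inv[u [hu _ eu]] /simr_inv[v [hv _ ev]].
by move: ev; rewrite -(IH _ _ hu hv) eu => -[].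
Qed.

Lemma simr_local J1 J2 n :
  (forall s t a, size s < n -> simr J1 s t -> J1 s t a = J2 s t a) ->
  forall s t, size s <= n -> simr J1 s t <-> simr J2 s t.
Proof.
move=> h; elim/last_ind => [|s a IH] t; rewrite ?size_rcons => sn.
  by split=> /simr_nil_inv->; exact: simr_nil.
have {}IH u := IH u (ltnW sn).
split=> /simr_inv[u [hu Ta eu]].
  by apply: simr_rcons (Ta) _; [exact/IH/hu|rewrite -h].
have hu1 := (IH u).2 hu.
by apply: (simr_rcons hu1 Ta); rewrite (h _ _ _ sn hu1).
Qed.

End Simulation.

(** * Simulated strategies that switch between modes *)

Section Switch.
Context {A B C : Type} (P : bool) (T : seq A -> Prop).

(** The memory of the simulated strategy: the opening, a mode that honours an imagined commitment,
    or the pursuit of an open set by a stored winning quasi-strategy. *)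
Inductive tag := Pre | Main of B | Chase of C & (seq A -> Prop).

(* [G b] are the positions in mode [b]; in context [c] the player [P] chases
   the open set [OC c] inside the tree [TC c], and [xm c u b] means that the
   chase, ending at [u], is followed by the mode [b]. *)
Variables (G : B -> seq A -> Prop) (TC OC : C -> seq A -> Prop).
Variables (xm : C -> seq A -> B -> Prop) (mc : B -> C -> Prop).
Variable (J0 : seq A -> A -> tag -> Prop).

Definition aft c q V t' : Prop :=
  (~ OC c q /\ t' = Chase c V) \/ (exists2 b, xm c q b & t' = Main b).

Definition arrive c q t' : Prop :=
  exists2 V, winstrat P (TC c) (OC c) q V & aft c q V t'.

Definition switchJ s t a t' : Prop :=
  match t with
  | Pre => J0 s a t'
  | Main b => (G b (rcons s a) /\ t' = Main b) \/
      [/\ ~ G b (rcons s a), odd (size s) <> P &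
        exists2 c, mc b c & arrive c (rcons s a) t']
  | Chase c V => V (rcons s a) /\ aft c (rcons s a) V t'
  end.

Definition switch s : Prop := exists t, simr T Pre switchJ s t.

Hypothesis hT : tree_at [::] T.
Variables (I0 : seq A -> Prop) (CG : C -> seq A -> Prop) (F : B -> Prop) (N0 : nat).

Definition switchI s t : Prop :=
  match t with
  | Pre => I0 s
  | Main b => G b s /\ N0 <= size s
  | Chase c V => exists q, [/\ winstrat P (TC c) (OC c) q V, V s, CG c q, N0 <= size s &
      forall n, size q <= n -> n <= size s -> ~ OC c (take n s)]
  end.

Lemma aftI c q q' V t' :
  (forall c q u b, CG c q -> ext q u -> N0 <= size u -> TC c u ->
    xm c u b -> G b u /\ F b) -> CG c q -> ext q q' -> TC c q' -> N0 <= size q' ->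
  winstrat P (TC c) (OC c) q V -> V q' ->
  (forall n, size q <= n -> n < size q' -> ~ OC c (take n q')) ->
  aft c q' V t' -> switchI q' t'.
Proof.
move=> hx cg qq' Tq' Nq' hV Vq' nO [[nOq ->]|[b xb ->]] /=.
  exists q; split=> // n qn; rewrite leq_eqVlt => /orP[/eqP->|]; first by rewrite take_size.
  exact: nO.
by have [] := hx _ _ _ _ cg qq' Nq' Tq' xb.
Qed.

Lemma aft_ex c q q' V :
  (forall c q u, CG c q -> ext q u -> N0 <= size u -> TC c u -> OC c u ->
    exists b, xm c u b) -> CG c q -> ext q q' -> TC c q' -> N0 <= size q' ->
  exists t', aft c q' V t'.
Proof.
move=> hx cg qq' Tq' Nq'; have [OCq|nO] := pselect (OC c q').
  by have [b xb] := hx _ _ _ cg qq' Nq' Tq' OCq; exists (Main b); right; exists b.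
by exists (Chase c V); left.
Qed.

(** By [hGopp] a mode is left only by a move after which [P] can force some [OC c]; by [hxmG] a
    finished chase enters a mode in [F]; by [hF] the opponent cannot leave such a mode. So a play
    contains at most one chase. *)
Record switchable : Prop := Switchable {
  hI0 : I0 [::];
  h0own : forall s, I0 s -> odd (size s) = P ->
    exists a t', T (rcons s a) /\ J0 s a t';
  h0opp : forall s a, I0 s -> odd (size s) <> P -> T (rcons s a) ->
    exists t', J0 s a t';
  h0inv : forall s a t', I0 s -> T (rcons s a) -> J0 s a t' ->
    switchI (rcons s a) t';
  h0end : forall s, I0 s -> size s < N0;
  hGown : forall b s, G b s -> N0 <= size s -> odd (size s) = P ->
    exists2 a, T (rcons s a) & G b (rcons s a);
  hGopp : forall b s a, G b s -> N0 <= size s -> odd (size s) <> P -> T (rcons s a) ->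
    ~ G b (rcons s a) ->
    (exists2 c, mc b c & Win P (TC c) (OC c) (rcons s a)) /\
    (forall c, mc b c -> CG c (rcons s a));
  hCGtree : forall c q, CG c q -> tree_at q (TC c);
  hCGT : forall c q s, CG c q -> ext q s -> TC c s -> T s;
  hCGopp : forall c q s a, CG c q -> ext q s -> TC c s ->
    odd (size s) <> P -> T (rcons s a) -> TC c (rcons s a);
  hxm : forall c q u, CG c q -> ext q u -> N0 <= size u -> TC c u -> OC c u ->
    exists b, xm c u b;
  hxmG : forall c q u b, CG c q -> ext q u -> N0 <= size u -> TC c u ->
    xm c u b -> G b u /\ F b;
  hF : forall b s a, F b -> G b s -> N0 <= size s -> odd (size s) <> P -> T (rcons s a) ->
    G b (rcons s a) }.

Arguments h0own _ {s}.
Arguments h0opp _ {s a}.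
Arguments h0inv _ {s a t'}.
Arguments h0end _ {s}.
Arguments hGown _ {b s}.
Arguments hGopp _ {b s a}.
Arguments hCGtree _ {c q}.
Arguments hCGT _ {c q s}.
Arguments hCGopp _ {c q s a}.
Arguments hxm _ {c q u}.
Arguments hxmG _ {c q u b}.
Arguments hF _ {b s a}.

Hypothesis sw : switchable.

Let J := switchJ.

Lemma switchJ_inv s t a t' : switchI s t -> T (rcons s a) -> J s t a t' ->
  switchI (rcons s a) t'.
Proof.
case: t => [|b|c V] /=; first exact: (h0inv sw).
- move=> [Gs Ns] Ta [[Ga ->]|[nG sP [c bc [V hV]]]].
    by rewrite /= size_rcons leqW.
  have [_ /(_ _ bc) cg] := (hGopp sw) Gs Ns sP Ta nG.
  apply: (aftI (@hxmG sw) cg (ext_refl _) _ _ hV); rewrite ?size_rcons ?(leqW Ns)//.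
  + exact: tree_root ((hCGtree sw) cg).
  + exact: qs_root hV.1.
  + by move=> n; rewrite leqNgt => /negP.
- move=> [q [hV Vs cg Ns nO]] Ta [Va].
  apply: (aftI (@hxmG sw) cg _ _ _ hV Va); rewrite ?size_rcons ?(leqW Ns)//.
  + exact: qs_ext hV.1 _ Va.
  + exact: qs_sub hV.1 _ Va.
  + by move=> n qn; rewrite ltnS => ns; rewrite take_rcons_le//; apply: nO.
Qed.

Lemma simr_I s t : simr T Pre J s t -> switchI s t.
Proof.
elim=> [|{}s {}t a t' _ IH Ta e]; first exact: (hI0 sw).
exact: switchJ_inv IH Ta (epso_some e).
Qed.

Lemma simr_step s t a : simr T Pre J s t -> T (rcons s a) ->
  (exists t', J s t a t') -> switch (rcons s a).
Proof.
move=> hs Ta /epsoP[t' _ e]; exists t'; exact: simr_rcons hs Ta e.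
Qed.

Lemma switch_qs : qsat P [::] T switch.
Proof.
split.
- move=> s [t h]; case: h => [|{}s {}t a t' _ Ta _ //].
  exact: tree_root hT.
- by move=> s _; rewrite /ext take0.
- by exists Pre; exact: simr_nil.
- by move=> s a _ [t h]; have [u [hu _ _]] := simr_inv h; exists u.
- move=> s [t hs] sP; have := simr_I hs; case: t hs => [|b|c V] hs /=.
  + move=> /(h0own sw)/(_ sP)[a [t' [Ta j]]]; exists a.
    by apply: (simr_step hs Ta); exists t'.
  + move=> [Gs Ns]; have [a Ta Ga] := (hGown sw) Gs Ns sP; exists a.
    by apply: (simr_step hs Ta); exists (Main b); left.
  + move=> [q [hV Vs cg Ns nO]]; have [a Va] := qs_own hV.1 Vs sP.
    have qa := qs_ext hV.1 Va; have TCa := qs_sub hV.1 Va.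
    exists a; apply: (simr_step hs ((hCGT sw) cg qa TCa)).
    have [|t' h] := aft_ex V (@hxm sw) cg qa TCa; first by rewrite size_rcons leqW.
    by exists t'.
- move=> s a [t hs] sP Ta; apply: (simr_step hs Ta).
  have := simr_I hs; case: t hs => [|b|c V] hs /=.
  + by move=> /(h0opp sw); apply.
  + move=> [Gs Ns]; have [Ga|nG] := pselect (G b (rcons s a)).
      by exists (Main b); left.
    have [[c bc W] /(_ _ bc) cg] := (hGopp sw) Gs Ns sP Ta nG.
    have hTC := (hCGtree sw) cg.
    have [V hV] := Win_strat hTC W.
    have [|t' h] := aft_ex V (@hxm sw) cg (ext_refl _) (tree_root hTC).
      by rewrite size_rcons leqW.
    by exists t'; right; split => //; exists c => //; exists V.
  + move=> [q [hV Vs cg Ns nO]].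
    have TCs := qs_sub hV.1 Vs; have qs := qs_ext hV.1 Vs.
    have TCa := (hCGopp sw) cg qs TCs sP Ta.
    have Va := qs_opp hV.1 Vs sP TCa.
    have [|t' h] := aft_ex V (@hxm sw) cg (ext_rcons a qs) TCa; first by rewrite size_rcons leqW.
    by exists t'.
Qed.

(** A chase ends because its quasi-strategy is winning, and it ends in a mode that is never left. A
    branch that meets no such mode therefore contains no chase, and the mode it has at length [N0]
    stays. *)
Lemma switch_branch x : (forall n, switch (pre x n)) ->
  exists b N, forall n, N <= n -> G b (pre x n).
Proof.
move=> /boolp.choice[tau htau].
have I n := simr_I (htau n).
have step n : J (pre x n) (tau n) (x n) (tau n.+1).
  have := htau n.+1; rewrite preS => h; have [t [ht _ e]] := simr_inv h.
  have := epso_some e; by rewrite (simr_fun ht (htau n)).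
have final n b : tau n = Main b -> F b -> forall m, n <= m -> tau m = Main b.
  move=> en Fb; elim=> [|m IH].
    by rewrite leqn0 => /eqP <-.
  rewrite leq_eqVlt => /orP[/eqP <-//|]; rewrite ltnS => /IH em.
  have := step m; have := I m; rewrite em /= => -[Gm Nm] [[]//|[nG sP _]].
  case: nG; apply: (hF sw) => //; rewrite -preS.
  exact: qs_sub switch_qs _ (ex_intro _ _ (htau m.+1)).
have finalG n b : tau n = Main b -> F b -> exists b N, forall n, N <= n -> G b (pre x n).
  by move=> en Fb; exists b, n => m /(final _ _ en Fb) em; have := I m; rewrite em => -[].
have [[n [b [en Fb]]]|noF] := pselect (exists n b, tau n = Main b /\ F b).
  exact: finalG en Fb.
have aftC c q V t' n : CG c q -> ext q (pre x n) -> N0 <= n -> TC c (pre x n) ->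
    tau n = t' -> aft c (pre x n) V t' -> t' = Chase c V.
  move=> cg qn Nn Tn en [[]//|[b xb eb]].
  have [|_ Fb] := (hxmG sw) cg qn _ Tn xb; first by rewrite size_pre.
  by case: noF; exists n, b; rewrite en eb.
have noC n c V : tau n <> Chase c V.
  move=> en; have cst m : n <= m -> tau m = Chase c V.
    elim: m => [|m IH]; first by rewrite leqn0 => /eqP <-.
    rewrite leq_eqVlt => /orP[/eqP <-//|]; rewrite ltnS => /IH em.
    have := step m; have := I m; rewrite em /= => -[q [hV Vm cg Nm nO]] [].
    rewrite -preS => Va; apply: (aftC _ _ _ _ _ cg _ _ _ erefl).
    + exact: qs_ext hV.1 _ Va.
    + by rewrite size_pre in Nm; rewrite leqW.
    + exact: qs_sub hV.1 _ Va.
  have := I n; rewrite en /= => -[q [hV Vn cg Nn nO]].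
  have qn := qs_ext hV.1 Vn.
  have sqn : size q <= n by have := ext_size qn; rewrite size_pre.
  have xq : pre x (size q) = q by rewrite -(take_pre x sqn).
  have [m qm|m qm Om] := hV.2 x xq.
    have [nm|mn] := leqP n m.
      by have := I m; rewrite cst //= => -[? []].
    rewrite -(take_pre x (ltnW mn)).
    exact: tree_at_take (qsat_tree ((hCGtree sw) cg) hV.1) qn Vn qm.
  have [nm|mn] := leqP n m.
    have := I m; rewrite cst //= => -[q' [hV' Vm _ _ nO']].
    apply: (nO' m); rewrite ?size_pre// ?take_pre//.
    by have := ext_size (qs_ext hV'.1 Vm); rewrite size_pre.
  by apply: (nO m) => //; rewrite ?size_pre ?(ltnW mn)// take_pre ?(ltnW mn).
have [b eb] : exists b, tau N0 = Main b.
  have := I N0; case e : (tau N0) => [|b|c V] /=; last by case: (noC _ _ _ e).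
    by move=> /(h0end sw); rewrite size_pre ltnn.
  by exists b.
exists b, N0; suff cst n : N0 <= n -> tau n = Main b.
  by move=> n /cst en; have := I n; rewrite en => -[].
elim: n => [|n IH]; first by rewrite leqn0 => /eqP <-.
rewrite leq_eqVlt => /orP[/eqP <-//|]; rewrite ltnS => Nn; have en := IH Nn.
have := step n; have := I n; rewrite en /= => -[Gn _] [[]//|[nG sP [c bc [V hV]]]].
rewrite -preS.
have Tn1 : T (rcons (pre x n) (x n)).
  by rewrite -preS; apply: qs_sub switch_qs _ (ex_intro _ _ (htau n.+1)).
have [|_ /(_ _ bc)] := (hGopp sw) Gn _ sP Tn1 nG; first by rewrite size_pre.
rewrite -preS => cg h; exfalso.
have := aftC _ _ _ _ _ cg (ext_refl _) (leqW Nn) (tree_root ((hCGtree sw) cg)) erefl h.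
exact: noC.
Qed.

End Switch.

(** * Unraveling Borel sets *)

(** Martin's coverings. Positions of length at most [N] are only renamed, by [iota]. In [cov_strat]
    the second clause makes [phi] act level by level, so that infinitely many coverings can be
    composed, and the last one lifts every play consistent with [phi S'] to a play consistent with
    [S']. *)
Record covering (N : nat) (A A' : Type) (T : seq A -> Prop) (T' : seq A' -> Prop)
    (pi : A' -> A) (iota : A -> A') : Prop := Covering {
  cov_pi : forall s, T' s -> T (map pi s);
  cov_iota : cancel iota pi;
  cov_up : forall s, size s <= N -> T s -> T' (map iota s);
  cov_low : forall s, size s <= N -> T' s -> s = map iota (map pi s);
  cov_strat : forall P, exists phi : (seq A' -> Prop) -> seq A -> Prop,
    [/\ forall S', qsat P [::] T' S' -> qsat P [::] T (phi S'),
      forall n S1 S2, qsat P [::] T' S1 -> qsat P [::] T' S2 ->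
        (forall s, size s <= n -> S1 s <-> S2 s) ->
        forall s, size s <= n -> phi S1 s <-> phi S2 s,
      forall S' s, qsat P [::] T' S' -> size s <= N ->
        (phi S' s <-> S' (map iota s))
    & forall S' x, qsat P [::] T' S' -> (forall n, phi S' (pre x n)) ->
        exists2 x' : nat -> A', forall n, S' (pre x' n) & forall n, pi (x' n) = x n] }.

(** * Unraveling one closed set *)

Section ClosedUnraveling.
Context {A : Type} (T K : seq A -> Prop) (N : nat).
Hypothesis hT : tree_at [::] T.
Hypothesis evenN : odd N = false.

(* At move [N] player I commits to a quasi-strategy [AI S]; at move [N + 1]
   player II either names a position [u] where the play leaves the closed set
   ([AU u]) or commits to a quasi-strategy staying in it ([AII S']). *)
Inductive aux := ANone | AI of (seq A -> Prop) | AU of seq A | AII of (seq A -> Prop).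

Implicit Types (s u : seq A) (o : aux) (b : aux * aux).

Definition axf o1 o2 j := if j == N then o1 else if j == N.+1 then o2 else ANone.

(** A position of the new game is a position of [T] with at most two commitments, stored in the
    moves [N] and [N.+1]; written this way, the commitments can be exchanged while [s] is kept. *)
Definition lift s o1 o2 : seq (A * aux) := zip s (mkseq (axf o1 o2) (size s)).

Lemma lift_rcons s a o1 o2 :
  lift (rcons s a) o1 o2 = rcons (lift s o1 o2) (a, axf o1 o2 (size s)).
Proof. by rewrite /lift size_rcons mkseqS zip_rcons ?size_mkseq. Qed.

Lemma map_lift s o1 o2 : map fst (lift s o1 o2) = s.
Proof. by rewrite /lift -/(unzip1 _) unzip1_zip ?size_mkseq. Qed.

Lemma size_lift s o1 o2 : size (lift s o1 o2) = size s.
Proof. by rewrite -(size_map fst) map_lift. Qed.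

Lemma lift_id s o1 o2 : size s <= N -> lift s o1 o2 = map (fun a => (a, ANone)) s.
Proof.
elim/last_ind: s => [|s a IH]//; rewrite size_rcons => sN.
by rewrite lift_rcons map_rcons IH ?(ltnW sN)// /axf !ltn_eqF// ltnW.
Qed.

Lemma lift_eq s o1 o2 o1' o2' : (N < size s -> o1 = o1') ->
  (N.+1 < size s -> o2 = o2') -> lift s o1 o2 = lift s o1' o2'.
Proof.
elim/last_ind: s => [|s a IH]//; rewrite size_rcons !ltnS => h1 h2.
rewrite !lift_rcons IH//; [|by move=> /ltnW|by move=> /ltnW].
congr (rcons _ (_, _)); rewrite /axf; case: eqP => [e|_].
  by apply: h1; rewrite e.
by case: eqP => // e; apply: h2; rewrite e.
Qed.

Lemma lift_inj s s' o1 o2 o1' o2' : lift s o1 o2 = lift s' o1' o2' ->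
  [/\ s = s', N < size s -> o1 = o1' & N.+1 < size s -> o2 = o2'].
Proof.
move=> e; have es : s = s' by rewrite -(map_lift s o1 o2) e map_lift.
subst s'; have /(congr1 (nth ANone)) e2 : mkseq (axf o1 o2) (size s) = mkseq (axf o1' o2') (size s).
  have := congr1 unzip2 e; rewrite /lift !unzip2_zip ?size_mkseq//.
by split=> // h; [have := congr1 (fun f => f N) e2|have := congr1 (fun f => f N.+1) e2];
  rewrite !nth_mkseq// /axf ?eqxx// (gtn_eqF (ltnSn N)).
Qed.

Definition ok1 s o1 : Prop := exists2 S, o1 = AI S & qsat false (take N.+1 s) T S.

(** The announcement decides the play: after [AU u] only positions comparable with [u], which lies
    outside [K], are legal, and after [AII S'] the play stays in [S'], hence in [K]. *)
Definition ok2 s o1 o2 : Prop := exists2 S, o1 = AI S &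
  (exists u, [/\ o2 = AU u, S u, ext (take N.+2 s) u, ~ K u & ext s u \/ ext u s]) \/
  (exists S', [/\ o2 = AII S', qsat true (take N.+2 s) S S',
     forall t, S' t -> K t & S' s]).

Definition cond s o1 o2 : Prop :=
  [/\ T s, N < size s -> ok1 s o1 & N.+1 < size s -> ok2 s o1 o2].

Definition cT (s' : seq (A * aux)) : Prop :=
  exists s o1 o2, s' = lift s o1 o2 /\ cond s o1 o2.

Lemma cT_lift s o1 o2 : cT (lift s o1 o2) <-> cond s o1 o2.
Proof.
split=> [[s' [p1 [p2 [/lift_inj[-> h1 h2] [Ts k1 k2]]]]]|h]; last first.
  by exists s, o1, o2.
split=> // sN; first by have := k1 sN; rewrite -h1.
by have := k2 sN; rewrite -h1 -?h2// ltnW.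
Qed.

Lemma cond_rcons s a o1 o2 : cond (rcons s a) o1 o2 -> cond s o1 o2.
Proof.
move=> [Ta k1 k2]; split.
- by apply: tree_rcons hT _ _ _ Ta; rewrite /ext take0.
- move=> sN; have [|S e hS] := k1; first by rewrite size_rcons ltnW.
  by exists S => //; move: hS; rewrite take_rcons_le.
- move=> sN; have [|S e hS] := k2; first by rewrite size_rcons ltnW.
  exists S => //; case: hS => [[u [-> Su eu Ku eus]]|[S' [-> hS' S'K S's]]].
    left; exists u; split=> //; first by move: eu; rewrite take_rcons_le.
    case: eus => e'; first by left; apply: ext_rconsl e'.
    case: (ext_rcons_inv e') => [->|]; [left; exact: ext_rcons (ext_refl _)|by right].
  right; exists S'; rewrite take_rcons_le// in hS'; split => //.
  apply: qs_rcons hS' _ _ (ext_take _ _) S's.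
Qed.

Lemma hT_at s : T s -> tree_at s T.
Proof. by move=> Ts; apply: tree_atW hT Ts (ext0 s). Qed.

Lemma triv_qs P s : T s -> qsat P s T (fun t => T t /\ ext s t).
Proof.
move=> Ts; split=> [t []//|t []//||t a st [Ta _]|t [Tt st] _|t a [Tt st] _ Ta].
- by split=> //; exact: ext_refl.
- by split=> //; apply: tree_rcons hT _ _ (ext0 _) Ta.
- by have [a Ta] := tree_pruned hT (ext0 _) Tt; exists a; split=> //; exact: ext_rcons.
- by split => //; exact: ext_rcons.
Qed.

Lemma ok1_tree s S : N.+1 <= size s -> qsat false (take N.+1 s) T S -> S (take N.+2 s) ->
  tree_at (take N.+2 s) S.
Proof.
move=> sN hS Ss; apply: tree_atW (qsat_tree _ hS) Ss _.
  exact/hT_at/(qs_sub hS)/(qs_root hS).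
rewrite /ext size_takel// take_takel//.
Qed.

Lemma size_ge_take n s : size s = n -> take n s = s.
Proof. by move=> <-; exact: take_size. Qed.

(** At the lengths [N] and [N.+1] a legal commitment has to be found: for player I all of [T] above
    the position, for player II a position outside [K] if [S] contains one, and else all of [S]
    above the position. *)
Lemma cond_ext s o1 o2 : cond s o1 o2 ->
  exists a o1' o2', cond (rcons s a) o1' o2' /\ lift s o1' o2' = lift s o1 o2.
Proof.
move=> [Ts k1 k2].
have [sN|sN] := ltnP (size s) N.
  have [a Ta] := tree_pruned hT (ext0 _) Ts; exists a, o1, o2; split=> //.
  by split => //; rewrite size_rcons !ltnS leqNgt ?(ltnW sN) ?sN// ltnW// (leq_trans _ (leqnSn _)).
move: sN; rewrite leq_eqVlt => /orP[/eqP sN|sN].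
  have [a Ta] := tree_pruned hT (ext0 _) Ts.
  exists a, (AI (fun t => T t /\ ext (rcons s a) t)), ANone; split; last first.
    by apply: lift_eq => //; rewrite -sN ?ltnn// ltnNge leqnSn.
  split=> //; last by rewrite size_rcons -sN ltnn.
  move=> _.
  by eexists; first reflexivity; rewrite take_oversize ?size_rcons -?sN//; exact: triv_qs.
have [S eS hS] := k1 sN.
move: sN; rewrite leq_eqVlt => /orP[/eqP sN|sN].
  have es : take N.+1 s = s by rewrite sN take_size.
  have [a Ta] := tree_pruned hT (ext0 _) Ts.
  have Sa : S (rcons s a).
    by apply: (qs_opp hS _ _ Ta); rewrite -?sN /= ?evenN// -{1}es; exact: qs_root hS.
  have ea : take N.+2 (rcons s a) = rcons s a by rewrite sN -(size_rcons s a) take_size.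
  have hSa : tree_at (rcons s a) S.
    rewrite -ea; apply: ok1_tree; rewrite ?ea ?size_rcons -?sN//.
    by rewrite take_rcons_le ?sN// -?sN.
  have [[u [Su au Ku]]|nex] := pselect (exists u, [/\ S u, ext (rcons s a) u & ~ K u]).
    exists a, o1, (AU u); split; last by apply: lift_eq => //; rewrite -sN ltnn.
    split=> // _; first by exists S => //; rewrite take_rcons_le// -sN.
    exists S => //; left; exists u; rewrite ea; split=> //; by left.
  exists a, o1, (AII (fun t => S t /\ ext (rcons s a) t)).
  split; last by apply: lift_eq => //; rewrite -sN ltnn.
  split=> // _; first by exists S => //; rewrite take_rcons_le// -sN.
  exists S => //; right; eexists; split; [reflexivity| | |by split=> //; exact: ext_refl].
    rewrite ea; split=> [t []//|t []//||t b st [Tb _]|t [Tt st] _|t b [Tt st] _ Tb].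
    - by split=> //; exact: ext_refl.
    - by split=> //; apply: tree_rcons hSa _ _ st Tb.
    - have [b Tb] := tree_pruned hSa st Tt; exists b; split => //; exact: ext_rcons.
    - by split => //; exact: ext_rcons.
  by move=> t [St st]; apply: contrapT => Kt; apply: nex; exists t.
have [S1 eS1 hS1] := k2 sN.
have eSS : S1 = S by move: eS1; rewrite eS => -[].
subst S1; move: hS1.
have st1 a : take N.+1 (rcons s a) = take N.+1 s by rewrite take_rcons_le// ltnW.
have st2 a : take N.+2 (rcons s a) = take N.+2 s by rewrite take_rcons_le.
case=> [[u [eo Su eu Ku]]|[S' [eo hS' S'K S's]]]; last first.
  have [a Ta] : exists a, S' (rcons s a).
    have hSt : tree_at (take N.+2 s) S.
      apply: ok1_tree => //; first exact: ltnW.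
      exact: qs_sub hS' _ (qs_root hS').
    exact: (tree_pruned (qsat_tree hSt hS') (ext_take _ _) S's).
  exists a, o1, o2; split=> //; split=> [|_|_].
  - exact: qs_sub hS _ (qs_sub hS' Ta).
  - by exists S => //; rewrite st1.
  - by exists S => //; right; exists S'; rewrite st2.
case=> [su|us].
  have [su'|us] := ltnP (size s) (size u); last first.
    have us' : u = s.
      by rewrite -[RHS]su take_oversize.
    have [a Ta] := tree_pruned hT (ext0 _) Ts; exists a, o1, o2; split=> //.
    split=> // _; first by exists S => //; rewrite st1.
    exists S => //; left; exists u; rewrite st2; split=> //; right.
    by rewrite us'; apply: ext_rcons (ext_refl _).
  have [a0 _] := tree_pruned hT (ext0 _) Ts.
  set a := nth a0 u (size s).
  have ea : rcons s a = take (size s).+1 u by rewrite (take_nth a0)// su.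
  exists a, o1, o2; split=> //; split=> [|_|_].
  - by rewrite ea; apply: tree_at_take hT (ext0 _) (qs_sub hS Su) _.
  - by exists S => //; rewrite st1.
  - exists S => //; left; exists u; rewrite st2; split=> //; left.
    by rewrite ea; apply: ext_take.
have [a Ta] := tree_pruned hT (ext0 _) Ts; exists a, o1, o2; split=> //.
split=> // _; first by exists S => //; rewrite st1.
by exists S => //; left; exists u; rewrite st2; split=> //; right; exact: ext_rcons.
Qed.

Lemma cT_rcons_inv (s' : seq (A * aux)) p : cT (rcons s' p) ->
  exists s a o1 o2, [/\ s' = lift s o1 o2, p = (a, axf o1 o2 (size s)) & cond (rcons s a) o1 o2].
Proof.
move=> [s [ o1 [ o2 [e h]]]]; case: (lastP s) e h => [|s1 a] e h.
  by move/(congr1 size): e; rewrite size_rcons.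
by move: e; rewrite lift_rcons => /rcons_inj[-> ->]; exists s1, a, o1, o2.
Qed.

Lemma cT_tree : tree_at [::] cT.
Proof.
split.
- by exists [::], ANone, ANone; split=> //; split=> //; exact: tree_root hT.
- move=> s' p _ h; have [s [a [ o1 [ o2 [-> _ c]]]]] := cT_rcons_inv h.
  by exists s, o1, o2; split=> //; exact: cond_rcons c.
- move=> s' _ [s [ o1 [ o2 [-> c]]]]; have [a [ o1' [ o2' [h e]]]] := cond_ext c.
  by exists (a, axf o1' o2' (size s)); rewrite -e -lift_rcons; apply/cT_lift.
Qed.


Section Transfer.
Variables (P : bool) (S' : seq (A * aux) -> Prop).
Hypothesis hS' : qsat P [::] cT S'.

Lemma S'_cond s o1 o2 : S' (lift s o1 o2) -> cond s o1 o2.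
Proof. by move=> h; apply/cT_lift/(qs_sub hS'). Qed.

Lemma S'_take s o1 o2 n : S' (lift s o1 o2) -> S' (lift (take n s) o1 o2).
Proof.
elim/last_ind: s => [|s a IH] h; first by [].
have [sn|ns] := leqP (size (rcons s a)) n; first by rewrite take_oversize.
rewrite size_rcons ltnS in ns; rewrite take_rcons_le//; apply: IH.
rewrite lift_rcons in h.
exact: (qs_rcons hS' (ext0 _) h).
Qed.

Lemma S'_own s o1 o2 : S' (lift s o1 o2) -> odd (size s) = P ->
  exists a o1' o2', [/\ S' (lift (rcons s a) o1' o2'), N < size s -> o1' = o1
    & N.+1 < size s -> o2' = o2].
Proof.
move=> h sP; have [|p hp] := qs_own hS' h; first by rewrite size_lift.
have [s1 [a [ o1' [ o2' [e ep c]]]]] := cT_rcons_inv (qs_sub hS' hp).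
have [es e1 e2] := lift_inj e; subst s1.
by exists a, o1', o2'; split=> [|/e1|/e2]//; rewrite lift_rcons -e -ep.
Qed.

Lemma S'_opp s a o1 o2 : S' (lift s o1 o2) -> odd (size s) <> P ->
  cond (rcons s a) o1 o2 -> S' (lift (rcons s a) o1 o2).
Proof.
move=> h sP c; rewrite lift_rcons; apply: (qs_opp hS' h).
  by rewrite size_lift.
by rewrite -lift_rcons; apply/cT_lift.
Qed.

(** Under the commitment [AU u] the rules leave the owner of [S'] no move away from [u], and the
    opponent's moves along [u] are legal, so [S'] contains [u]. Player II announces [u] himself, so
    for [P = true] the given position must already include the move [N.+1]. *)
Lemma S'_follow S u j0 : N.+1 <= j0 -> j0 <= size u ->
  (P = true -> N.+2 <= j0) ->
  S' (lift (take j0 u) (AI S) (AU u)) -> qsat false (take N.+1 u) T S ->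
  S u -> ~ K u -> N.+2 <= size u -> S' (lift u (AI S) (AU u)).
Proof.
move=> Nj ju hP h hS Su Ku Nu.
suff main d : j0 + d <= size u -> S' (lift (take (j0 + d) u) (AI S) (AU u)).
  by have := main (size u - j0); rewrite subnKC// take_size; apply.
elim: d => [|d IH]; first by rewrite addn0.
rewrite addnS => jd; have {IH} := IH (ltnW jd); set j := j0 + d in jd *.
have Nj' : N < j by rewrite (leq_trans Nj)// leq_addr.
move=> hj; have [a0 _] := tree_pruned hT (ext0 _) (qs_sub hS Su).
set a := nth a0 u j.
have ea : take j.+1 u = rcons (take j u) a by rewrite (take_nth a0).
have sj : size (take j u) = j by rewrite size_takel// ltnW.
have t1 : take N.+1 (take j.+1 u) = take N.+1 u by rewrite take_takel// ltnW.
have t2 : N.+2 <= j.+1 -> take N.+2 (take j.+1 u) = take N.+2 u by move=> ?; rewrite take_takel.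
have cj : cond (take j.+1 u) (AI S) (AU u).
  split=> [||_]; first by apply: tree_at_take hT (ext0 _) (qs_sub hS Su) _.
    by move=> _; exists S => //; rewrite t1.
  exists S => //; left; exists u; rewrite t2//; split => //; first exact: ext_take.
  by left; exact: ext_take.
have [oj|oj] := pselect (odd j = P); last first.
  by rewrite ea; apply: S'_opp => //; rewrite ?sj// -ea.
(* A position of the odd length [N.+1] belongs to player II, and for him [hP] starts later. *)
have Nj2 : N.+1 < j.
  rewrite ltn_neqAle Nj' andbT; move: oj hP; case: P => oj hP; last first.
    by apply/eqP => e; move: oj; rewrite -e /= evenN.
  by rewrite neq_ltn (leq_trans (hP erefl))// leq_addr.
have [|a' [ o1' [ o2' [h']]]] := S'_own hj; first by rewrite sj.
rewrite sj => /(_ (ltnW Nj2)) e1 /(_ Nj2) e2; subst o1' o2'.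
suff -> : take j.+1 u = rcons (take j u) a' by [].
have [_ _] := S'_cond h'; rewrite size_rcons sj => /(_ _)[|S1 _]; first by rewrite ltnS ltnW.
case=> [[u1 [[<-] _ _ _ [eu|eu]]]|[S2 [//]]].
  by move: eu; rewrite /ext size_rcons sj.
have := ext_size eu; rewrite size_rcons sj => uj.
have eju : j.+1 = size u by apply/eqP; rewrite eqn_leq jd uj.
have eau : rcons (take j u) a' = u.
  by have := eu; rewrite /ext take_oversize ?size_rcons ?sj ?eju.
by rewrite eau eju take_size.
Qed.

Lemma lift_branch b x n0 : (forall n, n0 <= n -> S' (lift (pre x n) b.1 b.2)) ->
  exists2 x' : nat -> A * aux, forall n, S' (pre x' n) & forall n, fst (x' n) = x n.
Proof.
move=> h; exists (fun n => (x n, axf b.1 b.2 n)) => // n.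
have -> : pre (fun n => (x n, axf b.1 b.2 n)) n = lift (pre x n) b.1 b.2.
  by elim: n => [|n IH]//; rewrite !preS lift_rcons IH size_pre.
rewrite -(take_pre x (leq_maxl n n0)); apply: S'_take; apply: h; exact: leq_maxr.
Qed.

Lemma simr_id (Tag : Type) (t0 : Tag) J s :
  (forall s t, simr T t0 J s t -> size s <= N -> t = t0 /\ S' (lift s ANone ANone)) ->
  (forall s a, size s < N ->
    J s t0 a = fun t => t = t0 /\ S' (lift (rcons s a) ANone ANone)) ->
  size s <= N -> (exists t, simr T t0 J s t) <-> S' (map (fun a => (a, ANone)) s).
Proof.
move=> h1 h2 sN; split=> [[t /h1/(_ sN)[_]]|]; first by rewrite lift_id.
rewrite -(lift_id ANone ANone)// => h; exists t0.
elim/last_ind: s sN h => [|s a IH]; first by move=> _ _; exact: simr_nil.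
rewrite size_rcons => sN h.
have hs := h; rewrite lift_rcons in hs; have {}hs := qs_rcons hS' (ext0 _) hs.
have [Ta _ _] := S'_cond h.
have [|t' et ht] := @epsoP _ (J s t0 a); first by exists t0; rewrite h2.
have ett : t' = t0 by move: et; rewrite h2// => -[].
by subst t'; apply: (simr_rcons (IH (ltnW sN) hs) Ta).
Qed.

End Transfer.

Lemma T_opp_cond_AU s a S u : cond s (AI S) (AU u) -> T (rcons s a) -> ext u s ->
  N.+1 < size s -> cond (rcons s a) (AI S) (AU u).
Proof.
move=> [_ k1 k2] Ta us sN; split=> // _.
  by have [S1 e hS] := k1 (ltnW sN); exists S1 => //; rewrite take_rcons_le// ltnW.
have [S1 e h] := k2 sN; exists S1 => //; rewrite take_rcons_le//.
case: h => [[u1 [eu Su eu1 Ku _]]|[S2 [//]]].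
case: eu => eu; subst u1; left; exists u; split => //; right; exact: ext_rcons.
Qed.

(** * Transfer of the strategies of player I *)

Section TransferI.
Variable S' : seq (A * aux) -> Prop.

Definition nowinI S q := nowin false S (fun t => ~ K t) q.

Definition GI b s : Prop := S' (lift s b.1 b.2) /\
  ((exists S u, b = (AI S, AU u) /\ ext u s) \/
   (exists S, b = (AI S, AII (nowinI S (take N.+2 s))))).

Local Notation Pre := (@Pre A (aux * aux) (seq A -> Prop)).
Local Notation Main := (@Main A (aux * aux) (seq A -> Prop)).

Definition xmI (c : seq A -> Prop) u b : Prop := ~ K u /\ b = (AI c, AU u).

Definition arriveI := arrive false id (fun=> (fun t => ~ K t)) xmI.

(** At length [N.+1], [S] is picked by [epso] from the position [s] alone, so it is the same for all
    replies [a] of the opponent. *)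
Definition J0I s a (t' : @tag A (aux * aux) (seq A -> Prop)) : Prop :=
  if size s < N then t' = Pre /\ S' (lift (rcons s a) ANone ANone)
  else if size s == N then t' = Pre /\ exists S, S' (lift (rcons s a) (AI S) ANone)
  else exists2 S, epso (fun S => S' (lift s (AI S) ANone)) = Some S &
    if pselect (Win false S (fun t => ~ K t) (rcons s a)) then arriveI S (rcons s a) t'
    else t' = Main (AI S, AII (nowinI S (rcons s a))).

Definition JI := switchJ false GI id (fun=> (fun t => ~ K t)) xmI
  (fun b c => b.1 = AI c) J0I.

Definition phiI s : Prop := exists t, simr T Pre JI s t.

Definition I0I s : Prop := [/\ size s <= N.+1,
  size s <= N -> S' (lift s ANone ANone) &
  size s = N.+1 -> exists S, S' (lift s (AI S) ANone)].

Definition CGI (c : seq A -> Prop) q : Prop :=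
  [/\ N.+2 <= size q, S' (lift (take N.+1 q) (AI c) ANone) & c q].

Definition FI b : Prop := exists S u, b = (AI S, AU u).

Hypothesis hS' : qsat false [::] cT S'.

Lemma CGI_qs c q : CGI c q -> qsat false (take N.+1 q) T c.
Proof.
move=> [Nq h _]; have [_ k1 _] := S'_cond hS' h.
have [|S [<-] hS] := k1; first by rewrite size_takel ?(ltnW Nq).
by rewrite take_takel in hS.
Qed.

Lemma CGI_tree c q : CGI c q -> tree_at q c.
Proof.
move=> cg; have hc := CGI_qs cg; case: cg => Nq _ cq.
apply: (tree_atW _ cq (ext_take _ _)); apply: (qsat_tree _ hc).
exact/hT_at/(qs_sub hc)/(qs_root hc).
Qed.

Lemma switchableI : switchable false T GI id (fun=> (fun t => ~ K t)) xmI
  (fun b c => b.1 = AI c) J0I I0I CGI FI N.+2.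
Proof.
have xmG c q u b : CGI c q -> ext q u -> N.+2 <= size u -> c u -> xmI c u b -> GI b u /\ FI b.
  move=> cg qu Nu cu [Ku ->]; split; last by exists c, u.
  split; last by left; exists c, u; split => //; exact: ext_refl.
  case: (cg) => Nq hq cq.
  have tq : take N.+1 u = take N.+1 q by rewrite -[in RHS]qu take_takel// ltnW.
  (* At length [N.+1] the second commitment is not yet visible, so the position can be continued as
     if [u] had been announced. *)
  apply: (S'_follow hS' (leqnn _)) => //; first exact: ltnW.
    rewrite tq; suff -> : lift (take N.+1 q) (AI c) (AU u) = lift (take N.+1 q) (AI c) ANone by [].
    by apply: lift_eq => //; rewrite size_takel ?ltnn// ltnW.
  by rewrite tq; exact: CGI_qs.
split.
- split=> // _; exact: (qs_root hS').
- move=> s [sN h1 h2] sP.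
  have {}sN : size s <= N.
    by move: sN; rewrite leq_eqVlt => /orP[/eqP e|//]; move: sP; rewrite e /= evenN.
  have [a [ o1 [ o2 [h _ _]]]] := S'_own hS' (h1 sN) sP.
  have [Ta k1 _] := S'_cond hS' h.
  rewrite /J0I; move: sN; rewrite leq_eqVlt => /orP[/eqP sN|sN].
    exists a, Pre; split=> //; rewrite sN ltnn eqxx; split => //.
    have [|S e _] := k1; first by rewrite size_rcons sN.
    exists S; suff -> : lift (rcons s a) (AI S) ANone = lift (rcons s a) o1 o2 by [].
    by apply: lift_eq => //; rewrite size_rcons sN ltnn.
  exists a, Pre; split=> //; rewrite sN; split => //.
  suff -> : lift (rcons s a) ANone ANone = lift (rcons s a) o1 o2 by [].
  by rewrite !lift_id// size_rcons.
- move=> s a [sN h1 h2] sP Ta.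
  rewrite /J0I; case: (ltnP (size s) N) => [sN'|Ns].
    exists Pre; split=> //; have := h1 (ltnW sN').
    move=> h; apply: (S'_opp hS') => //.
    by split=> //; rewrite size_rcons ltnS leqNgt ?sN'// ltnW// ltnW.
  case: eqP => [e|/eqP ne]; first by move: sP; rewrite e evenN.
  have {}sN : size s = N.+1.
    by apply/eqP; rewrite eqn_leq sN ltn_neqAle eq_sym ne Ns.
  have [S hs e] := epsoP (h2 sN).
  have [W|W] := pselect (Win false S (fun t => ~ K t) (rcons s a)); last first.
    by eexists; exists S => //; case: pselect.
  have Sa : S (rcons s a).
    have [_ k1 _] := S'_cond hS' hs; have [|S1 [<-] hS] := k1; first by rewrite sN.
    by apply: (qs_opp hS _ _ Ta) => //; have := qs_root hS; rewrite size_ge_take.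
  have cg : CGI S (rcons s a).
    by split=> //; rewrite ?size_rcons ?sN// take_rcons_le ?sN// size_ge_take.
  have [V hV] := Win_strat (CGI_tree cg) W.
  have [||t' ht] := aft_ex (N0 := N.+2) (OC := fun=> (fun t => ~ K t)) (xm := xmI) (CG := CGI) (TC := id) V _ cg (ext_refl _) Sa _.
    + by move=> c q u cg' qu Nu cu Ku; exists (AI c, AU u).
    + by rewrite size_rcons sN.
  by exists t', S => //; case: pselect => // W'; exists V.
- move=> s a t' [sN h1 h2] Ta; rewrite /J0I; case: (ltnP (size s) N) => [sN'|Ns].
    move=> [-> h]; split; rewrite ?size_rcons//; first exact: ltnW.
    by case=> e; move: sN'; rewrite e ltnn.
  case: eqP => [e|/eqP ne].
    by move=> [-> h]; split; rewrite ?size_rcons ?e ?ltnn.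
  have {}sN : size s = N.+1.
    by apply/eqP; rewrite eqn_leq sN ltn_neqAle eq_sym ne Ns.
  have saN : size (rcons s a) = N.+2 by rewrite size_rcons sN.
  have ta : take N.+2 (rcons s a) = rcons s a by rewrite size_ge_take.
  move=> [S he]; have hs := epso_some he.
  have [_ k1 _] := S'_cond hS' hs; have [|S1 [eS] hS] := k1; first by rewrite sN.
  subst S1; rewrite size_ge_take// in hS.
  have Sa : S (rcons s a).
    apply: (qs_opp hS _ _ Ta); last by rewrite sN /= evenN.
    exact: qs_root hS.
  have cg : CGI S (rcons s a).
    by split=> //; rewrite ?saN// take_rcons_le ?sN// size_ge_take.
  case: pselect => [W|nW].
    move=> [V hV ha]; apply: (aftI I0I xmG cg (ext_refl _) Sa _ hV _ _ ha); rewrite ?saN//.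
    + exact: qs_root hV.1.
    + by move=> n; rewrite leqNgt => /negP.
  have hN := nowin_qs (CGI_tree cg) nW.
  move=> ->; split; last by rewrite saN.
  split; last by right; exists S; rewrite ta.
  have -> : lift (rcons s a) (AI S) (AII (nowinI S (rcons s a))) =
     rcons (lift s (AI S) ANone) (a, AII (nowinI S (rcons s a))).
    rewrite lift_rcons /axf sN eqxx (gtn_eqF (ltnSn N)); congr rcons.
    by apply: lift_eq => //; rewrite sN ltnn.
  have c : cond (rcons s a) (AI S) (AII (nowinI S (rcons s a))).
    split=> // _; first by exists S => //; rewrite take_rcons_le ?sN// size_ge_take.
    exists S => //; right; exists (nowinI S (rcons s a)); rewrite ta; split => //.
    + move=> t [_ st nWt]; apply: contrapT => Kt.
      apply: (nWt (size t)); first exact: ext_size.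
      by rewrite take_size; apply: Win_here.
    + exact: qs_root hN.
  apply: (qs_opp hS' hs); first by rewrite size_lift sN /= evenN.
  exists (rcons s a), (AI S), (AII (nowinI S (rcons s a))); split => //.
  rewrite lift_rcons /axf sN eqxx (gtn_eqF (ltnSn N)); congr rcons.
  by apply: lift_eq => //; rewrite sN ltnn.
- by move=> s [].
- move=> b s [hs hb] Ns sP; have [a [ o1 [ o2 [h e1 e2]]]] := S'_own hS' hs sP.
  rewrite e1 ?(ltnW Ns)// e2// in h.
  exists a; first by have [] := S'_cond hS' h.
  split=> //; case: hb => [[S [u [eb us]]]|[S eb]].
    by left; exists S, u; split => //; exact: ext_rcons.
  by right; exists S; rewrite take_rcons_le.
- move=> b s a [hs hb] Ns sP Ta nG.
  have c := S'_cond hS' hs.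
  case: hb => [[S [u [eb us]]]|[S eb]]; subst b => /=.
    case: nG; split; last by left; exists S, u; split => //; exact: ext_rcons.
    by apply: (S'_opp hS' hs sP); apply: T_opp_cond_AU c Ta us Ns.
  have [_ k1 k2] := c; have [|S1 [e1] hS] := k1; first exact: ltnW.
  subst S1; have {k1 k2} [//|S1 [e1] h2] := k2; subst S1.
  case: h2 => [[u [//]]|[S2 [[<-] hS2 S2K [Ss s2 sW]]]].
  have Sa : S (rcons s a) by exact: (qs_opp hS Ss sP Ta).
  split; last first.
    move=> c' [<-]; split=> //; first by rewrite size_rcons ltnW.
    rewrite take_rcons_le; last exact: ltnW.
    have := S'_take hS' N.+1 hs; rewrite (lift_eq (o1' := AI S) (o2' := ANone))//.
    by rewrite size_takel ?ltnn// ltnW.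
  (* If I could not force a way out of [K] after [a], this move would stay in [nowinI]. *)
  exists S => //; apply: contrapT => nW; apply: nG; split; last first.
    by right; exists S; rewrite take_rcons_le.
  apply: (S'_opp hS' hs sP); split=> // _.
    by exists S => //; rewrite take_rcons_le// ltnW.
  exists S => //; right; exists (nowinI S (take N.+2 s)); rewrite take_rcons_le//.
  split => //; split=> //; first exact: ext_rcons.
  move=> n Nn; have [ns|sn] := leqP n (size s).
    by rewrite take_rcons_le//; apply: sW.
  by rewrite take_oversize// size_rcons.
- exact: CGI_tree.
- by move=> c q s /CGI_qs/qs_sub h _; apply: h.
- by move=> c q s a /CGI_qs h _ cs sP Ta; apply: (qs_opp h cs sP Ta).
- by move=> c q u _ _ _ _ Ku; exists (AI c, AU u).
- exact: xmG.
- move=> b s a [S [u eb]] [hs hb] Ns sP Ta; subst b.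
  have us : ext u s by case: hb => [[S1 [u1 [[_ <-] //]]]|[S1 [//]]].
  split; last by left; exists S, u; split => //; exact: ext_rcons.
  by apply: (S'_opp hS' hs sP); apply: (T_opp_cond_AU (S'_cond hS' hs) Ta us Ns).
Qed.

End TransferI.

Lemma phiI_qs S' : qsat false [::] cT S' -> qsat false [::] T (phiI S').
Proof. by move=> h; have := switch_qs hT (switchableI h). Qed.

Lemma phiI_id S' s : qsat false [::] cT S' -> size s <= N ->
  (phiI S' s <-> S' (map (fun a => (a, ANone)) s)).
Proof.
move=> h sN; apply: (simr_id h _ _ sN) => [{}s t hs {}sN|{}s a {}sN].
  have := simr_I (switchableI h) hs; case: t hs => [|b|c V] _ /=.
  - by move=> [_ /(_ sN)].
  - by move=> [_ /ltnW]; rewrite ltnNge sN.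
  - by move=> [q [_ _ _ /ltnW]]; rewrite ltnNge sN.
by apply/funext => t; rewrite /JI /= /J0I sN.
Qed.

Lemma phiI_lift S' x : qsat false [::] cT S' -> (forall n, phiI S' (pre x n)) ->
  exists2 x' : nat -> A * aux, forall n, S' (pre x' n) & forall n, fst (x' n) = x n.
Proof.
move=> h hx; have [b [n0 hb]] := switch_branch hT (switchableI h) hx.
by apply: (lift_branch h (b := b) (n0 := n0)) => n /hb[].
Qed.

Lemma lift_agree n (S1 S2 : seq (A * aux) -> Prop) s o1 o2 :
  (forall s' : seq (A * aux), size s' <= n -> S1 s' <-> S2 s') -> size s <= n ->
  S1 (lift s o1 o2) = S2 (lift s o1 o2).
Proof. by move=> h sn; apply/propext/h; rewrite size_lift. Qed.

Lemma phiI_local n S1 S2 : qsat false [::] cT S1 -> qsat false [::] cT S2 ->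
  (forall s' : seq (A * aux), size s' <= n -> S1 s' <-> S2 s') ->
  forall s, size s <= n -> phiI S1 s <-> phiI S2 s.
Proof.
move=> h1 h2 h12 s sn.
pose t0 := @Pre A (aux * aux) (seq A -> Prop).
suff e t : simr T t0 (JI S1) s t <-> simr T t0 (JI S2) s t.
  by split=> -[t /e ht]; exists t.
apply: (@simr_local _ _ T t0 (JI S1) (JI S2) n) => // {sn}s {}t a sn _; case: t => [|b|c V] //=.
- have sn1 : size (rcons s a) <= n by rewrite size_rcons.
  apply/funext => t'; rewrite /JI /= /J0I.
  rewrite (lift_agree _ _ h12 sn1).
  have -> : (fun S => S1 (lift s (AI S) ANone)) = (fun S => S2 (lift s (AI S) ANone)).
    by apply/funext => S; apply: (lift_agree _ _ h12); apply: ltnW.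
  suff -> : (exists S, S1 (lift (rcons s a) (AI S) ANone)) =
    (exists S, S2 (lift (rcons s a) (AI S) ANone)) by [].
  by congr ex; apply/funext => S; apply: (lift_agree _ _ h12).
- apply/funext => t'; rewrite /JI /=; suff -> : GI S1 b (rcons s a) = GI S2 b (rcons s a) by [].
  by rewrite /GI (lift_agree _ _ h12)// size_rcons.
Qed.

(** * Transfer of the strategies of player II *)

Section TransferII.
Variable S' : seq (A * aux) -> Prop.

(* The positions that some commitment of player I lets II's strategy announce. *)
Definition OII u : Prop := N.+2 <= size u /\
  exists S, S' (lift (take N.+2 u) (AI S) (AU u)).

Definition nowinII q := nowin true T OII q.

(** Player II imagines that I commits to [nowinII], which avoids [OII]; then [S'] cannot announce a
    position and names a quasi-strategy [S]. When I leaves the mode, II forces some [u] in [OII] and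
    then pretends that I had made the commitment to which [S'] answers by announcing [u]. *)
Definition GII b s : Prop := S' (lift s b.1 b.2) /\
  ((exists S u, b = (AI S, AU u) /\ ext u s) \/
   (exists S, b = (AI (nowinII (take N.+1 s)), AII S))).

Local Notation Pre := (@Pre A (aux * aux) unit).
Local Notation Main := (@Main A (aux * aux) unit).

Definition xmII (c : unit) u b : Prop := exists2 S,
  b = (AI S, AU u) & S' (lift (take N.+2 u) (AI S) (AU u)).

Definition J0II s a (t' : @tag A (aux * aux) unit) : Prop :=
  if size s < N then t' = Pre /\ S' (lift (rcons s a) ANone ANone)
  else if size s == N then t' = Pre
  else if pselect (Win true T OII s) then
    exists2 V, winstrat true T OII s V /\ V (rcons s a) & aft (fun=> OII) xmII tt (rcons s a) V t'
  else exists2 S, t' = Main (AI (nowinII s), AII S) & S' (lift (rcons s a) (AI (nowinII s)) (AII S)).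

Definition JII := switchJ true GII (fun=> T) (fun=> OII) xmII (fun _ _ => True) J0II.

Definition phiII s : Prop := exists t, simr T Pre JII s t.

Definition I0II s : Prop := [/\ size s <= N.+1, T s &
  S' (lift (take N s) ANone ANone)].

Definition CGII (c : unit) q : Prop := T q.

Hypothesis hS' : qsat true [::] cT S'.

Lemma OII_follow S u : S' (lift (take N.+2 u) (AI S) (AU u)) -> N.+2 <= size u ->
  S' (lift u (AI S) (AU u)) /\ S u.
Proof.
move=> h Nu; have [_ k1 k2] := S'_cond hS' h.
have su : size (take N.+2 u) = N.+2 by rewrite size_takel.
have [|S1 [e] hS] := k1; first by rewrite su.
subst S1; have {k1 k2} [|S1 [e] h2] := k2; first by rewrite su.
subst S1; rewrite take_takel// in hS.
case: h2 => [[u1 [[eu] Su _ Ku _]]|[S2 [//]]]; subst u1.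
split=> //; exact: (S'_follow hS' _ Nu _ h hS Su Ku Nu).
Qed.

Lemma switchableII : switchable true T GII (fun=> T) (fun=> OII) xmII
  (fun _ _ => True) J0II I0II CGII FI N.+2.
Proof.
have xmG c q u b : CGII c q -> ext q u -> N.+2 <= size u -> T u -> xmII c u b -> GII b u /\ FI b.
  move=> cg qu Nu cu [S -> h]; split; last by exists S, u.
  have [h' _] := OII_follow h Nu.
  by split=> //; left; exists S, u; split => //; exact: ext_refl.
have hxm c q u : CGII c q -> ext q u -> N.+2 <= size u -> T u -> OII u -> exists b, xmII c u b.
  by move=> _ _ _ _ [_ [S h]]; exists (AI S, AU u), S.
split.
- by split=> //; [exact: tree_root hT|exact: (qs_root hS')].
- move=> s [sN Ts hs] sP.
  rewrite /J0II; case: (ltnP (size s) N) => [sN'|Ns].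
    rewrite take_oversize in hs; last exact: ltnW.
    have [a [ o1 [ o2 [h _ _]]]] := S'_own hS' hs sP.
    have [Ta k1 _] := S'_cond hS' h.
    exists a, Pre; split=> //; split => //.
    suff -> : lift (rcons s a) ANone ANone = lift (rcons s a) o1 o2 by [].
    by rewrite !lift_id// size_rcons.
  case: eqP => [e|/eqP ne]; first by move: sP; rewrite e evenN.
  have {}sN : size s = N.+1.
    by apply/eqP; rewrite eqn_leq sN ltn_neqAle eq_sym ne Ns.
  case: pselect => [W|nW].
    have [V hV] := Win_strat (hT_at Ts) W.
    have [a Va] := qs_own hV.1 (qs_root hV.1) sP; have Ta := qs_sub hV.1 Va.
    have [|t' ht] := aft_ex (N0 := N.+2) V hxm (c := tt) (Ta : CGII tt _) (ext_refl _) Ta.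
    - by rewrite size_rcons sN.
    by exists a, t'; split=> //; exists V.
  have hN := nowin_qs (hT_at Ts) nW.
  have cs : cond s (AI (nowinII s)) ANone.
    split=> //; last by rewrite sN ltnn.
    by move=> _; exists (nowinII s) => //; rewrite size_ge_take.
  have hs' : S' (lift s (AI (nowinII s)) ANone).
    have [a es] : exists a, s = rcons (take N s) a.
      case/lastP: (s) sN => [//|s1 a]; rewrite size_rcons => -[<-].
      by exists a; rewrite take_rcons_le// take_size.
    have sT : size (take N s) = N by rewrite size_takel// sN.
    move: cs; rewrite {1 3}es; set o1 := AI (nowinII s) => cs.
    apply: (S'_opp hS') cs; last by rewrite sT evenN.
    suff -> : lift (take N s) o1 ANone = lift (take N s) ANone ANone by [].
    by rewrite !lift_id// sT.
  have [a [ o1 [ o2 [h e1 _]]]] := S'_own hS' hs' sP.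
  rewrite e1 ?sN// in h.
  have [Ta _ k2] := S'_cond hS' h.
  exists a; have [|S1 [e] h2] := k2; first by rewrite size_rcons sN.
  subst S1; case: h2 => [[u [eo Su eu Ku _]]|[S2 [eo _ _ _]]]; subst o2; last first.
    by exists (Main (AI (nowinII s), AII S2)); split => //; exists S2.
  (* An announced [u] would be a position of [nowinII] that lies in [OII]. *)
  exfalso; case: (Su) => Tu su /(_ (size u)); apply; first exact: ext_size.
  rewrite take_size; apply: Win_here.
  have ta : take N.+2 (rcons s a) = rcons s a by rewrite size_ge_take// size_rcons sN.
  rewrite ta in eu.
  have su2 : N.+2 <= size u by have := ext_size eu; rewrite size_rcons sN.
  split => //; exists (nowinII s).
  suff -> : take N.+2 u = rcons s a by [].
  by have := eu; rewrite /ext size_rcons sN.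
- move=> s a [sN Ts hs] sP Ta.
  rewrite /J0II; case: (ltnP (size s) N) => [sN'|Ns].
    exists Pre; split => //; rewrite take_oversize in hs; last exact: ltnW.
    apply: (S'_opp hS' hs sP); split => //; rewrite size_rcons ltnS leqNgt ?sN'//.
    by rewrite ltnS ltnW.
  case: eqP => [e|/eqP ne]; first by exists Pre.
  have {}sN : size s = N.+1.
    by apply/eqP; rewrite eqn_leq sN ltn_neqAle eq_sym ne Ns.
  by move: sP; rewrite sN /= evenN.
- move=> s a t' [sN Ts hs] Ta; rewrite /J0II; case: (ltnP (size s) N) => [sN'|Ns].
    move=> [-> h]; split=> //; rewrite ?size_rcons ?ltnS ?(ltnW sN')//.
    by rewrite take_oversize// size_rcons.
  case: eqP => [e|/eqP ne].
    move=> ->; split => //; rewrite ?size_rcons ?e// take_rcons_le ?e//.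
  have {}sN : size s = N.+1.
    by apply/eqP; rewrite eqn_leq sN ltn_neqAle eq_sym ne Ns.
  case: pselect => [W|nW].
    move=> [V [hV Va] ha].
    apply: (aftI I0II xmG (Ts : CGII tt s) _ Ta _ hV Va _ ha).
    - exact: ext_rcons (ext_refl _).
    - by rewrite size_rcons sN.
    - move=> n _; rewrite size_rcons sN ltnS => nN [+ _].
      by rewrite size_take_min leq_min ltnNge nN.
  move=> [S -> h]; split; last by rewrite size_rcons sN.
  by split=> //; right; exists S; rewrite take_rcons_le ?sN// size_ge_take.
- by move=> s [].
- move=> b s [hs hb] Ns sP; have [a [ o1 [ o2 [h e1 e2]]]] := S'_own hS' hs sP.
  rewrite e1 ?(ltnW Ns)// e2// in h.
  exists a; first by have [] := S'_cond hS' h.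
  split=> //; case: hb => [[S [u [eb us]]]|[S eb]].
    by left; exists S, u; split => //; exact: ext_rcons.
  by right; exists S; rewrite (take_rcons_le _ (ltnW Ns)).
- move=> b s a [hs hb] Ns sP Ta nG.
  have c := S'_cond hS' hs; split=> //; exists tt => //.
  case: hb => [[S [u [eb us]]]|[S eb]]; subst b => /=.
    case: nG; split; last by left; exists S, u; split => //; exact: ext_rcons.
    by apply: (S'_opp hS' hs sP); apply: T_opp_cond_AU c Ta us Ns.
  have [_ k1 k2] := c; have [|S1 [e1] hS] := k1; first exact: ltnW.
  subst S1; have {k2} [//|S1 [e1] h2] := k2; subst S1.
  case: h2 => [[u [//]]|[S2 [[<-] hS2 S2K S2s]]].
  apply: contrapT => nW; apply: nG; split; last first.
    by right; exists S; rewrite (take_rcons_le _ (ltnW Ns)).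
  apply: (S'_opp hS' hs sP).
  have tN1 : take N.+1 (rcons s a) = take N.+1 s by rewrite take_rcons_le// ltnW.
  split=> // _; first by eexists; first reflexivity; rewrite tN1.
  eexists; first reflexivity.
  right; exists S; rewrite take_rcons_le//; split => //.
  apply: (qs_opp hS2 S2s sP); have [Ts s1 sW] := qs_sub hS2 S2s.
  split=> //; first exact: ext_rcons.
  move=> n Nn; have [ns|sn] := leqP n (size s).
    by rewrite take_rcons_le//; apply: sW.
  by rewrite take_oversize// size_rcons.
- by move=> c q Tq; exact: hT_at.
- by [].
- by [].
- exact: hxm.
- exact: xmG.
- move=> b s a [S [u eb]] [hs hb] Ns sP Ta; subst b.
  have us : ext u s by case: hb => [[S1 [u1 [[_ <-] //]]]|[S1 [//]]].
  split; last by left; exists S, u; split => //; exact: ext_rcons.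
  by apply: (S'_opp hS' hs sP); apply: (T_opp_cond_AU (S'_cond hS' hs) Ta us Ns).
Qed.

End TransferII.

Lemma phiII_qs S' : qsat true [::] cT S' -> qsat true [::] T (phiII S').
Proof. by move=> h; have := switch_qs hT (switchableII h). Qed.

Lemma phiII_id S' s : qsat true [::] cT S' -> size s <= N ->
  (phiII S' s <-> S' (map (fun a => (a, ANone)) s)).
Proof.
move=> h sN; apply: (simr_id h _ _ sN) => [{}s t hs {}sN|{}s a {}sN].
  have := simr_I (switchableII h) hs; case: t hs => [|b|c V] _ /=.
  - by move=> [_ _]; rewrite take_oversize.
  - by move=> [_ /ltnW]; rewrite ltnNge sN.
  - by move=> [q [_ _ _ /ltnW]]; rewrite ltnNge sN.
by apply/funext => t; rewrite /JII /= /J0II sN.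
Qed.

Lemma phiII_lift S' x : qsat true [::] cT S' -> (forall n, phiII S' (pre x n)) ->
  exists2 x' : nat -> A * aux, forall n, S' (pre x' n) & forall n, fst (x' n) = x n.
Proof.
move=> h hx; have [b [n0 hb]] := switch_branch hT (switchableII h) hx.
by apply: (lift_branch h (b := b) (n0 := n0)) => n /hb[].
Qed.

Lemma phiII_local n S1 S2 : qsat true [::] cT S1 -> qsat true [::] cT S2 ->
  (forall s' : seq (A * aux), size s' <= n -> S1 s' <-> S2 s') ->
  forall s, size s <= n -> phiII S1 s <-> phiII S2 s.
Proof.
move=> h1 h2 h12 s sn.
pose t0 := @Pre A (aux * aux) unit.
suff e t : simr T t0 (JII S1) s t <-> simr T t0 (JII S2) s t.
  by split=> -[t /e ht]; exists t.
(* [OII] contains positions of any length but reads [S'] only at length [N.+2], and it is consulted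
   only for moves that lead to positions of at least this length. *)
have tk (u : seq A) o1 o2 : N.+2 <= n ->
    S1 (lift (take N.+2 u) o1 o2) = S2 (lift (take N.+2 u) o1 o2).
  move=> Nn; apply: (lift_agree _ _ h12).
  by rewrite size_take_min geq_min Nn.
have eO : N.+2 <= n -> OII S1 = OII S2.
  move=> Nn; apply/funext => u; rewrite /OII; congr (_ /\ ex _).
  by apply/funext => S; exact: tk.
have ex : N.+2 <= n -> xmII S1 = xmII S2.
  move=> Nn; apply/funext => c; apply/funext => u; apply/funext => b.
  rewrite /xmII; suff -> : (fun S => S1 (lift (take N.+2 u) (AI S) (AU u))) =
    (fun S => S2 (lift (take N.+2 u) (AI S) (AU u))) by [].
  by apply/funext => S; exact: tk.
apply: (@simr_local _ _ T t0 (JII S1) (JII S2) n) => // {sn}s {}t a sn hst.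
have sn1 : size (rcons s a) <= n by rewrite size_rcons.
have := simr_I (switchableII h1) hst; case: t hst => [|b|c V] _ /= hI; apply/funext => t'.
- rewrite /JII /= /J0II (lift_agree _ _ h12 sn1).
  case: ltnP => // Ns; case: eqP => // /eqP ne.
  have Nn : N.+2 <= n.
    by apply: leq_trans sn; rewrite ltnS ltn_neqAle eq_sym ne.
  rewrite /nowinII (eO Nn) (ex Nn).
  suff -> : (fun S => S1 (lift (rcons s a) (AI (nowin true T (OII S2) s)) (AII S))) =
    (fun S => S2 (lift (rcons s a) (AI (nowin true T (OII S2) s)) (AII S))) by [].
  by apply/funext => S; rewrite (lift_agree _ _ h12).
- have Nn : N.+2 <= n by apply: leq_trans (ltnW sn); case: hI.
  rewrite /JII /= /arrive /aft (ex Nn) (eO Nn).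
  suff -> : GII S1 b (rcons s a) = GII S2 b (rcons s a) by [].
  by rewrite /GII (lift_agree _ _ h12)// /nowinII (eO Nn).
- have Nn : N.+2 <= n by apply: leq_trans (ltnW sn); case: hI => q [].
  by rewrite /JII /= /aft (ex Nn) (eO Nn).
Qed.

(** The first [N.+2] moves contain both commitments, and the kind of the second one decides whether
    the play stays in [K]. *)
Lemma closed_unravel : exists (A' : Type) (T' : seq A' -> Prop) (pi : A' -> A) (iota : A -> A'),
  [/\ covering N T T' pi iota, tree_at [::] T' &
    forall x, (forall n, T' (pre x n)) -> exists n, forall x', (forall m, T' (pre x' m)) ->
      pre x' n = pre x n ->
      ((forall m, K (pre (pi \o x) m)) <-> (forall m, K (pre (pi \o x') m)))].
Proof.
exists (A * aux)%type, cT, fst, (fun a => (a, ANone)); split; last first.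
- have pm (x : nat -> A * aux) m : pre (fst \o x) m = map fst (pre x m).
    by rewrite /pre /mkseq map_comp.
  have dec (x : nat -> A * aux) : (forall n, cT (pre x n)) -> exists o1 o2,
      (forall n, pre x n = lift (pre (fst \o x) n) o1 o2) /\ forall n, cond (pre (fst \o x) n) o1 o2.
    move=> hx; exists (x N).2, (x N.+1).2.
    suff e n : pre x n = lift (pre (fst \o x) n) (x N).2 (x N.+1).2.
      by split=> // n; apply/cT_lift; rewrite -e.
    elim: n => [|n IH] //; rewrite !preS lift_rcons -IH /axf size_pre.
    congr rcons; rewrite (surjective_pairing (x n)); congr pair.
    have [->//|nN] := eqVneq n N; have [->//|nN1] := eqVneq n N.+1.
    have := hx n.+1; rewrite preS => h.
    have [s [a [ o1 [ o2 [e -> _]]]]] := cT_rcons_inv h; rewrite /axf /=.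
    have -> : size s = n by rewrite -(size_pre x n) e size_lift.
    by rewrite (negbTE nN) (negbTE nN1).
  move=> x hx; exists N.+2 => x' hx' exx'.
  have [ o1 [ o2 [ex cx]]] := dec x hx; have [ o1' [ o2' [ex' cx']]] := dec x' hx'.
  have := exx'; rewrite ex ex' => /lift_inj[eN]; rewrite size_pre.
  move=> /(_ (ltnW (ltnSn _))) e1 /(_ (ltnSn _)) e2; subst o1' o2'.
  have tkp (y : nat -> A) : take N.+2 (pre y N.+2) = pre y N.+2.
    by rewrite size_ge_take ?size_pre.
  have [_ _] := cx N.+2; rewrite size_pre => /(_ (ltnSn _))[S eS].
  move=> [[u [eu Su uu Ku _]]|[S2 [eS2 hS2 S2K _]]].
    have bad (y : nat -> A * aux) : (forall n, cond (pre (fst \o y) n) o1 o2) ->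
        ~ (forall m, K (pre (fst \o y) m)).
      move=> cy hK; apply: Ku; have [_ _] := cy (maxn (size u) N.+2).
      rewrite size_pre => /(_ (leq_maxr _ _))[S3 _] [[u3 [eu3 _ _ _ [su|us]]]|[S3' [eS3 _ _ _]]].
      - have eu' : u3 = u by move: eu3; rewrite eu => -[].
        subst u3; have := ext_size su; rewrite size_pre geq_max => /andP[_ Nu].
        move: su; rewrite /ext size_pre (maxn_idPl Nu) take_size => ->; exact: hK.
      - have eu' : u3 = u by move: eu3; rewrite eu => -[].
        subst u3; move: us; rewrite /ext take_pre ?leq_maxl// => <-; exact: hK.
      - by move: eS3; rewrite eu.
    by split=> h; exfalso; [exact: (bad x)|exact: (bad x')].
  have good (y : nat -> A * aux) : (forall n, cond (pre (fst \o y) n) o1 o2) ->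
      forall m, N.+2 <= m -> K (pre (fst \o y) m).
    move=> cy m Nm; have [_ _] := cy m; rewrite size_pre => /(_ Nm)[S3 _].
    case=> [[u3 [eu3]]|[S3' [eS3 _ + +]]]; first by move: eu3; rewrite eS2.
    by move=> h /h.
  have low m : m <= N.+2 -> pre (fst \o x) m = pre (fst \o x') m.
    by move=> mN; rewrite -!(take_pre _ mN) eN.
  split=> h m; have [mN|/ltnW Nm] := leqP m N.+2.
  - by rewrite -low.
  - exact: good.
  - by rewrite low.
  - exact: good.
- exact: cT_tree.
split.
- by move=> s [s' [ o1 [ o2 [-> [Ts _ _]]]]]; rewrite map_lift.
- by [].
- move=> s sN Ts; rewrite -(lift_id ANone ANone sN); apply/cT_lift; split => // h.
    by move: sN; rewrite leqNgt h.
  by move: sN; rewrite leqNgt (ltnW h).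
- move=> s sN [s' [ o1 [ o2 [e _]]]]; rewrite e map_lift lift_id//.
  by rewrite -(size_lift s' o1 o2) -e.
- case.
    exists phiII; split; [exact: phiII_qs|exact: phiII_local|exact: phiII_id|exact: phiII_lift].
  exists phiI; split; [exact: phiI_qs|exact: phiI_local|exact: phiI_id|exact: phiI_lift].
Qed.

End ClosedUnraveling.

Lemma down_ind (Q : nat -> Prop) : (forall j, Q j.+1 -> Q j) ->
  forall i j, j <= i -> Q i -> Q j.
Proof.
move=> h; elim=> [|i IH] j; first by rewrite leqn0 => /eqP ->.
by rewrite leq_eqVlt => /orP[/eqP ->//|]; rewrite ltnS => /IH k /h.
Qed.

(** * Inverse limits of coverings *)

Section InverseLimit.
Variables (N : nat) (A : nat -> Type) (T : forall i, seq (A i) -> Prop).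
Variables (pi : forall i, A i.+1 -> A i) (iota : forall i, A i -> A i.+1).
Arguments T {i}.
Hypothesis hT : forall i, tree_at [::] (@T i).
Hypothesis hcov : forall i, covering (N + i.*2) (@T i) (@T i.+1) (@pi i) (@iota i).

Definition thread : Type := forall i, A i.

Let down (z : {i & A i}) : {i & A i} :=
  match z with
  | existT 0 b => existT A 0 b
  | existT j.+1 b => existT A j (pi b)
  end.

Let up (z : {i & A i}) : {i & A i} := existT A (projT1 z).+1 (iota (projT2 z)).

(** [down] and [up] act on dependent pairs, so they can be iterated without casts between the types
    [A i]; the tags are computed afterwards. *)
Lemma thread_ex m (a : A m) : exists t : thread,
  [/\ t m = a, forall i, pi (t i.+1) = t i & forall i, m <= i -> t i.+1 = iota (t i)].
Proof.
pose f i := if i <= m then iter (m - i) down (existT A m a)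
  else iter (i - m) up (existT A m a).
have tag_dn d : projT1 (iter d down (existT A m a)) = m - d.
  elim: d => [|d IH] /=; first by rewrite subn0.
  rewrite subnS -IH; case: (iter _ _ _) => -[|j] b //=.
have tag_up d : projT1 (iter d up (existT A m a)) = d + m.
  by elim: d => [|d IH] //=; rewrite IH.
have tagf i : projT1 (f i) = i.
  rewrite /f; case: leqP => im; first by rewrite tag_dn subKn.
  by rewrite tag_up subnK// ltnW.
have ex i : exists b : A i, existT A i b = f i.
  by have := tagf i; case: (f i) => j b /= <-; exists b.
pose t i := projT1 (cid (ex i)).
have tE i : existT A i (t i) = f i by rewrite /t; case: cid.
have fm : f m = existT A m a by rewrite /f leqnn subnn.
have fup i : m <= i -> f i.+1 = up (f i).
  move=> mi; rewrite /f [i < m]ltnNge mi /= subSn//; have [->|im] := eqVneq i m.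
    by rewrite leqnn subnn.
  by rewrite leqNgt ltn_neqAle eq_sym im mi.
have fdn i : i < m -> f i = down (f i.+1).
  by move=> im; rewrite /f (ltnW im) im -[in LHS](subnSK im).
have tup i : m <= i -> t i.+1 = iota (t i).
  move=> mi; apply: (@existT_inj2 nat A).
  by rewrite tE fup// -tE.
exists t; split => //.
- by apply: (@existT_inj2 nat A); rewrite tE.
- move=> i; have [im|mi] := ltnP i m; last by rewrite tup// (cov_iota (hcov i)).
  by apply: (@existT_inj2 nat A); rewrite tE fdn// -tE.
Qed.

Definition proj i (s : seq thread) : seq (A i) := map (fun t : thread => t i) s.

Lemma proj_inj s s' : (forall i, proj i s = proj i s') -> s = s'.
Proof.
elim: s s' => [|a s IH] [|b s'] h //; try by have := h 0.
have -> : a = b by apply: functional_extensionality_dep => i; have [] := h i.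
by rewrite (IH s')// => i; have [] := h i.
Qed.

Lemma size_proj i s : size (proj i s) = size s. Proof. exact: size_map. Qed.

Definition limT (s : seq thread) : Prop :=
  (forall i, T (proj i s)) /\ (forall i, map (@pi i) (proj i.+1 s) = proj i s).

Lemma lim_low i s : limT s -> size s <= N + i.*2 ->
  proj i.+1 s = map (@iota i) (proj i s).
Proof.
move=> [Ts coh] sN; rewrite -(coh i); by apply: (cov_low (hcov i) _ (Ts _)); rewrite size_proj.
Qed.

(** Up to length [N + i.*2] the later coverings only rename moves, so coordinate [i] determines the
    later coordinates by [iota] and the earlier ones by [pi]. *)
Lemma lim_inj i s s' : limT s -> limT s' -> size s <= N + i.*2 ->
  proj i s = proj i s' -> s = s'.
Proof.
move=> hs hs' sN e; have ss' : size s = size s' by rewrite -(size_proj i s) e size_proj.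
apply: proj_inj => j; have [ij|/ltnW ji] := leqP i j.
  elim: j ij => [|j IH]; first by rewrite leqn0 => /eqP <-.
  rewrite leq_eqVlt => /orP[/eqP <-//|]; rewrite ltnS => ij.
  have sj : N + i.*2 <= N + j.*2 by rewrite leq_add2l leq_double.
  by rewrite (lim_low hs) ?(lim_low hs') ?IH ?(leq_trans _ sj) -?ss'.
apply: (@down_ind (fun j => proj j s = proj j s') _ i) => // k e'.
by rewrite -hs.2 e' hs'.2.
Qed.

Lemma lim_ext m s (a : A m) : limT s -> size s < N + m.*2 -> T (rcons (proj m s) a) ->
  exists2 t : thread, t m = a & limT (rcons s t).
Proof.
move=> hs sN Ta; have [t [tm tpi tup]] := thread_ex a; exists t => //.
have prc i : proj i (rcons s t) = rcons (proj i s) (t i) by rewrite /proj map_rcons.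
have coh i : map (@pi i) (proj i.+1 (rcons s t)) = proj i (rcons s t).
  by rewrite !prc map_rcons hs.2 tpi.
split=> // j; have [mj|/ltnW jm] := leqP m j.
  elim: j mj => [|j IH].
    by rewrite leqn0 => /eqP e; move: a t tm tpi tup prc coh Ta; rewrite e => a t tm _ _ prc _; rewrite prc tm.
  rewrite leq_eqVlt => /orP[/eqP e|].
    by move: a t tm tpi tup prc coh Ta {IH}; case: _ / e => a t tm _ _ prc _; rewrite prc tm.
  rewrite ltnS => mj; have Tj := IH mj.
  have sj : size s < N + j.*2 by apply: leq_trans sN _; rewrite leq_add2l leq_double.
  rewrite prc lim_low//; last exact: ltnW.
  rewrite tup// -map_rcons -prc; apply: (cov_up (hcov j) _ Tj).
  by rewrite size_proj size_rcons.
apply: (@down_ind (fun j => T (proj j (rcons s t))) _ m) => //.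
  by move=> k Tk; rewrite -coh; apply: (cov_pi (hcov _)).
by rewrite prc tm.
Qed.

Lemma limT_tree : tree_at [::] limT.
Proof.
split.
- by split=> // i; exact: tree_root (hT i).
- move=> s a _ [Ta coh]; split=> i.
    by have := Ta i; rewrite /proj map_rcons => /(tree_rcons (hT i) (ext0 _)).
  by have := coh i; rewrite /proj !map_rcons => /rcons_inj[].
- move=> s _ hs; have [a Ta] := tree_pruned (hT (size s).+1) (ext0 _) (hs.1 _).
  have [|t _ ht] := lim_ext hs _ Ta; last by exists t.
  by apply: leq_trans (leq_addl _ _); rewrite doubleS ltnS -addnn leqW ?leq_addr.
Qed.

Definition iota_inf (a : A 0) : thread := projT1 (cid (thread_ex a)).

Lemma iota_infE a : [/\ iota_inf a 0 = a, forall i, pi (iota_inf a i.+1) = iota_inf a i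
  & forall i, iota_inf a i.+1 = iota (iota_inf a i)].
Proof. by rewrite /iota_inf; case: cid => t /= [h1 h2 h3]; split=> // i; exact: h3. Qed.

Section LimStrategies.
Variable P : bool.

Definition phi i : (seq (A i.+1) -> Prop) -> seq (A i) -> Prop :=
  projT1 (cid (cov_strat (hcov i) P)).

Lemma phiE i : [/\ forall S', qsat P [::] (@T i.+1) S' -> qsat P [::] (@T i) (phi S'),
      forall n S1 S2, qsat P [::] (@T i.+1) S1 -> qsat P [::] (@T i.+1) S2 ->
        (forall s, size s <= n -> S1 s <-> S2 s) ->
        forall s, size s <= n -> phi S1 s <-> phi S2 s,
      forall S' s, qsat P [::] (@T i.+1) S' -> size s <= N + i.*2 ->
        (phi S' s <-> S' (map (@iota i) s))
    & forall S' x, qsat P [::] (@T i.+1) S' -> (forall n, phi S' (pre x n)) ->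
        exists2 x' : nat -> A i.+1, forall n, S' (pre x' n) & forall n, pi (x' n) = x n].
Proof. by rewrite /phi; case: cid. Qed.

Section Strat.
Variable S : seq thread -> Prop.

(** Coordinate [i] determines a position of the limit only up to length [N + i.*2]; beyond this
    length all moves of [T] are allowed. *)
Definition trunc i (s : seq (A i)) : Prop :=
  T s /\ exists2 s', S s' & proj i s' = take (N + i.*2) s.

Fixpoint stage d i : seq (A i) -> Prop :=
  match d with
  | 0 => @trunc i
  | d.+1 => phi (@stage d i.+1)
  end.

Definition limS i (s : seq (A i)) : Prop := stage (size s) s.
Arguments limS : clear implicits.

Hypothesis hS : qsat P [::] limT S.

Lemma trunc_qs i : qsat P [::] (@T i) (@trunc i).
Proof.
split=> [s []//|s _|||s|s a].
- exact: ext0.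
- by split; [exact: tree_root (hT i)|exists [::] => //; exact: qs_root hS].
- move=> s a _ [Ta [s' Ss' e]]; split; first exact: (tree_rcons (hT i) (ext0 _) Ta).
  have [sN|Ns] := ltnP (size s) (N + i.*2); last first.
    by exists s' => //; rewrite e take_rcons_le.
  rewrite take_oversize ?size_rcons// in e.
  case/lastP: s' Ss' e => [|s' t] Ss' e.
    by move/(congr1 size): e; rewrite size_rcons.
  move: e; rewrite /proj map_rcons => /rcons_inj[e _].
  exists s'; first exact: (qs_rcons hS (ext0 _) Ss').
  by rewrite /proj e take_oversize// ltnW.
- move=> [Ts [s' Ss' e]] sP; have [sN|Ns] := ltnP (size s) (N + i.*2); last first.
    have [a Ta] := tree_pruned (hT i) (ext0 _) Ts; exists a; split=> //.
    by exists s' => //; rewrite e take_rcons_le.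
  rewrite take_oversize in e; last exact: ltnW.
  have [|t St] := qs_own hS Ss'; first by rewrite -(size_proj i) e.
  have pt : proj i (rcons s' t) = rcons s (t i) by rewrite /proj map_rcons -/(proj i s') e.
  exists (t i); rewrite -pt; split; first by have [+ _] := qs_sub hS St; apply.
  by exists (rcons s' t) => //; rewrite take_oversize// pt size_rcons.
- move=> [Ts [s' Ss' e]] sP Ta; split => //.
  have [sN|Ns] := ltnP (size s) (N + i.*2); last first.
    by exists s' => //; rewrite e take_rcons_le.
  rewrite take_oversize in e; last exact: ltnW.
  have [||t ti Tt] := @lim_ext i s' a (qs_sub hS Ss').
  - by rewrite -(size_proj i) e.
  - by rewrite e.
  have pt : proj i (rcons s' t) = rcons s a by rewrite /proj map_rcons -/(proj i s') e ti.
  exists (rcons s' t); last by rewrite take_oversize// size_rcons.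
  by apply: (qs_opp hS Ss') Tt; rewrite -(size_proj i) e.
Qed.

Lemma stage_qs d i : qsat P [::] (@T i) (@stage d i).
Proof.
elim: d i => [|d IH] i; first exact: trunc_qs.
by have [h _ _ _] := phiE i; apply: h.
Qed.

(** Covering [i] is a renaming up to length [N + i.*2], so to start one level higher changes nothing
    there; the locality of [phi] carries this down. Hence [size s] stages suffice in [limS]. *)
Lemma stage_stable d i s : size s <= N + (i + d).*2 -> (@stage d i s <-> @stage d.+1 i s).
Proof.
elim: d i s => [|d IH] i s; last first.
  rewrite addnS -addSn => sd; have [_ h _ _] := phiE i.
  by apply: (h (N + (i.+1 + d).*2) _ _ (stage_qs _ _) (stage_qs d.+1 _)) => // s' /IH.
rewrite addn0 => sN /=; have [_ _ h _] := phiE i.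
have {}h := h _ _ (trunc_qs i.+1) sN.
split=> [[Ts [s' Ss' e]]|/h[Ts [s' Ss' e]]].
  apply/h; rewrite take_oversize// in e.
  have hs' := qs_sub hS Ss'; have low := lim_low hs' (i := i).
  have e' : proj i.+1 s' = map (@iota i) s by rewrite low ?e// -(size_proj i) e.
  split; first by rewrite -e'; case: hs'.
  by exists s' => //; rewrite e' take_oversize// size_map (leq_trans sN)// leq_add2l leq_double.
have hs' := qs_sub hS Ss'.
rewrite take_oversize in e; last by rewrite size_map (leq_trans sN)// leq_add2l leq_double.
have e' : proj i s' = s.
  by rewrite -hs'.2 e mapK//; exact: cov_iota (hcov i).
split; first by rewrite -e'; case: hs'.
by exists s' => //; rewrite take_oversize.
Qed.

Lemma limSE d i s : size s <= N + (i + d).*2 -> (limS i s <-> @stage d i s).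
Proof.
have main e k : size s <= N + (i + e).*2 -> e <= k -> (@stage e i s <-> @stage k i s).
  move=> se; elim: k => [|k IH]; first by rewrite leqn0 => /eqP ->.
  rewrite leq_eqVlt => /orP[/eqP <-//|]; rewrite ltnS => ek.
  rewrite IH// stage_stable//; apply: leq_trans se _.
  by rewrite leq_add2l leq_double leq_add2l.
move=> sd; have s0 : size s <= N + (i + size s).*2.
  by rewrite doubleD -(addnn (size s)) !addnA leq_addl.
have e1 := main _ (maxn d (size s)) s0 (leq_maxr _ _).
have e2 := main _ (maxn d (size s)) sd (leq_maxl _ _).
by rewrite /limS; tauto.
Qed.

Lemma limSE' d i s : size s <= d -> (limS i s <-> @stage d i s).
Proof.
move=> sd; apply: limSE; apply: leq_trans sd _.
by rewrite doubleD -(addnn d) !addnA leq_addl.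
Qed.

Lemma limS_qs i : qsat P [::] (@T i) (limS i).
Proof.
have h n := stage_qs n i.
split=> [s /(qs_sub (h _))//|s _|||s Ss sP|s a Ss sP Ta].
- exact: ext0.
- exact: qs_root (h 0).
- move=> s a _ /(qs_rcons (h _) (ext0 _)) Ss.
  by apply/(limSE' (d := size (rcons s a))) => //; rewrite size_rcons.
- have {}Ss := (limSE' (leqnSn _)).1 Ss; have [a Sa] := qs_own (h _) Ss sP.
  by exists a; rewrite /limS size_rcons.
- have {}Ss := (limSE' (leqnSn _)).1 Ss.
  by rewrite /limS size_rcons; apply: (qs_opp (h _) Ss sP Ta).
Qed.

Lemma phi_limS i s : phi (limS i.+1) s <-> limS i s.
Proof.
have [_ h _ _] := phiE i.
rewrite (h (size s) _ (@stage (size s) i.+1) (limS_qs _) (stage_qs _ _))//.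
  by rewrite (@limSE' (size s).+1)//.
by move=> s' ss'; exact: limSE'.
Qed.

Lemma phi_limS_eq i : phi (limS i.+1) = limS i.
Proof. by apply/funext => s; apply/propext/phi_limS. Qed.

Definition limX_step i (X : {x : nat -> A i | forall n, limS i (pre x n)}) :
  {x : nat -> A i.+1 | (forall n, limS i.+1 (pre x n)) /\
     forall n, pi (x n) = sval X n}.
Proof.
apply: cid; case: X => x hx /=; have [_ _ _ h] := phiE i.
have [|x' h1 h2] := h _ x (limS_qs i.+1); first by rewrite phi_limS_eq.
by exists x'.
Qed.

(** The play is lifted one level at a time. Its prefix of length [n] belongs to [S] because at level
    [n] this length does not exceed [N + n.*2], where [limS] is the truncation of [S]. *)
Lemma lim_lift (x : nat -> A 0) : (forall n, limS 0 (pre x n)) ->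
  exists2 x' : nat -> thread, forall n, S (pre x' n) & forall n, x' n 0 = x n.
Proof.
move=> hx.
pose X := fix X i : {x : nat -> A i | forall n, limS i (pre x n)} :=
  match i with
  | 0 => exist _ x hx
  | i.+1 => exist _ (sval (limX_step (X i))) (svalP (limX_step (X i))).1
  end.
pose x' n : thread := fun i => sval (X i) n.
have pX i n : proj i (pre x' n) = pre (sval (X i)) n.
  by rewrite /proj /pre /mkseq -map_comp.
have coh i n : pi (sval (X i.+1) n) = sval (X i) n.
  exact: (svalP (limX_step (X i))).2.
have Tx' n : limT (pre x' n).
  split=> i; rewrite !pX; first exact: (qs_sub (limS_qs i) (svalP (X i) n)).
  by rewrite /pre /mkseq -map_comp; apply: eq_map => k /=; exact: coh.
exists x' => // n.
have nn : n <= N + n.*2 by rewrite -addnn addnA leq_addl.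
have := svalP (X n) n.
have -> : limS n (pre (sval (X n)) n) <-> @stage 0 n (pre (sval (X n)) n).
  by apply: limSE; rewrite addn0 size_pre.
rewrite -pX => -[_ [s' Ss']]; rewrite take_oversize ?size_proj ?size_pre// => e.
suff <- : s' = pre x' n by [].
have ss' : size s' = n by rewrite -(size_proj n) e size_proj size_pre.
by apply: (lim_inj (i := n) (qs_sub hS Ss') (Tx' n) _ e); rewrite ss'.
Qed.

End Strat.

Lemma stage_local n S1 S2 d i : qsat P [::] limT S1 -> qsat P [::] limT S2 ->
  (forall s, size s <= n -> S1 s <-> S2 s) ->
  forall s, size s <= n -> @stage S1 d i s <-> @stage S2 d i s.
Proof.
move=> h1 h2 h12; elim: d i => [|d IH] i s sn; last first.
  have [_ h _ _] := phiE i; apply: (h n _ _ (stage_qs h1 d i.+1) (stage_qs h2 d i.+1)) => //.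
  by move=> s' /IH.
have e s' : proj i s' = take (N + i.*2) s -> S1 s' <-> S2 s'.
  move=> /(congr1 size); rewrite size_proj => es; apply: h12.
  by rewrite es size_take_min geq_min sn orbT.
by split=> -[Ts [s' Ss' es]]; split=> //; exists s' => //; apply/(e _ es).
Qed.

End LimStrategies.

Lemma lim_covering : covering N (@T 0) limT (fun t : thread => t 0) iota_inf.
Proof.
split.
- by move=> s [h _]; exact: (h 0).
- by move=> a; have [] := iota_infE a.
- move=> s sN Ts.
  have p0 : proj 0 (map iota_inf s) = s.
    by rewrite /proj -map_comp -[RHS]map_id; apply: eq_map => a /=; have [] := iota_infE a.
  have pS i : proj i.+1 (map iota_inf s) = map (@iota i) (proj i (map iota_inf s)).
    by rewrite /proj -!map_comp; apply: eq_map => a /=; have [] := iota_infE a.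
  split=> i.
    elim: i => [|i IH]; first by rewrite p0.
    rewrite pS; apply: (cov_up (hcov i) _ IH).
    by rewrite size_proj size_map (leq_trans sN)// leq_addr.
  by rewrite pS mapK//; exact: cov_iota (hcov i).
- move=> s sN hs; apply: proj_inj => i; elim: i => [|i IH].
    rewrite /proj -!map_comp; apply: eq_map => t /=; by have [] := iota_infE (t 0).
  rewrite lim_low// ?IH; last by rewrite (leq_trans sN)// leq_addr.
  by rewrite /proj -!map_comp; apply: eq_map => t /=; have [_ _ ->] := iota_infE (t 0).
- move=> P; exists (fun S => @limS P S 0); split.
  + by move=> S hS; exact: (limS_qs hS 0).
  + move=> n S1 S2 h1 h2 h12 s sn; rewrite /limS.
    exact: (@stage_local P n S1 S2 (size s) 0 h1 h2 h12 s sn).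
  + move=> S s hS sN.
    have -> : @limS P S 0 s <-> @stage P S 0 0 s by apply: (limSE hS (d := 0)); rewrite addn0 double0 addn0.
    have p0 : proj 0 (map iota_inf s) = s.
      by rewrite /proj -map_comp -[RHS]map_id; apply: eq_map => a /=; have [] := iota_infE a.
    rewrite /= /trunc double0 addn0 take_oversize//; split=> [[Ts [s' Ss' e]]|Ss].
      suff <- : s' = map iota_inf s by [].
      have hs' := qs_sub hS Ss'.
      apply: (lim_inj (i := 0) hs') => //.
      * split=> i.
          elim: i => [|i IH]; first by rewrite p0.
          rewrite (_ : proj i.+1 _ = map (@iota i) (proj i (map iota_inf s))).
            apply: (cov_up (hcov i) _ IH).
            by rewrite size_proj size_map (leq_trans sN)// leq_addr.
          by rewrite /proj -!map_comp; apply: eq_map => a /=; have [] := iota_infE a.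
        by rewrite /proj -!map_comp; apply: eq_map => a /=; have [] := iota_infE a.
      * by rewrite double0 addn0 -(size_proj 0) e.
      * by rewrite p0.
    split; last by exists (map iota_inf s).
    by rewrite -p0; have [h _] := qs_sub hS Ss; exact: (h 0).
  + move=> S x hS hx; exact: (lim_lift hS hx).
Qed.

End InverseLimit.

Lemma covering_comp N A A' A'' (T : seq A -> Prop) (T' : seq A' -> Prop) (T'' : seq A'' -> Prop)
    pi iota pi' iota' : covering N T T' pi iota -> covering N T' T'' pi' iota' ->
  covering N T T'' (pi \o pi') (iota' \o iota).
Proof.
move=> c c'; split.
- by move=> s /(cov_pi c')/(cov_pi c); rewrite map_comp.
- by move=> a /=; rewrite (cov_iota c') (cov_iota c).
- move=> s sN Ts; rewrite map_comp; apply: (cov_up c'); rewrite ?size_map//.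
  exact: (cov_up c).
- move=> s sN Ts; rewrite [LHS](cov_low c')// [in LHS](cov_low c (s := map pi' s)) ?size_map//.
    by rewrite -!map_comp.
  exact: (cov_pi c').
move=> P; have [f [f1 f2 f3 f4]] := cov_strat c P.
have [g [g1 g2 g3 g4]] := cov_strat c' P.
exists (f \o g); split=> /=.
- by move=> S /g1/f1.
- move=> n S1 S2 h1 h2 h12; apply: f2; [exact: g1|exact: g1|exact: g2].
- move=> S s hS sN; have h1 := f3 _ s (g1 _ hS) sN.
  have h2 := g3 S (map iota s) hS; rewrite size_map in h2.
  by rewrite map_comp; have := h2 sN; tauto.
- move=> S x hS hx; have [x' h1 h2] := f4 _ _ (g1 _ hS) hx.
  have [x'' h3 h4] := g4 _ _ hS h1.
  by exists x'' => // n /=; rewrite h4 h2.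
Qed.

Lemma covering_id N A (T : seq A -> Prop) : covering N T T id id.
Proof.
split.
- by move=> s; rewrite map_id.
- by [].
- by move=> s _; rewrite map_id.
- by move=> s _ _; rewrite !map_id.
move=> P; exists id; split=> //=; first by move=> S s _ _; rewrite map_id.
by move=> S x _ hx; exists x.
Qed.

(** * Borel determinacy *)

Record arena (A0 : Type) := Arena {
  ar_move : Type;
  ar_tree : seq ar_move -> Prop;
  ar_treeP : tree_at [::] ar_tree;
  ar_map : ar_move -> A0 }.

Arguments ar_tree {A0} a _.
Arguments ar_map {A0} a _.
Arguments ar_treeP {A0} a.

Definition clopenT A (T : seq A -> Prop) (Y : set (nat -> A)) : Prop :=
  forall x, (forall n, T (pre x n)) -> exists n, forall x', (forall m, T (pre x' m)) ->
    pre x' n = pre x n -> (Y x <-> Y x').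

Record unravels A0 (N : nat) (a b : arena A0) (W : set (nat -> A0)) : Type := Unravels {
  un_pi : ar_move b -> ar_move a;
  un_iota : ar_move a -> ar_move b;
  un_cov : covering N (@ar_tree _ a) (@ar_tree _ b) un_pi un_iota;
  un_map : forall c, ar_map b c = ar_map a (un_pi c);
  un_clopen : clopenT (@ar_tree _ b) (fun x => W (@ar_map _ b \o x)) }.

(** The arena is arbitrary, since each set of a countable union is unraveled over the game that the
    preceding coverings have produced. *)
Definition unravelable A0 (W : set (nat -> A0)) : Prop :=
  forall (a : arena A0) N, odd N = false -> exists b, inhabited (unravels N a b W).

Inductive borel_seq (A0 : Type) : set (nat -> A0) -> Prop :=
| borel_seq_fin n (Q : seq A0 -> Prop) : borel_seq (fun x => Q (pre x n))
| borel_seq_compl W : borel_seq W -> borel_seq (fun x => ~ W x)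
| borel_seq_union (W : nat -> set (nat -> A0)) :
    (forall i, borel_seq (W i)) -> borel_seq (fun x => exists i, W i x).

Lemma pre_comp A B (f : A -> B) x n : pre (f \o x) n = map f (pre x n).
Proof. by rewrite /pre /mkseq map_comp. Qed.

(** A covering for a set serves its complement. For a union the sets [W i] are unraveled one after
    the other, at ever later moves; over the limit all of them are clopen, so their union is open
    and one closed unraveling finishes. *)
Lemma borel_unravelable A0 (W : set (nat -> A0)) : borel_seq W -> unravelable W.
Proof.
elim=> {W} [n Q|W _ IH|W _ IH] a N evN.
- exists a; split; exists id id => //; first exact: covering_id.
  move=> x hx; exists n => x' hx' e.
  by rewrite (pre_comp (ar_map a) x') e -(pre_comp (ar_map a) x).
- have [b [u]] := IH a N evN; exists b; split.
  exists (un_pi u) (un_iota u); [exact: un_cov|exact: un_map|].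
  move=> x hx; have [n hn] := un_clopen u hx; exists n => x' hx' e.
  by have := hn x' hx' e; tauto.
have nxt (i : nat) (c : arena A0) : {b : arena A0 & unravels (N + i.*2) c b (W i)}.
  have [|b h] := cid (IH i c (N + i.*2) _); first by rewrite oddD evN odd_double.
  exists b; have hu : exists _ : unravels (N + i.*2) c b (W i), True by case: h => u; exists u.
  exact: projT1 (cid hu).
pose ar := fix ar i : arena A0 := match i with 0 => a | i.+1 => projT1 (nxt i (ar i)) end.
pose un i : unravels (N + i.*2) (ar i) (ar i.+1) (W i) := projT2 (nxt i (ar i)).
have hT i : tree_at [::] (@ar_tree _ (ar i)) := ar_treeP (ar i).
have hcov i := un_cov (un i).
pose lim := @Arena A0 _ _ (limT_tree hT hcov) (fun t : thread (fun i => ar_move (ar i)) => ar_map (ar 0) (t 0)).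
have mapE i s : ar_tree lim s -> map (@ar_map _ lim) s = map (@ar_map _ (ar i)) (proj i s).
  elim: i => [|i IHi] hs.
    exact: (map_comp (ar_map (ar 0)) (fun t : thread (fun i => ar_move (ar i)) => t 0) s).
  rewrite (IHi hs) -(hs.2 i) -(map_comp (ar_map (ar i))); apply: eq_map => t /=.
  by rewrite (un_map (un i)).
have clW i : clopenT (@ar_tree _ lim) (fun x => W i (@ar_map _ lim \o x)).
  have mE x : (forall n, ar_tree lim (pre x n)) ->
      @ar_map _ lim \o x = @ar_map _ (ar i.+1) \o (fun n => x n i.+1).
    move=> hx; apply/funext => n; have := mapE i.+1 _ (hx n.+1).
    rewrite preS /proj !map_rcons => /rcons_inj[_ e]; exact: e.
  have br x : (forall n, ar_tree lim (pre x n)) ->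
      forall n, ar_tree (ar i.+1) (pre (fun n => x n i.+1) n).
    by move=> hx n; rewrite (pre_comp (fun t : thread _ => t i.+1)); exact: (hx n).1.
  move=> x hx; have [n hn] := un_clopen (un i) (br x hx); exists n => x' hx' e.
  rewrite mE// mE//; apply: hn; first exact: br.
  by rewrite !(pre_comp (fun t : thread _ => t i.+1)) e.
(* [K] holds as long as the position does not guarantee that the play ends in some [W i]. *)
pose K s := ~ exists i, forall x, (forall n, ar_tree lim (pre x n)) -> pre x (size s) = s ->
  W i (@ar_map _ lim \o x).
have [A' [T' [pi [iota [c hT' cl]]]]] := @closed_unravel _ _ K N (ar_treeP lim) evN.
exists (@Arena A0 A' T' hT' (@ar_map _ lim \o pi)); split.
exists ((fun t : ar_move lim => t 0) \o pi) (iota \o iota_inf hcov) => //=.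
  exact: covering_comp (lim_covering hT hcov) c.
have KW x : (forall n, T' (pre x n)) ->
    (exists i, W i (@ar_map _ lim \o (pi \o x))) <-> ~ (forall m, K (pre (pi \o x) m)).
  move=> hx; have hpx n : ar_tree lim (pre (pi \o x) n).
    by rewrite pre_comp; exact: (cov_pi c).
  split=> [[i Wi] hK|].
    have [n hn] := clW i _ hpx; apply: (hK n); exists i => x' hx'.
    by rewrite size_pre => e; apply/(hn x' hx' e).
  move=> /existsNP[m]; rewrite /K => /contrapT[i hi]; exists i; apply: hi => //.
  by rewrite size_pre.
move=> x hx; have [n hn] := cl x hx; exists n => x' hx' e.
by have := hn x' hx' e; have := KW x hx; have := KW x' hx'; rewrite /comp /=; tauto.
Qed.

(** In the unraveled arena the winning condition is clopen, so open determinacy applies there; the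
    quasi-strategy obtained is pushed down by [cov_strat], and moves are chosen from it. *)
Theorem borel_determinacy A (a0 : A) (W : set (nat -> A)) : borel_seq W ->
  (exists sg : seq A -> A, forall x, (forall n, odd n = false -> x n = sg (pre x n)) -> W x) \/
  (exists sg : seq A -> A, forall x, (forall n, odd n = true -> x n = sg (pre x n)) -> ~ W x).
Proof.
move=> hW.
have hT : tree_at [::] (fun _ : seq A => True) by split=> // s _ _; exists a0.
have [b [u]] := borel_unravelable hW (Arena hT id) (N := 0) erefl.
pose W' x := W (@ar_map _ b \o x).
have cW' : clopenT (@ar_tree _ b) W' := un_clopen u.
have hb := ar_treeP b.
pose O s := forall x, (forall n, ar_tree b (pre x n)) -> pre x (size s) = s -> W' x.
have extract P (Y : set (nat -> A)) S' : qsat P [::] (@ar_tree _ b) S' ->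
    (forall x, (forall n, S' (pre x n)) -> Y (@ar_map _ b \o x)) ->
    exists sg : seq A -> A, forall x, (forall n, odd n = P -> x n = sg (pre x n)) -> Y x.
  move=> hS' hY; have [phi [p1 _ _ p4]] := cov_strat (un_cov u) P.
  have hS := p1 _ hS'; set S := phi S' in hS.
  have ex s : exists a, S s -> odd (size s) = P -> S (rcons s a).
    case: (pselect (S s)) => [Ss|]; last by exists a0.
    case: (pselect (odd (size s) = P)) => [sP|]; last by exists a0.
    by have [a Sa] := qs_own hS Ss sP; exists a.
  have [sg hsg] := boolp.choice ex.
  exists sg => x hx.
  have Sx n : S (pre x n).
    elim: n => [|n IH]; first exact: qs_root hS.
    rewrite preS; have [nP|nP] := pselect (odd n = P).
      by rewrite hx//; apply: hsg => //; rewrite size_pre.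
    by apply: (qs_opp hS) => //; rewrite size_pre.
  have [x' h1 h2] := p4 _ x hS' Sx.
  suff <- : @ar_map _ b \o x' = x by apply: hY.
  by apply/funext => n /=; rewrite (un_map u) /= h2.
have [Win0|nW] := pselect (Win false (@ar_tree _ b) O [::]).
  left; have [V [hV Vw]] := Win_strat hb Win0.
  apply: (extract false W V hV) => x hx.
  have [//|//|n _ On] := Vw x.
  apply: On; last by rewrite size_pre.
  by move=> m; exact: qs_sub hV _ (hx m).
right; have hN := nowin_qs hb nW.
apply: (extract true (fun x => ~ W x) _ hN) => x hx Wx.
have Tx n : ar_tree b (pre x n) by have [] := hx n.
have [n hn] := cW' x Tx; have [_ _ /(_ n)] := hx n; apply => //.
rewrite take_oversize ?size_pre//; apply: Win_here => x' hx'.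
by rewrite size_pre => e; apply/(hn x' hx' e).
Qed.

Import Order.TTheory GRing.Theory Num.Theory.
Local Open Scope classical_set_scope.

(** * Sigma-algebras of predicates *)

(** Measurability is always proved through this interface, whose instances are Borel sets, Borel
    sets of plays, bianalytic sets, and families of sets with continuous codes. *)
Record salg (T : Type) (S : set (set T)) : Prop := Salg {
  salgT : S (fun=> True);
  salg_not : forall P : set T, S P -> S (fun t => ~ P t);
  salg_ex : forall P : nat -> set T, (forall i, S (P i)) -> S (fun t => exists i, P i t) }.

Section Salg.
Context {T : Type} (S : set (set T)).
Hypothesis hS : salg S.
Implicit Types P Q : set T.

Lemma salg_ext P Q : (forall t, P t <-> Q t) -> S P -> S Q.
Proof. by move=> h; suff -> : P = Q by []; apply/predeqP. Qed.

Lemma salg_const (Q : Prop) : S (fun=> Q).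
Proof.
have [q|nq] := pselect Q; first by apply: salg_ext (salgT hS).
by apply: salg_ext (salg_not hS (salgT hS)) => t; split.
Qed.

Lemma salg_or P Q : S P -> S Q -> S (fun t => P t \/ Q t).
Proof.
move=> hP hQ; apply: (@salg_ext (fun t => exists i, (if i is 0%N then P else Q) t)).
  move=> t; split=> [[[|i]]|[]]; [by left|by right|by exists 0%N|by exists 1%N].
by apply: (salg_ex hS) => -[].
Qed.

Lemma salg_and P Q : S P -> S Q -> S (fun t => P t /\ Q t).
Proof.
move=> hP hQ; have h := salg_not hS (salg_or (salg_not hS hP) (salg_not hS hQ)).
by apply: salg_ext h => t; rewrite not_orE !notK.
Qed.

Lemma salg_imp P Q : S P -> S Q -> S (fun t => P t -> Q t).
Proof.
move=> hP hQ; apply: salg_ext (salg_or (salg_not hS hP) hQ) => t.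
by rewrite implyE.
Qed.

Lemma salg_iff P Q : S P -> S Q -> S (fun t => P t <-> Q t).
Proof. by move=> hP hQ; apply: salg_and; apply: salg_imp. Qed.

Lemma salg_exc (I : countType) (P : I -> set T) : (forall i, S (P i)) ->
  S (fun t => exists i, P i t).
Proof.
move=> hP; apply: (@salg_ext (fun t => exists n, (if unpickle n is Some i then P i else set0) t)).
  move=> t; split=> [[n]|[i Pi]].
    by case: (unpickle n) => // i ?; exists i.
  by exists (pickle i); rewrite pickleK.
apply: (salg_ex hS) => n; case: (unpickle n) => [i|]; first exact: hP.
exact: salg_const.
Qed.

Lemma salg_allc (I : countType) (P : I -> set T) : (forall i, S (P i)) ->
  S (fun t => forall i, P i t).
Proof.
move=> hP; have h := salg_not hS (salg_exc (fun i => salg_not hS (hP i))).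
apply: salg_ext h => t; split=> [h i|h [i]]; last by apply.
by apply: contrapT => n; apply: h; exists i.
Qed.

Lemma salg_fiber (f : T -> nat) (A : set nat) : (forall k, S (fun t => f t = k)) ->
  S (fun t => A (f t)).
Proof.
move=> hf; apply: (@salg_ext (fun t => exists k, A k /\ f t = k)).
  by move=> t; split=> [[k [Ak ->]]//|Af]; exists (f t).
by apply: (salg_ex hS) => k; apply: salg_and => //; exact: salg_const.
Qed.

End Salg.

Lemma salg_pre (T T' : Type) (S : set (set T)) (f : T -> T') : salg S ->
  salg (fun A => S (fun t => A (f t))).
Proof.
by move=> h; split; [exact: salgT|move=> P; exact: salg_not|move=> P; exact: salg_ex].
Qed.

Lemma borel_salg (T : topologicalType) : salg (@borel T).
Proof.
have [b0 bC bU] := @smallest_sigma_algebra T setT open.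
have bC' (A : set T) : borel A -> borel (~` A) by move=> hA; have := bC A hA; rewrite setTD.
split.
- have -> : (fun=> True) = ~` (@set0 T) by rewrite setC0.
  exact: bC'.
- exact: bC'.
- move=> P hP; rewrite (_ : (fun t => _) = \bigcup_i P i); first exact: (bU P hP).
  by apply/predeqP => t; split=> [[i Pi]|[i _ Pi]]; exists i.
Qed.

Lemma borel_min (T : topologicalType) (S : set (set T)) : salg S ->
  (forall U, open U -> S U) -> forall A, borel A -> S A.
Proof.
move=> hS hU; apply: smallest_sub => //; split.
- by apply: (salg_ext _ (salg_const hS False)) => t; split.
- by move=> A hA; rewrite setTD; exact: salg_not.
- move=> A hA; apply: (salg_ext _ (salg_ex hS hA)) => t.
  by split=> [[i Pi]|[i _ Pi]]; exists i.
Qed.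

Lemma borel_open (T : topologicalType) (U : set T) : open U -> borel U.
Proof. exact: sub_gen_smallest. Qed.

Lemma borel_preimage (T T' : topologicalType) (f : T -> T') A : continuous f ->
  borel A -> borel (fun t => A (f t)).
Proof.
move=> cf; apply: (borel_min (salg_pre f (borel_salg T))) => U oU.
by apply: borel_open; apply: open_comp => // x _; exact: cf.
Qed.

(** * Countable powers of the discrete space of natural numbers *)

Section NatPower.
Variable I : countType.
Let X : topologicalType := prod_topology (fun _ : I => nat).
Implicit Types (x : X).

Lemma coord_open (i : I) (A : set nat) : open [set x : X | A (x i)].
Proof.
apply: (@open_comp X nat (fun x => x i) A); last exact: discrete_open.
by move=> x _; exact: (@proj_continuous I (fun=> nat) i).
Qed.

Lemma nbhs_cyl x (A : set X) : nbhs x A <->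
  exists J : seq I, forall x' : X, (forall j, j \in J -> x' j = x j) -> A x'.
Proof.
pose C (J : seq I) : set X := [set x' | forall j, j \in J -> x' j = x j].
split=> [|[J hJ]]; last first.
  apply: (@filterS _ (nbhs x) _ (C J)); first by move=> x' h; exact: hJ.
  elim: {hJ} J => [|j J IH]; first by apply: filterS filterT => x' _ j.
  have h : nbhs x [set x' : X | x' j = x j].
    by apply: open_nbhs_nbhs; split => //; exact: (coord_open j [set x j]).
  apply: filterS (filterI h IH) => x' [/= e1 e2] k; rewrite inE => /orP[/eqP->//|].
  exact: e2.
pose F := filter_from setT C.
have FF : Filter F.
  apply: filter_from_filter; first by exists [::].
  move=> J1 J2 _ _; exists (J1 ++ J2) => // x' h; split=> j hj; apply: h;
  by rewrite mem_cat hj ?orbT.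
suff h : F --> (x : X) by move=> /h[J _ hJ]; exists J => x' hx'; exact: hJ.
apply/cvg_sup => i B /=; rewrite (@nbhsE (initial_topology _)).
move=> [B' [[D oD <-] xB'] sB]; exists [:: i] => // x' /(_ i) e.
apply: sB; rewrite /preimage /= e//; exact: mem_head.
Qed.

Lemma openP_cyl (A : set X) : open A <-> forall x, A x ->
  exists J : seq I, forall x' : X, (forall j, j \in J -> x' j = x j) -> A x'.
Proof.
rewrite openE; split=> h x /h; first by move=> /nbhs_cyl.
by move=> /nbhs_cyl.
Qed.

Definition cyl (c : seq (I * nat)) : set X :=
  [set x | all (fun p => x p.1 == p.2) c].

Lemma cyl_open c : open (cyl c).
Proof.
elim: c => [|p c IH].
  by rewrite (_ : cyl [::] = setT) ?predeqE//; exact: openT.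
rewrite (_ : cyl (p :: c) = [set x : X | x p.1 = p.2] `&` cyl c).
  by apply: openI => //; exact: (coord_open p.1 [set p.2]).
by rewrite predeqE => x; rewrite /cyl /=; split=> [/andP[/eqP]|[-> ->]]//; rewrite eqxx.
Qed.

Lemma cyl_nbhs (A : set X) x : nbhs x A -> exists c, cyl c x /\ cyl c `<=` A.
Proof.
move=> /nbhs_cyl[J hJ]; exists [seq (j, x j) | j <- J]; split.
  by rewrite /cyl /= all_map; apply/allP => j _ /=.
move=> x'; rewrite /cyl /= all_map => /allP h; apply: hJ => j /h /= /eqP.
exact.
Qed.

Lemma open_cylE (A : set X) : open A ->
  A = (fun x => exists c, cyl c `<=` A /\ cyl c x).
Proof.
move=> oA; apply/predeqP => x; split=> [Ax|[c [cA /cA]]//].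
have [|c [cx cA]] := @cyl_nbhs A x; first exact: open_nbhs_nbhs.
by exists c.
Qed.

Lemma salg_nat_open (S : set (set X)) : salg S ->
  (forall i k, S (fun x => x i = k)) -> forall U, open U -> S U.
Proof.
move=> hS hi U oU; rewrite (open_cylE oU); apply: salg_exc => // c.
apply: salg_and => //; first exact: salg_const.
elim: c => [|p c IH].
  by apply: salg_ext (salgT hS) => x; rewrite /cyl /=; split.
apply: salg_ext (salg_and hS (hi p.1 p.2) IH) => x; rewrite /cyl /=.
by split=> [[-> ->]|/andP[/eqP]]//; rewrite eqxx.
Qed.

Lemma borel_coord i k : borel (fun x : X => x i = k).
Proof. by apply: borel_open; exact: (coord_open i [set k]). Qed.

Lemma cts_nat (T : topologicalType) (f : T -> X) :
  (forall i k, open [set t | f t i = k]) -> continuous f.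
Proof.
move=> h t A /cyl_nbhs[c [cx cA]]; rewrite /fmap /nbhs /=.
apply: (filterS (P := [set t | cyl c (f t)])); first by move=> t' /cA.
elim: c cx {cA} => [|p c IH]; first by move=> _; apply: filterS filterT => t' _.
rewrite /cyl /= => /andP[/eqP e /IH hc].
have hp : nbhs t [set t' | f t' p.1 = p.2] by apply: open_nbhs_nbhs; split.
by apply: filterS (filterI hp hc) => t' [/= -> ->]; rewrite eqxx.
Qed.

End NatPower.

Definition natpow (R : realType) (I : countType) : Type := I -> nat.

Section NatPowerMetric.
Variables (R : realType) (I : countType).
Let M := natpow R I.
Implicit Types x y z : M.
Local Open Scope ring_scope.

Definition agree n x y := forall i : I, (pickle i < n)%N -> x i = y i.

Definition natdist x y : R :=
  xget 0 [set r | (x = y /\ r = 0) \/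
    exists k, [/\ agree k x y, ~ agree k.+1 x y & r = k.+1%:R^-1]].

Lemma natdist_cases x y : (x = y /\ natdist x y = 0) \/
  exists k, [/\ agree k x y, ~ agree k.+1 x y & natdist x y = k.+1%:R^-1].
Proof.
rewrite /natdist; case: xgetP => [r _ //|h]; exfalso.
have [e|ne] := pselect (x = y); first by apply: (h 0); left.
have ex : exists n, `[< ~ agree n x y >].
  apply: contrapT => nx; apply: ne; apply/funext => i; apply: contrapT => xy.
  by apply: nx; exists (pickle i).+1; apply/asboolP => /(_ i (ltnSn _)).
case: (ex_minnP ex) => -[|k] /asboolP nk mk; first by apply: nk.
apply: (h k.+1%:R^-1); right; exists k; split=> //.
by apply: contrapT => /asboolP /mk; rewrite ltnn.
Qed.

Lemma agreeW m n x y : (m <= n)%N -> agree n x y -> agree m x y.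
Proof. by move=> mn h i im; apply: h; exact: leq_trans im mn. Qed.

Lemma natdist_le n x y : natdist x y <= n.+1%:R^-1 <-> agree n x y.
Proof.
have [[-> ->]|[k [ak nk ->]]] := natdist_cases x y; first by split=> // _; rewrite invr_ge0.
rewrite lef_pV2 ?posrE// ler_nat ltnS; split=> [h|h]; first exact: agreeW ak.
by rewrite leqNgt; apply/negP => kn; apply: nk; exact: agreeW h.
Qed.

Lemma natdistxx x : natdist x x = 0.
Proof. by have [[_ ->]//|[k [_ []]]] := natdist_cases x x. Qed.

Lemma natdist_ge0 x y : 0 <= natdist x y.
Proof. by have [[_ ->]//|[k [_ _ ->]]] := natdist_cases x y; rewrite invr_ge0. Qed.

Lemma natdist_positivity x y : natdist x y = 0 -> x = y.
Proof.
have [[->//]|[k [_ _ ->]]] := natdist_cases x y => /eqP.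
by rewrite invr_eq0 pnatr_eq0.
Qed.

Lemma natdist_sym x y : natdist x y = natdist y x.
Proof.
suff h u v : natdist u v <= natdist v u by apply/eqP; rewrite eq_le !h.
have [[-> _]|[k [ak _ ->]]] := natdist_cases v u; first by [].
by apply/natdist_le => i /ak.
Qed.

Lemma natdist_triangle y x z : natdist x z <= natdist x y + natdist y z.
Proof.
have [[-> ->]|[k [ak _ ek]]] := natdist_cases x y; first by rewrite add0r.
have [[<- _]|[l [al _ el]]] := natdist_cases y z; first by rewrite lerDl natdist_ge0.
have [kl|lk] := leqP k l.
  apply: (@le_trans _ _ k.+1%:R^-1); last by rewrite ek lerDl natdist_ge0.
  by apply/natdist_le => i ik; rewrite ak// al//; exact: leq_trans ik kl.
apply: (@le_trans _ _ l.+1%:R^-1); last by rewrite el lerDr natdist_ge0.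
by apply/natdist_le => i il; rewrite ak ?al//; exact: ltn_trans il lk.
Qed.

End NatPowerMetric.

HB.instance Definition _ (R : realType) (I : countType) := gen_eqMixin (natpow R I).
HB.instance Definition _ (R : realType) (I : countType) := gen_choiceMixin (natpow R I).
HB.instance Definition _ (R : realType) (I : countType) :=
  @isMetric.Build R (natpow R I) (@natdist R I) (@natdistxx R I)
   (@natdist_positivity R I) (@natdist_sym R I) (@natdist_triangle R I).

Section NatPowerPolish.
Variables (R : realType) (I : countType).
Let X : topologicalType := prod_topology (fun _ : I => nat).
Let M : metricType R := natpow R I.

Lemma natpow_nbhs (x : M) (A : set M) :
  nbhs x A <-> exists n, forall y, agree n x y -> A y.
Proof.
rewrite -nbhs_ballE; split=> [[e /= e0 he]|[n hn]].
  have /ltr_add_invr[n] := e0; rewrite add0r => ne.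
  exists n => y /(@natdist_le R I) h; apply: he; rewrite ballEmdist /=.
  exact: le_lt_trans ne.
exists n.+1%:R^-1%R; first by rewrite /= invr_gt0.
move=> y; rewrite ballEmdist /= => /ltW h; apply: hn; exact/(@natdist_le R I).
Qed.

Lemma finite_agree n : exists J : seq I, forall i, (pickle i < n)%N -> i \in J.
Proof.
elim: n => [|n [J hJ]]; first by exists [::].
exists (if unpickle n is Some i then i :: J else J) => i; rewrite ltnS leq_eqVlt.
move=> /orP[/eqP <-|/hJ iJ]; first by rewrite pickleK mem_head.
by case: unpickle => // j; rewrite inE iJ orbT.
Qed.

Lemma polish_nat : polish R X.
Proof.
split.
  exists (range (fun c => xget (fun=> 0%N) (@cyl I c))); first by apply: sub_countable (card_image_le _ _) (countableP _).
  move=> O [x Ox] oO.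
  have [|c [cx cO]] := @cyl_nbhs I O x; first exact: open_nbhs_nbhs.
  exists (xget (fun=> 0%N) (@cyl I c)); split; last by exists c.
  apply: cO; exact: (xgetPex _ (ex_intro _ _ cx)).
exists M, (fun x => x), (fun x => x); split=> //.
- move=> x A /natpow_nbhs[n hn]; have [J hJ] := finite_agree n.
  apply/nbhs_cyl; exists J => x' h; apply: hn => i /hJ /h; exact: esym.
- apply: cts_nat => i k; rewrite openE => x /= xi; apply/natpow_nbhs.
  by exists (pickle i).+1 => y h; rewrite /= -(h i (ltnSn _)).
- move=> u cu.
  have h n : exists x : M, \forall m \near \oo, agree n x (u m).
    have [cP _] := @cauchyP R M (u @ \oo) _.
    have [|x hx] := cP cu n.+1%:R^-1%R; first by rewrite invr_gt0.
    exists x; apply: filterS hx => m.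
    by rewrite /= ballEmdist /= => /ltW /(@natdist_le R I).
  have {h} [w hw] := choice h.
  (* [w n] agrees up to [n] with almost all terms of the sequence, so coordinate [i] can be read
     from [w (pickle i).+1]. *)
  exists (fun i => w (pickle i).+1 i) => A /natpow_nbhs[n hn].
  rewrite /fmap /= /nbhs /=.
  suff : \forall m \near \oo, agree n (fun i => w (pickle i).+1 i) (u m).
    by apply: filterS => m /hn.
  elim: n {hn} => [|n IH]; first by apply: filterS filterT => m _ i.
  apply: filterS (filterI IH (hw n.+1)) => m [h1 h2] i.
  rewrite ltnS leq_eqVlt => /orP[/eqP e|/h1//].
  by rewrite e; apply: h2; rewrite e.
Qed.

End NatPowerPolish.

(** * Functions into countable powers that are measurable for a sigma-algebra *)

Lemma salg_rel2 (T : Type) (S : set (set T)) (f g : T -> nat) (r : nat -> nat -> Prop) :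
  salg S -> (forall k, S (fun t => f t = k)) -> (forall k, S (fun t => g t = k)) ->
  S (fun t => r (f t) (g t)).
Proof.
move=> hS hf hg.
apply: (@salg_ext _ _ (fun t => exists k, f t = k /\ r k (g t))).
  by move=> t; split=> [[k [-> ]]//|h]; exists (f t).
apply: (salg_ex hS) => k; apply: salg_and => //.
exact: (salg_fiber hS (r k) hg).
Qed.

Definition mea (T : Type) (I : countType) (S : set (set T)) (f : T -> I -> nat) : Prop :=
  forall i k, S (fun t => f t i = k).

Section Mea.
Context {T : Type} (S : set (set T)).
Hypothesis hS : salg S.
Notation X I := (prod_topology (fun _ : I => nat) : topologicalType).

Lemma mea_borel (I : countType) (f : T -> X I) (A : set (X I)) : mea S f -> borel A -> S (fun t => A (f t)).
Proof.
move=> hf; apply: (borel_min (salg_pre f hS)); apply: salg_nat_open; first exact: salg_pre.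
exact: hf.
Qed.

Lemma mea_eq (I : countType) (f g : T -> X I) : mea S f -> mea S g -> S (fun t => f t = g t).
Proof.
move=> hf hg; apply: (@salg_ext _ _ (fun t => forall i, f t i = g t i)).
  by move=> t; split=> [|->//]; move/funext.
by apply: salg_allc => // i; exact: (salg_rel2 eq hS).
Qed.

Lemma mea_borel2 (I J : countType) (f : T -> X I) (g : T -> X J) (A : set (X I * X J)) :
  mea S f -> mea S g -> borel A -> S (fun t => A (f t, g t)).
Proof.
move=> hf hg; apply: (borel_min (salg_pre (fun t => (f t, g t)) hS)) => U oU /=.
apply: (@salg_ext _ _ (fun t => exists c : seq (I * nat) * seq (J * nat),
  (cyl c.1 `*` cyl c.2 `<=` U) /\ (cyl c.1 (f t) /\ cyl c.2 (g t)))).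
  move=> t; split=> [[c [+ h]]|Ut]; first exact.
  have : nbhs (f t, g t) U by apply: open_nbhs_nbhs.
  move=> [[A1 A2] [/= /cyl_nbhs[c1 [f1 s1]] /cyl_nbhs[c2 [f2 s2]]] sU].
  exists (c1, c2); split=> // -[a b] [/= /s1 ha /s2 hb]; exact: sU.
apply: salg_exc => // c; apply: salg_and => //; first exact: salg_const.
by apply: salg_and => //; apply: mea_borel => //; apply: borel_open; exact: cyl_open.
Qed.

Lemma mea_comp (I J : countType) (f : T -> X I) (g : X I -> J -> nat) :
  mea S f -> mea (@borel (X I)) g -> mea S (g \o f).
Proof. by move=> hf hg i k; exact: (mea_borel hf (hg i k)). Qed.

End Mea.

Lemma mea_id (I : countType) : mea (@borel (prod_topology (fun _ : I => nat))) (fun x => x).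
Proof. by move=> i k; exact: borel_coord. Qed.

Lemma mea_cts (T : topologicalType) (I : countType)
  (f : T -> prod_topology (fun _ : I => nat)) : continuous f -> mea (@borel T) f.
Proof. by move=> cf i k; exact: (borel_preimage cf (@borel_coord I i k)). Qed.

(** * The graph *)

Section Graph.
Variable D : nat.

(** The coordinates [(0, n)] and [(1, n)] hold the parameters [d] and [T], the coordinates [(2, n)]
    the digits, and a word holds the label of the last edge of the path it describes. *)
Definition idx : countType := (nat * nat + seq 'I_D)%type.
Definition vtx : topologicalType := prod_topology (fun _ : idx => nat).
Implicit Types (x : vtx) (w v : seq 'I_D) (i j : 'I_D).

Definition dg x (n : nat) : nat := x (inl (2, n)).
Definition lb x w : nat := x (inr w).

(* Seen from the other end of the edge [i], the path [w] becomes [swp i w]. *)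
Definition swp i w : seq 'I_D :=
  match w with
  | [::] => [::]
  | a :: w' => if a != i then i :: w else
      match w' with [::] => w | b :: _ => if b == i then w else w' end
  end.

(* The label of an edge leaving [x] is [0] if the other end has the shifted
   digit sequence, and [k + 1] if the other end has the digit sequence of [x]
   with [k] put in front. *)
Definition gam i x : vtx := fun c =>
  match c with
  | inr w => if w == [:: i] then (if lb x w is _.+1 then 0%N else (dg x 0).+1)
             else lb x (swp i w)
  | inl (2, n) => if lb x [:: i] is k.+1 then (if n is m.+1 then dg x m else k)
                  else dg x n.+1
  | inl p => x (inl p)
  end.

(** The words that begin with [i] twice and the word [[:: i]] are fixed, which makes the map an
    involution on all words and not only on reduced ones. *)
Lemma swpK i : involutive (swp i).
Proof.
case=> [//|a w] /=; have [->|ai] := eqVneq a i; last by rewrite /= eqxx /= (negbTE ai).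
case: w => [|b w] /=; first by rewrite eqxx.
by have [->|bi] := eqVneq b i; rewrite /= ?eqxx ?bi.
Qed.

Lemma swp_eq i w : (swp i w == [:: i]) = (w == [:: i]).
Proof. apply/eqP/eqP => [e|->]; last by rewrite /= eqxx.
by rewrite -[w](swpK i) e /= eqxx. Qed.

(** A shift stores the dropped digit, plus one, as the label of the edge seen from the other end, so
    it can be undone. *)
Lemma gamK i : involutive (gam i).
Proof.
move=> x; apply/funext => -[[[|[|[|a]]] n]|w] //=; rewrite /gam /lb /dg /= ?eqxx /=.
  by case E: (x _) => [|k]; case: n.
rewrite swp_eq swpK; case: eqVneq => [->|//].
by case: (x (inr [:: i])).
Qed.

Lemma gam_borel i : mea (@borel vtx) (gam i).
Proof.
have hS := borel_salg vtx; have hb c k := @borel_coord idx c k.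
move=> [[[|[|[|a]]] n]|w] k; try exact: hb; rewrite /gam.
- apply: (@salg_ext _ (@borel vtx) (fun x : vtx => (lb x [:: i] = 0%N /\ dg x n.+1 = k) \/
    exists l, lb x [:: i] = l.+1 /\ (if n is m.+1 then dg x m else l) = k)).
    move=> x; case: (lb x [:: i]) => [|l]; split.
    + by case=> [[]|[l' []]].
    + by left.
    + by case=> [[]|[l' [[->]]]].
    + by right; exists l.
  apply: (salg_or hS); first exact: (salg_and hS (hb _ _) (hb _ _)).
  apply: (salg_ex hS) => l; apply: (salg_and hS) => //; first exact: hb.
  by case: n => [|m]; [exact: salg_const|exact: hb].
- case: eqP => [->|_]; last exact: hb.
  apply: (@salg_ext _ (@borel vtx) (fun x : vtx => (if lb x [:: i] is _.+1 then 0 else (dg x 0).+1) = k)).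
    by [].
  exact: (@salg_rel2 _ (@borel vtx) (fun x : vtx => lb x [:: i]) (fun x => dg x 0)
    (fun a b => (if a is _.+1 then 0 else b.+1) = k)
    hS (hb _) (hb _)).
Qed.

(** ** Walks *)

Definition act w x : vtx := foldl (fun x i => gam i x) x w.

Lemma act_cat w v x : act (w ++ v) x = act v (act w x).
Proof. exact: foldl_cat. Qed.

Lemma act_rcons w i x : act (rcons w i) x = gam i (act w x).
Proof. exact: foldl_rcons. Qed.

Lemma actK w x : act (rev w) (act w x) = x.
Proof.
elim: w x => [//|i w IH] x; rewrite rev_cons act_rcons.
by rewrite (IH (gam i x) : act (rev w) (act (i :: w) x) = _) gamK.
Qed.

Lemma act_borel w : mea (@borel vtx) (act w).
Proof.
elim: w => [|i w IH]; first exact: mea_id.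
by apply: (mea_comp (borel_salg _) (f := gam i) (g := act w)) => //; exact: gam_borel.
Qed.

Definition red w : bool := sorted (fun a b => a != b) w.

(** ** The vertex set *)

Definition incr x : Prop := exists N, forall n, (N <= n)%N -> (dg x n < dg x n.+1)%N.

Lemma dg_gam i x n : dg (gam i x) n =
  if lb x [:: i] is k.+1 then (if n is m.+1 then dg x m else k) else dg x n.+1.
Proof. by []. Qed.

Lemma incr_gam i x : incr x -> incr (gam i x).
Proof.
move=> [N h]; exists N.+1 => n Nn; rewrite !dg_gam.
case: (lb _ _) => [|k]; first by apply: h; exact: leq_trans (ltnW Nn) _.
by case: n Nn => [//|n] Nn; exact: h.
Qed.

Lemma incr_act w x : incr x -> incr (act w x).
Proof. by elim: w x => [//|i w IH] x hx; apply: IH; exact: incr_gam. Qed.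

Lemma incr_neq i x : incr x -> gam i x <> x.
Proof.
move=> [N h] e.
have E n : dg x n = if lb x [:: i] is k.+1 then (if n is m.+1 then dg x m else k) else dg x n.+1.
  by rewrite -dg_gam e.
case: (lb x [:: i]) E => [|k] E; first by have := h N (leqnn _); rewrite {1}(E N) ltnn.
by have := h N (leqnn _); rewrite (E N.+1) ltnn.
Qed.

Definition free x : Prop := forall v w, red w -> w != [::] -> act w (act v x) <> act v x.

Lemma free_gam i x : free x -> free (gam i x).
Proof. by move=> h v w rw w0; exact: (h (i :: v)). Qed.

Lemma incr_borel : borel incr.
Proof.
have hS := borel_salg vtx; apply: (salg_ex hS) => N; apply: (salg_allc hS) => n.
apply: (salg_imp hS); first exact: salg_const.
exact: (@salg_rel2 _ _ (fun x => dg x n) (fun x => dg x n.+1) (fun a b => (a < b)%N) hS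
  (@borel_coord _ _) (@borel_coord _ _)).
Qed.

Lemma free_borel : borel free.
Proof.
have hS := borel_salg vtx; apply: (salg_allc hS) => v; apply: (salg_allc hS) => w.
apply: (salg_imp hS); first exact: salg_const.
apply: (salg_imp hS); first exact: salg_const.
apply: (salg_not hS); apply: (mea_eq hS (f := fun x => act w (act v x)) (g := act v)).
  by apply: (mea_comp hS (f := act v) (g := act w)); exact: act_borel.
exact: act_borel.
Qed.

Definition V x : Prop := incr x /\ free x.

Lemma V_gam i x : V x -> V (gam i x).
Proof. by move=> [? ?]; split; [exact: incr_gam|exact: free_gam]. Qed.

Lemma V_borel : borel V.
Proof. exact: (salg_and (borel_salg _) incr_borel free_borel). Qed.

Definition walk_graph : set (vtx * vtx) := [set p | V p.1 /\ exists i, p.2 = gam i p.1].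

Lemma H_borel : borel walk_graph.
Proof.
have hS := borel_salg (vtx * vtx)%type.
have h1 : mea (@borel (vtx * vtx)%type) fst by apply: mea_cts => x; exact: cvg_fst.
have h2 : mea (@borel (vtx * vtx)%type) snd by apply: mea_cts => x; exact: cvg_snd.
apply: (salg_and hS); first exact: (mea_borel hS h1 V_borel).
apply: (salg_exc hS) => i; apply: (mea_eq hS h2).
by apply: (mea_comp hS h1); exact: gam_borel.
Qed.

Lemma H_sym x y : walk_graph (x, y) -> walk_graph (y, x).
Proof. by move=> [/= Vx [i ->]]; split; [exact: V_gam|exists i; rewrite /= gamK]. Qed.

Lemma H_irr x : ~ walk_graph (x, x).
Proof. by move=> [/= [hx _] [i /esym]]; exact: incr_neq. Qed.

Lemma H_borel_graph : borel_graph walk_graph.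
Proof. by split; [exact: H_borel|exact: H_sym|exact: H_irr]. Qed.

Lemma H_bounded : bounded_degree walk_graph.
Proof.
exists D => x; apply: (@card_le_trans _ _ _ ((fun i => gam i x) @` [set: 'I_D])).
  by apply: subset_card_le => y [_ /= [i ->]]; exists i.
apply: (card_le_trans (card_image_le _ _)).
by have /card_eqPle[] := @card_II D.
Qed.

Lemma H_walk x (s : seq vtx) : path [rel a b | (a, b) \in walk_graph] x s ->
  exists w, size w = size s /\
    forall k, (k <= size s)%N -> nth x (x :: s) k = act (take k w) x.
Proof.
elim: s x => [|y s IH] x /=; first by move=> _; exists [::]; split=> // -[].
move=> /andP[/set_mem[_ /= [i ->]] /IH[w [sw hw]]]; exists (i :: w); split=> [|[//|k] ks].
  by rewrite /= sw.
by rewrite /= -[RHS](hw k ks); apply: set_nth_default.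
Qed.

(* Reading the letters off a cycle gives a reduced word. *)
Lemma H_acyclic : acyclic walk_graph.
Proof.
move=> s s2 /andP[]; case: s s2 => // x s s2 /= pth un.
have Vx : V x by case: s pth {s2 un} => [|y s] /= /andP[/set_mem[]].
have [w [sw hw]] := H_walk pth.
have e0 : act w x = x.
  have := hw (size w); rewrite sw leqnn take_oversize ?sw // => /(_ isT) <-.
  by rewrite size_rcons /= nth_rcons ltnn eqxx.
have w0 : w != [::] by rewrite -size_eq0 sw size_rcons.
have i0 : 'I_D by case: w w0 {sw hw e0}.
case: Vx => _ /(_ [::] w) /=; rewrite e0; apply=> //; apply/(sortedP i0) => k kw.
apply/eqP => ek; have kw' := ltnW kw.
have {ek} : nth x (x :: rcons s x) k.+2 = nth x (x :: rcons s x) k.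
  rewrite !hw -?sw ?(take_nth i0 kw) ?(take_nth i0 kw') ?act_rcons -?ek ?gamK//.
  exact: ltnW.
have sk : (k.+1 <= size s)%N by rewrite -ltnS -(size_rcons s x) -sw.
rewrite -rcons_cons !nth_rcons /= !ltnS (ltnW sk).
case: (ltnP k.+1 (size s)) => [ks|ks].
  have := @nth_uniq _ x (x :: s) k.+2 k ks (leqW sk) un => /= h /eqP.
  by rewrite h eqn_leq ltnNge leqnSn.
have ek : size s = k.+1 by apply/eqP; rewrite eqn_leq ks.
rewrite ek eqxx => /esym; case: k {kw kw'} sk ks ek => [|k] sk ks ek; first by rewrite /= ek in s2.
move=> /= e; have := @nth_uniq _ x (x :: s) k.+1 0 (leqW sk) isT un.
by rewrite /= e eqxx.
Qed.

(** ** A coloring with one more color than the degree *)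

Definition mex (s : seq nat) : nat := find (fun k => k \notin s) (iota 0 (size s).+1).

Lemma mexP s : mex s \notin s /\ (mex s <= size s)%N.
Proof.
have hs : has (fun k => k \notin s) (iota 0 (size s).+1).
  apply/negbNE/negP => /hasPn h.
  have : (size (iota 0 (size s).+1) <= size s)%N.
    by apply: uniq_leq_size => [|k /h]; rewrite ?iota_uniq ?negbK.
  by rewrite size_iota ltnn.
have := hs; rewrite has_find size_iota ltnS => l; split=> //.
by have := nth_find 0 hs; rewrite nth_iota.
Qed.

Lemma mex_subproof (x : vtx) : V x -> exists k, `[< exists c : seq (idx * nat),
  [/\ k = pickle c, cyl c x & forall i, ~ cyl c (gam i x)] >].
Proof.
move=> Vx; have h i : exists a, gam i x a <> x a.
  apply: contrapT => n; apply: (@incr_neq i x); first by case: Vx.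
  by apply/funext => a; apply: contrapT => xa; apply: n; exists a.
have {h} [f hf] := choice h; pose c := [seq (f i, x (f i)) | i <- enum 'I_D].
exists (pickle c); apply/asboolP; exists c; split=> // [|i].
  by rewrite /cyl /= all_map; apply/allP => i _ /=.
by rewrite /cyl /= all_map => /allP /(_ i); rewrite mem_enum => /(_ isT) /= /eqP /hf.
Qed.

(** A vertex is separated from its finitely many neighbours by a cylinder. The least code of such a
    cylinder is a Borel rank that differs at adjacent vertices, and the greedy coloring follows this
    rank. *)
Definition sep (k : nat) x : Prop :=
  exists c : seq (idx * nat), [/\ k = pickle c, cyl c x & forall i, ~ cyl c (gam i x)].
Definition rank_at (k : nat) x : Prop := sep k x /\ forall m, (m < k)%N -> ~ sep m x.

Lemma sep_borel k : borel (sep k).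
Proof.
have hS := borel_salg vtx; apply: (@salg_ext _ (@borel vtx)
  (fun x => exists c, k = pickle c /\ (cyl c x /\ forall i, ~ cyl c (gam i x)))).
  by move=> x; split=> [[c [? []]]|[c []]]; exists c; split.
apply: (salg_exc hS) => c; apply: (salg_and hS); first exact: salg_const.
have bc : borel (@cyl idx c) by apply: borel_open; exact: cyl_open.
apply: (salg_and hS) => //; apply: (salg_allc hS) => i; apply: (salg_not hS).
exact: (mea_borel hS (gam_borel i) bc).
Qed.

Lemma rank_at_borel k : borel (rank_at k).
Proof.
have hS := borel_salg vtx; apply: (salg_and hS); first exact: sep_borel.
apply: (salg_allc hS) => m; apply: (salg_imp hS); first exact: salg_const.
by apply: (salg_not hS); exact: sep_borel.
Qed.

Lemma rank_at_ex x : V x -> exists k, rank_at k x.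
Proof.
move=> /mex_subproof ex; case: (ex_minnP ex) => k /asboolP hk mk; exists k; split=> // m mk'.
by move=> hm; have := mk m (introT (asboolP _) hm); rewrite leqNgt mk'.
Qed.

Lemma rank_at_uniq x k l : rank_at k x -> rank_at l x -> k = l.
Proof.
by move=> [hk mk] [hl ml]; have [/ml|/mk|//] := ltngtP k l.
Qed.

Lemma rank_at_neq x k i : rank_at k x -> ~ rank_at k (gam i x).
Proof.
move=> [[c [-> _ h]] _] [[c' [e cx _]] _]; apply: (h i).
by have [->] : Some c = Some c' by rewrite -(pickleK c) e pickleK.
Qed.

(* [n] is fuel: the color of a vertex of rank [k] only depends on its neighbours
   of smaller rank. *)
Fixpoint greedy (n : nat) x : nat :=
  if n is n'.+1 then
    mex [seq if `[< exists k l, [/\ rank_at k x, rank_at l (gam i x) & (l < k)%N] >]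
             then greedy n' (gam i x) else D.+1 | i <- enum 'I_D]
  else 0%N.

Lemma greedy_le n x : (greedy n x < D.+1)%N.
Proof.
case: n => [//|n] /=; rewrite ltnS; set s := (X in mex X).
by have [_] := mexP s; rewrite size_map size_enum_ord.
Qed.

Lemma greedy_fuel n m x k : rank_at k x -> (k < n)%N -> (k < m)%N -> greedy n x = greedy m x.
Proof.
elim: n m x k => [//|n IH] [//|m] x k hk kn km /=; congr mex; apply: eq_map => i.
case: asboolP => // -[k' [l [/(rank_at_uniq hk) <- hl lk]]].
by apply: (IH _ _ l) => //; exact: leq_trans lk _.
Qed.

Lemma greedy_neq n x i k l : rank_at k x -> rank_at l (gam i x) -> (k < n)%N -> (l < n)%N ->
  greedy n x <> greedy n (gam i x).
Proof.
wlog lk : x k l / (l < k)%N.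
  move=> hw hk hl kn ln; case: (ltngtP k l) => [kl|lk|e]; last by subst l; case: (rank_at_neq hk hl).
    move=> /esym; rewrite -{2}(gamK i x); apply: (hw _ l k) => //; by rewrite gamK.
  exact: (hw _ k l).
move=> hk hl kn ln; case: n kn ln => [//|n] kn ln.
rewrite (@greedy_fuel n.+1 n (gam i x) l)//; last exact: leq_trans lk _.
rewrite [in LHS]/=; set s := (X in mex X); have [+ _] := mexP s => /negP ns e; apply: ns.
rewrite e; apply/mapP; exists i; first by rewrite mem_enum.
by case: asboolP => // -[]; exists k, l.
Qed.

Lemma greedy_borel n : forall k, borel (fun x => greedy n x = k).
Proof.
have hS := borel_salg vtx.
elim: n => [|n IH] k /=; first exact: salg_const.
pose P i x := exists k l, [/\ rank_at k x, rank_at l (gam i x) & (l < k)%N].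
have bP i : borel (P i).
  apply: (@salg_ext _ (@borel vtx) (fun x => exists k l, rank_at k x /\ (rank_at l (gam i x) /\ (l < k)%N))).
    by move=> x; split=> [[k' [l [? [? ?]]]]|[k' [l [? ? ?]]]]; exists k', l; split.
  apply: (salg_ex hS) => k'; apply: (salg_ex hS) => l; apply: (salg_and hS); first exact: rank_at_borel.
  apply: (salg_and hS); last exact: salg_const.
  exact: (mea_borel hS (gam_borel i) (rank_at_borel l)).
apply: (@salg_ext _ (@borel vtx) (fun x => exists t : D.-tuple nat, mex t = k /\
  forall i : 'I_D, (P i x -> greedy n (gam i x) = tnth t i) /\ (~ P i x -> D.+1 = tnth t i))).
  move=> x; split=> [[t [<- h]]|<-].
    congr mex; rewrite -[RHS]map_tnth_enum; apply: eq_map => i.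
    by have [h1 h2] := h i; case: asboolP => [/h1|/h2].
  exists [tuple if `[< P i x >] then greedy n (gam i x) else D.+1 | i < D]; split.
    by congr mex; apply: eq_map.
  by move=> i; rewrite tnth_mktuple; case: asboolP.
apply: (salg_exc hS) => t; apply: (salg_and hS); first exact: salg_const.
apply: (salg_allc hS) => i; apply: (salg_and hS); apply: (salg_imp hS) => //.
- exact: (mea_borel hS (gam_borel i) (IH _)).
- exact: (salg_not hS).
- exact: salg_const.
Qed.

Lemma H_colorable : colorable (@borel vtx) walk_graph (Fin D.+1).
Proof.
have hS := borel_salg vtx.
pose st x := xget 0%N [set k | rank_at k x].
have stE x k : rank_at k x -> st x = k.
  by move=> hk; have h := xgetPex 0%N (ex_intro (rank_at^~ x) k hk); exact: (rank_at_uniq h hk).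
exists (fun x => greedy (st x).+1 x); split=> [x|A|x y [/= Vx [i ->]]].
- exact: greedy_le.
- apply: (salg_fiber hS) => c; apply: (@salg_ext _ (@borel vtx) (fun x =>
    (exists k, rank_at k x /\ greedy k.+1 x = c) \/ ((forall k, ~ rank_at k x) /\ greedy 1 x = c))).
    move=> x; split=> [[[k [hk <-]]|[h <-]]|<-]; first by rewrite (stE _ _ hk).
      by rewrite /st; case: xgetP => [k _ /h|].
    have [[k hk]|h] := pselect (exists k, rank_at k x).
      by left; exists k; rewrite (stE _ _ hk).
    right; split=> [k hk|]; first by apply: h; exists k.
    by rewrite /st; case: xgetP => [k _ hk|//]; case: h; exists k.
  apply: (salg_or hS).
    by apply: (salg_ex hS) => k; apply: (salg_and hS); [exact: rank_at_borel|exact: greedy_borel].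
  apply: (salg_and hS); last exact: greedy_borel.
  by apply: (salg_allc hS) => k; apply: (salg_not hS); exact: rank_at_borel.
- have [k hk] := rank_at_ex Vx; have [l hl] := rank_at_ex (V_gam i Vx).
  change (greedy (st x).+1 x <> greedy (st (gam i x)).+1 (gam i x)).
  rewrite (stE _ _ hk) (stE _ _ hl).
  rewrite (@greedy_fuel k.+1 (maxn k l).+1 x k)// ?ltnS ?leq_maxl//.
  rewrite (@greedy_fuel l.+1 (maxn k l).+1 (gam i x) l)// ?ltnS ?leq_maxr//.
  by apply: (greedy_neq hk hl); rewrite ltnS ?leq_maxl ?leq_maxr.
Qed.

End Graph.

(** * Components with cycles *)

Section NonFree.
Variable D : nat.
Variable i0 : 'I_D.
Implicit Types (x g h : vtx D) (w v u : seq 'I_D) (i j : 'I_D) (q : seq 'I_D * seq (idx D * nat)).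
Local Notation borel := (@borel (vtx D)).
Local Notation hS := (borel_salg (vtx D)).

Definition closed_at w x : Prop := [/\ red w, w <> [::] & act w x = x].
Definition hasc (l : nat) x : Prop := exists v w, size w = l /\ closed_at w (act v x).
Definition girth l x : Prop := hasc l x /\ forall m, (m < l)%N -> ~ hasc m x.

(* The base point [g] of a shortest cycle is the only one near [g] in the
   cylinder, so that distinct marked cycles are disjoint. *)
Definition marked q g : Prop := [/\ closed_at q.1 g, cyl q.2 g &
  forall v, (size v <= size q.1 + size q.1)%N -> act v g = g \/ ~ cyl q.2 (act v g)].
Definition hasq q x : Prop := girth (size q.1) x /\ exists v, marked q (act v x).
Definition sel q x : Prop := hasq q x /\ forall q', (pickle q' < pickle q)%N -> ~ hasq q' x.
Definition onc q t x : Prop := (t < size q.1)%N /\ marked q (act (rev (take t q.1)) x).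
Definition near q n x : Prop := exists u, size u = n /\ exists t, onc q t (act u x).
(** On a chosen cycle a vertex points to its successor, elsewhere to a neighbour strictly nearer to
    the chosen cycles. *)
Definition pick i x : Prop := exists q, sel q x /\
  ((exists t, onc q t x /\ nth i0 q.1 t = i) \/
   ((forall t, ~ onc q t x) /\
    exists n, near q n (gam i x) /\ forall m, (m <= n)%N -> ~ near q m x)).

Lemma ex_act_gam (P : set (vtx D)) i x :
  (exists v, P (act v (gam i x))) <-> exists v, P (act v x).
Proof.
split=> -[v h]; first by exists (i :: v).
by exists (i :: v); rewrite -[act _ _]/(act v (gam i (gam i x))) gamK.
Qed.

Lemma hasc_gam l i x : hasc l (gam i x) <-> hasc l x.
Proof. exact: (ex_act_gam (fun y => exists w, size w = l /\ closed_at w y)). Qed.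

Lemma girth_gam l i x : girth l (gam i x) <-> girth l x.
Proof. split=> -[/hasc_gam h m]; split=> // k /m hk; first by move=> /(hasc_gam k i x).
by move=> /hasc_gam. Qed.

Lemma girth_act l v x : girth l (act v x) <-> girth l x.
Proof. by elim: v x => [//|i v IH] x; rewrite -(girth_gam l i x); exact: IH. Qed.

Lemma hasq_gam q i x : hasq q (gam i x) <-> hasq q x.
Proof.
by split=> -[/girth_gam h1 h2]; split=> //; apply/(ex_act_gam (marked q) i); rewrite ?gamK.
Qed.

Lemma sel_gam q i x : sel q (gam i x) <-> sel q x.
Proof.
split=> -[/hasq_gam h m]; split=> // k /m hk; first by move=> /(hasq_gam k i x).
by move=> /hasq_gam.
Qed.

Lemma sel_uniq q q' x : sel q x -> sel q' x -> q = q'.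
Proof.
move=> [h m] [h' m']; have [/m'|/m|e] := ltngtP (pickle q) (pickle q') => //.
by have [] : Some q = Some q' by rewrite -(pickleK q) e pickleK.
Qed.

Lemma onc_walk q t x : onc q t x -> exists g, marked q g /\ x = act (take t q.1) g.
Proof.
move=> [_ h]; exists (act (rev (take t q.1)) x); split=> //.
by have := actK (rev (take t q.1)) x; rewrite revK.
Qed.

Lemma marked_onc q t g : marked q g -> (t < size q.1)%N -> onc q t (act (take t q.1) g).
Proof. by move=> mg tq; split=> //; rewrite actK. Qed.

Lemma red_drop k w : red w -> red (drop k w).
Proof. exact: drop_sorted. Qed.

Lemma red_take k w : red w -> red (take k w).
Proof. exact: take_sorted. Qed.

(** The base points belonging to [t] and [t'] are joined by a word of length at most twice the
    girth, so [marked] identifies them; different [t] and [t'] would then give a closed reduced word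
    shorter than the girth. *)
Lemma onc_uniq q t t' x : girth (size q.1) x -> onc q t x -> onc q t' x -> t = t'.
Proof.
move=> gx; wlog tt : t t' / (t <= t')%N.
  by move=> hw h h'; case/orP: (leq_total t t') => l; [exact: hw|symmetry; exact: hw].
move=> h h'; have [tq _] := h; have [tq' _] := h'.
have [g [mg xg]] := onc_walk h; have [g' [mg' xg']] := onc_walk h'.
have gg : g' = g.
  have e : g' = act (take t q.1 ++ rev (take t' q.1)) g.
    by rewrite act_cat -xg xg' actK.
  have [_ _ /(_ (take t q.1 ++ rev (take t' q.1)))] := mg; rewrite -e; case=> //.
    by rewrite size_cat size_rev !size_take tq tq'; apply: leq_add; apply: ltnW.
  by case: mg'.
apply/eqP; rewrite eqn_leq tt leqNgt; apply/negP => lt.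
have [_ /(_ (t' - t)%N)] := gx; case.
  exact: leq_ltn_trans (leq_subr _ _) tq'.
exists [::], (drop t (take t' q.1)); rewrite size_drop size_take tq'; split=> //.
have [[rq _ _] _ _] := mg; split; first by apply: red_drop; exact: red_take.
  by move/(congr1 size); rewrite size_drop size_take tq' /= => /eqP; rewrite subn_eq0 leqNgt lt.
rewrite /= [in LHS]xg -act_cat.
have -> : take t q.1 ++ drop t (take t' q.1) = take t' q.1.
  by rewrite -{2}(cat_take_drop t (take t' q.1)) take_takel.
by rewrite [RHS]xg' gg.
Qed.

Lemma onc_next q t x i : incr x -> girth (size q.1) x -> onc q t x -> nth i0 q.1 t = i ->
  exists t', onc q t' (gam i x) /\ nth i0 q.1 t' <> i.
Proof.
move=> ix gx h ei; have [tq _] := h; have [g [mg xg]] := onc_walk h.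
have ex : gam i x = act (take t.+1 q.1) g by rewrite (take_nth i0 tq) act_rcons -xg ei.
have [[rq q0 qg] _ _] := mg.
have [tq'|] := ltnP t.+1 (size q.1).
  exists t.+1; split; first by rewrite ex; exact: marked_onc.
  by move: rq => /(sortedP i0)/(_ _ tq'); rewrite ei => /eqP h' /esym.
(* At the last letter the next vertex is the base point. If the first letter were also [i],
   cancelling the first and last letters would leave a shorter cycle; a one-letter cycle is excluded
   by [incr_neq]. *)
move=> qt; have et : size q.1 = t.+1 by apply/eqP; rewrite eqn_leq qt.
exists 0%N; split.
  rewrite ex take_oversize ?et// qg.
  by have := @marked_onc q 0%N g mg; rewrite take0; apply; rewrite et.
have gg : incr g by rewrite -(actK (take t q.1) g) -xg; exact: incr_act.
have girg : girth (size q.1) g by move: gx; rewrite xg girth_act.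
case: q.1 rq q0 qg et ei tq girg {h xg mg ex qt} => [//|a w] /= rq _ qg [et] ei tq girg ea.
subst a; case/lastP: w => [|u b] in rq qg et ei tq girg *.
  exact: (@incr_neq _ i g).
move: ei; rewrite -et size_rcons /= nth_rcons ltnn eqxx => eb; subst b.
have [_ /(_ (size u))] := girg; case; first by rewrite /= size_rcons.
exists [:: i], u; split=> //; split.
- by have := red_take (size u) (red_drop 1 (rq : red (i :: rcons u i))); rewrite /= drop0 -cats1 take_size_cat.
- by move=> u0; move: rq; rewrite u0 /= eqxx.
- by rewrite -{2}qg /act /= foldl_rcons gamK.
Qed.

(** If one end lies on a chosen cycle, [onc_next] puts the other end there too, with a different
    next letter; otherwise each end would be strictly nearer to the cycles than the other. *)
Lemma pick_conflict i x : incr x -> pick i x -> ~ pick i (gam i x).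
Proof.
move=> ix [q [sq hx]] [q' [/sel_gam sq' hx']]; have e := sel_uniq sq' sq; subst q'.
have gx : girth (size q.1) x by case: sq => -[].
have gx' : girth (size q.1) (gam i x) by apply/girth_gam.
case: hx => [[t [ht et]]|[nx [n [h1 h2]]]].
  have [t1 [h1 n1]] := onc_next ix gx ht et.
  case: hx' => [[t2 [h2 e2]]|[/(_ _ h1)//]].
  by apply: n1; rewrite (onc_uniq gx' h1 h2).
case: hx' => [[t [ht et]]|[nx' [n' [h1' h2']]]].
  have [t1 [h1' _]] := onc_next (incr_gam i ix) gx' ht et.
  by rewrite gamK in h1'; exact: nx h1'.
rewrite gamK in h1'.
have l1 : (n' > n)%N by rewrite ltnNge; apply/negP => /h2.
have l2 : (n > n')%N by rewrite ltnNge; apply/negP => /h2'.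
by move: (ltn_trans l1 l2); rewrite ltnn.
Qed.

Lemma short_words n : exists L : seq (seq 'I_D), forall v, (size v <= n)%N -> v \in L.
Proof.
elim: n => [|n [L hL]]; first by exists [:: [::]] => -[].
exists ([::] :: [seq i :: v | i <- enum 'I_D, v <- L]) => -[|i v] //=; rewrite ltnS => /hL vL.
by rewrite inE /=; apply: allpairs_f => //; rewrite mem_enum.
Qed.

(** The words of length at most twice the girth move the base point to finitely many points, so some
    cylinder contains the base point and none of the others. *)
Lemma sel_ex x : ~ free x -> exists q, sel q x.
Proof.
move=> nf; have [l] : exists l, `[< hasc l x >].
  apply: contrapT => n; apply: nf => v w rw w0 e; apply: n.
  exists (size w); apply/asboolP; exists v, w; split=> //; split=> //; exact/eqP.
move=> exl; have {l exl} [l gl] : exists l, girth l x.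
  case: (ex_minnP (ex_intro (fun l => `[< hasc l x >]) l exl)) => m /asboolP hm mm.
  by exists m; split=> // k km hk; have := mm k (introT (asboolP _) hk); rewrite leqNgt km.
have [[v [w [sw cw]]] _] := gl; set g := act v x in cw.
have h u : exists a, act u g = g \/ act u g a <> g a.
  have [e|ne] := pselect (act u g = g); first by exists (inr [::]); left.
  apply: contrapT => n; apply: ne; apply/funext => a; apply: contrapT => na; apply: n.
  by exists a; right.
have {h} [f hf] := choice h; have [L hL] := short_words (size w + size w).
pose c := [seq (f u, g (f u)) | u <- L].
have hq : hasq (w, c) x.
  split; first by rewrite sw.
  exists v; split=> // [|u /hL uL /=].
    by rewrite /cyl /= all_map; apply/allP => u _ /=.
  have [|ne] := hf u; [by left|right].
  by rewrite /cyl /= all_map => /allP /(_ u uL) /= /eqP.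
have ex : exists k, `[< exists q, pickle q = k /\ hasq q x >].
  by exists (pickle (w, c)); apply/asboolP; exists (w, c).
case: (ex_minnP ex) => k /asboolP[q [ek hk]] mk; exists q; split=> // q' qq hq'.
have hq'' : `[< exists q1, pickle q1 = pickle q' /\ hasq q1 x >] by apply/asboolP; exists q'.
by have := mk _ hq''; rewrite leqNgt -ek qq.
Qed.

Lemma pick_ex x : ~ free x -> exists i, pick i x.
Proof.
move=> /sel_ex[q sq]; have [[t ht]|nt] := pselect (exists t, onc q t x).
  by exists (nth i0 q.1 t), q; split=> //; left; exists t.
have {}nt t : ~ onc q t x by move=> ht; apply: nt; exists t.
have [[_ [v mv]] _] := sq.
have ex : exists n, `[< near q n x >].
  exists (size v); apply/asboolP; exists v; split=> //; exists 0%N.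
  have [[_ q0 _] _ _] := mv.
  by have := @marked_onc q 0%N _ mv; rewrite take0; apply; case: q.1 q0.
case: (ex_minnP ex) => n /asboolP[u [<- {n} [t ht]]] mn.
case: u ht mn => [/nt//|i u] ht mn; exists i, q; split=> //; right; split=> //.
exists (size u); split; first by exists u; split=> //; exists t.
move=> m mu hm; have := mn m (introT (asboolP _) hm); rewrite leqNgt ltnS.
by rewrite mu.
Qed.

Lemma closed_at_borel w : borel (closed_at w).
Proof.
apply: (@salg_ext _ borel (fun x => (red w /\ w <> [::]) /\ act w x = x)).
  by move=> x; split=> [[[? ?] ?]|[? ? ?]].
by apply: (salg_and hS); [exact: (salg_const hS)|exact: (@mea_eq _ _ hS _ (act w) (fun x => x) (act_borel w) (@mea_id _))].
Qed.

Lemma borel_act (P : set (vtx D)) v : borel P -> borel (fun x => P (act v x)).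
Proof. exact: (mea_borel hS (act_borel v)). Qed.

Lemma hasc_borel l : borel (hasc l).
Proof.
apply: (salg_exc hS) => v; apply: (salg_exc hS) => w; apply: (salg_and hS); first exact: (salg_const hS).
by apply: borel_act; exact: closed_at_borel.
Qed.

Lemma girth_borel l : borel (girth l).
Proof.
apply: (salg_and hS); first exact: hasc_borel.
apply: (salg_allc hS) => m; apply: (salg_imp hS); first exact: (salg_const hS).
by apply: (salg_not hS); exact: hasc_borel.
Qed.

Lemma marked_borel q : borel (marked q).
Proof.
have bc : borel (@cyl (idx D) q.2) by apply: borel_open; exact: cyl_open.
apply: (@salg_ext _ borel (fun g => closed_at q.1 g /\ (cyl q.2 g /\
  forall v, (size v <= size q.1 + size q.1)%N -> act v g = g \/ ~ cyl q.2 (act v g)))).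
  by move=> x; split=> [[? [? ?]]|[? ? ?]].
apply: (salg_and hS); first exact: closed_at_borel.
apply: (salg_and hS) => //; apply: (salg_allc hS) => v.
apply: (salg_imp hS); first exact: (salg_const hS).
apply: (salg_or hS); first exact: (@mea_eq _ _ hS _ (act v) (fun x => x) (act_borel v) (@mea_id _)).
by apply: (salg_not hS); exact: borel_act.
Qed.

Lemma hasq_borel q : borel (hasq q).
Proof.
apply: (salg_and hS); first exact: girth_borel.
by apply: (salg_exc hS) => v; apply: borel_act; exact: marked_borel.
Qed.

Lemma onc_borel q t : borel (onc q t).
Proof.
by apply: (salg_and hS); [exact: (salg_const hS)|apply: borel_act; exact: marked_borel].
Qed.

Lemma near_borel q n : borel (near q n).
Proof.
apply: (salg_exc hS) => u; apply: (salg_and hS); first exact: (salg_const hS).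
by apply: (salg_ex hS) => t; apply: borel_act; exact: onc_borel.
Qed.

Lemma pick_borel i : borel (pick i).
Proof.
apply: (salg_exc hS) => q; apply: (salg_and hS).
  apply: (salg_and hS); first exact: hasq_borel.
  apply: (salg_allc hS) => q'; apply: (salg_imp hS); first exact: (salg_const hS).
  by apply: (salg_not hS); exact: hasq_borel.
apply: (salg_or hS).
  by apply: (salg_ex hS) => t; apply: (salg_and hS); [exact: onc_borel|exact: (salg_const hS)].
apply: (salg_and hS).
  by apply: (salg_allc hS) => t; apply: (salg_not hS); exact: onc_borel.
apply: (salg_ex hS) => n; apply: (salg_and hS).
  exact: (borel_act [:: i] (near_borel q n)).
apply: (salg_allc hS) => m; apply: (salg_imp hS); first exact: (salg_const hS).
by apply: (salg_not hS); exact: near_borel.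
Qed.

(** Read as a color, [p] is a substitute on the components with cycles, where the games may lead
    although the graph has no vertices there: no edge [i] has both ends of color [i]. *)
Lemma nonfree_pick : exists p : vtx D -> 'I_D, (forall i, borel (fun x => p x = i)) /\
  forall x i, incr x -> ~ free x -> p x = i -> p (gam i x) = i -> False.
Proof.
pose P x i := pick i x /\ forall j, (j < i)%N -> ~ pick j x.
have Pu x i j : P x i -> P x j -> i = j.
  by move=> [hi mi] [hj mj]; have [/mj|/mi|/ord_inj] := ltngtP (i : nat) j.
have Pe x : ~ free x -> exists i, P x i.
  move=> /pick_ex[i hi].
  case: (@arg_minnP _ i (fun i => `[< pick i x >]) (@nat_of_ord D)); first exact/asboolP.
  move=> j /asboolP hj mj; exists j; split=> // k kj hk.
  by have := mj k (introT (asboolP _) hk); rewrite leqNgt kj.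
exists (fun x => xget i0 (P x)); split=> [i|x i ix fx ei ei'].
  apply: (@salg_ext _ borel (fun x => P x i \/ (i = i0 /\ forall j, ~ P x j))).
    move=> x; case: xgetP => [j _ hj|n]; split.
    + by case=> [/(Pu _ _ _ hj)//|[_ /(_ j) /(_ hj)]].
    + by move=> <-; left.
    + by case=> [/n|[]].
    + by move=> <-; right.
  have bP j : borel (P^~ j).
    apply: (salg_and hS); first exact: pick_borel.
    apply: (salg_allc hS) => k; apply: (salg_imp hS); first exact: (salg_const hS).
    by apply: (salg_not hS); exact: pick_borel.
  apply: (salg_or hS) => //; apply: (salg_and hS); first exact: (salg_const hS).
  by apply: (salg_allc hS) => j; apply: (salg_not hS).
have [j hj] := Pe x fx; have fx' : ~ free (gam i x).
  by move=> /(@free_gam D i); rewrite gamK.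
have [j' hj'] := Pe _ fx'.
have [+ _] := xgetPex i0 (ex_intro _ j hj); have [+ _] := xgetPex i0 (ex_intro _ j' hj').
by rewrite ei ei' => h' h; exact: (pick_conflict ix h h').
Qed.

End NonFree.

(** * The lower bound *)

Section Rounds.
Context {A : Type} (a0 : A) (m : nat -> seq A).
Hypothesis m4 : forall r, size (m r) = 4.

Definition play_of (k : nat) : A := nth a0 (m (k %/ 4)) (k %% 4).

Lemma play_of4 r j : (j < 4)%N -> play_of (4 * r + j) = nth a0 (m r) j.
Proof. by move=> j4; rewrite /play_of mulnC divnMDl// modnMDl divn_small// modn_small// addn0. Qed.

Lemma pre_play r j : (j <= 4)%N ->
  pre play_of (4 * r + j) = flatten [seq m k | k <- iota 0 r] ++ take j (m r).
Proof.
elim: r j => [|r IH] j; last first.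
  have e0 : pre play_of (4 * r.+1 + 0) = flatten [seq m k | k <- iota 0 r.+1].
    rewrite addn0 mulnS addnC (IH 4)// take_oversize ?m4//.
    by rewrite -addn1 iotaD map_cat flatten_cat /= cats0.
  elim: j => [|j IHj] j4; first by rewrite e0 take0 cats0.
  by rewrite addnS preS IHj ?(ltnW j4)// play_of4// (take_nth a0) ?m4// rcons_cat.
elim: j => [|j IHj] j4; first by rewrite take0.
by rewrite addnS preS IHj ?(ltnW j4)// play_of4// (take_nth a0) ?m4.
Qed.

End Rounds.

Section LowerBound.
Variable D : nat.
Variable x0 : vtx D.
Variable Ult : set_system nat.
Hypothesis UltF : UltraFilter Ult.
Hypothesis Ult_inf : forall N, Ult [set n | (N < n)%N].
Implicit Types (w v : seq 'I_D) (i j : 'I_D) (U : set nat).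

Definition move : Type := ((seq 'I_D -> nat) * set nat * nat)%type.
Implicit Types (p : seq move) (z : nat -> move).
Definition mv0 : move := (fun=> 0%N, setT, 0%N).
Definition lab (a : move) : seq 'I_D -> nat := a.1.1.

(* The digit that [b] answers to the set played by [a]; illegal moves are
   replaced by legal ones. *)
Definition dig (a b : move) : nat :=
  let U := xget setT [set U | Ult U /\ U = a.1.2] in xget (xget 0%N U) [set n | U n /\ n = b.2].

Lemma dig_in l U k b : Ult U -> U (dig (l, U, k) b).
Proof.
move=> uU; rewrite /dig /=; set W := xget setT _.
have -> : W = U by rewrite /W; case: xgetP => [? -> []//|/(_ U) []].
case: xgetP => [_ -> []//|_].
have [n Un] := @filter_ex _ Ult _ U uU; exact: (xgetPex 0%N (ex_intro _ n Un)).
Qed.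

Lemma digE a l U n : (Ult a.1.2 -> a.1.2 n) -> dig a (l, U, n) = n.
Proof.
move=> h; rewrite /dig /=; set W := xget setT _.
have Wn : W n by rewrite /W; case: xgetP => [V _ [+ e]|//]; rewrite e.
by case: xgetP => [_ -> []//|/(_ n)]; case.
Qed.

(* In round [r] of game [i] the first player labels the words of length [r.+1]
   that begin with [i], the second player labels the other words of length
   [r.+1], the first player plays a set of the ultrafilter and the second player
   an element of it, the digit [r]. *)
Definition out i z : vtx D := fun c =>
  match c with
  | inl (2, n) => dig (z (4 * n + 2)) (z (4 * n + 3))
  | inl p => x0 (inl p)
  | inr [::] => x0 (inr [::])
  | inr ((a :: w') as w) => lab (z (4 * size w' + (a != i))) w
  end.

Lemma borel_seq_salg (A : Type) : salg (@borel_seq A).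
Proof.
split; first exact: (@borel_seq_fin A 0 (fun=> True)).
- exact: borel_seq_compl.
- exact: borel_seq_union.
Qed.

Lemma out_mea i : mea (@borel_seq move) (out i).
Proof.
(* Each coordinate of the resulting point depends on finitely many moves. *)
have fin n (Q : (nat -> move) -> Prop) : (forall z z', pre z n = pre z' n -> Q z -> Q z') ->
    borel_seq Q.
  move=> h; apply: (@salg_ext _ (@borel_seq move) (fun z => exists z', pre z' n = pre z n /\ Q z')).
    by move=> z; split=> [[z' [e hz]]|Qz]; [exact: (h _ _ e hz)|exists z].
  exact: (borel_seq_fin n (fun s => exists z', pre z' n = s /\ Q z')).
have pz n m (z z' : nat -> move) : (m < n)%N -> pre z n = pre z' n -> z m = z' m.
  by move=> mn e; rewrite -(nth_mkseq mv0 z mn) -/(pre z n) e nth_mkseq.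
move=> c k; case: c => [[a n]|[|b w]].
- apply: (fin (4 * n + 4)%N) => z z' e; case: a => [|[|[|a]]] //=.
  rewrite (@pz (4 * n + 4)%N (4 * n + 2)%N _ _ _ e) ?(@pz (4 * n + 4)%N (4 * n + 3)%N _ _ _ e)//;
  by rewrite ltn_add2l.
- exact: (fin 0%N).
- apply: (fin (4 * size w + 2)%N) => z z' e /=.
  by rewrite (@pz (4 * size w + 2)%N _ _ _ _ e)//; rewrite ltn_add2l; case: (_ != _).
Qed.

Lemma lt4_cases (P : nat -> Prop) : (forall r j : nat, (j < 4)%N -> P (4 * r + j)%N) -> forall n, P n.
Proof.
by move=> h n; have := h (n %/ 4) (n %% 4) (@ltn_pmod n 4 isT); rewrite mulnC -divn_eq.
Qed.

Lemma odd4 (r j : nat) : odd (4 * r + j) = odd j.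
Proof. by rewrite oddD oddM. Qed.

(* If the first player won all the games, then playing his strategies against
   each other would give a point without color. *)
Section FirstPlayer.
Variable sg : 'I_D -> seq move -> move.

Definition all_labels (L : 'I_D -> move) : move :=
  (fun w => if w is a :: _ then lab (L a) w else 0%N, setT, 0%N).

Definition common_digit (L : 'I_D -> move) : nat :=
  xget 0%N [set n | forall i, Ult (L i).1.2 -> (L i).1.2 n].

Definition round1 (st : 'I_D -> seq move) (i : 'I_D) : seq move :=
  let L1 i := sg i (st i) in
  let L2 i := sg i (st i ++ [:: L1 i; all_labels L1]) in
  [:: L1 i; all_labels L1; L2 i; (fun=> 0%N, setT, common_digit L2)].

Fixpoint state1 (r : nat) (i : 'I_D) : seq move :=
  if r is r'.+1 then state1 r' i ++ round1 (state1 r') i else [::].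

Definition run1 i : nat -> move := play_of mv0 (fun r => round1 (state1 r) i).

Lemma common_digitP L i : Ult (L i).1.2 -> (L i).1.2 (common_digit L).
Proof.
move: i; have h i : Ult [set n | Ult (L i).1.2 -> (L i).1.2 n].
  have [u|nu] := pselect (Ult (L i).1.2); first by apply: (@filterS _ Ult _ _ _ _ u) => n Un _.
  rewrite (_ : [set n | _] = setT); first exact: (@filterT _ Ult _).
  by apply/predeqP => n; split=> // _ /nu.
have {}h (s : seq 'I_D) : Ult [set n | forall i, i \in s -> Ult (L i).1.2 -> (L i).1.2 n].
  elim: s => [|i s IH].
    rewrite (_ : [set n | _] = setT); first exact: (@filterT _ Ult _).
    by apply/predeqP => n; split.
  apply: (@filterS _ Ult _ _ _ _ (filterI (h i) IH)) => n [h1 h2] j.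
  by rewrite inE => /orP[/eqP ->|/h2].
have [n hn] := @filter_ex _ Ult _ _ (h (enum 'I_D)).
apply: (@xgetPex _ 0%N [set n | forall i, Ult (L i).1.2 -> (L i).1.2 n]).
by exists n => i; apply: hn; rewrite mem_enum.
Qed.

Lemma state1E r i : state1 r i = flatten [seq round1 (state1 k) i | k <- iota 0 r].
Proof.
by elim: r => [//|r IH]; rewrite -[in RHS]addn1 iotaD map_cat flatten_cat -IH add0n.
Qed.

Lemma run1_pre i (r j : nat) : (j <= 4)%N ->
  pre (run1 i) (4 * r + j) = state1 r i ++ take j (round1 (state1 r) i).
Proof. by move=> j4; rewrite state1E pre_play. Qed.

Lemma run1_4 i (r j : nat) : (j < 4)%N ->
  run1 i (4 * r + j) = nth mv0 (round1 (state1 r) i) j.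
Proof. by move=> j4; rewrite [LHS]play_of4. Qed.

Lemma run1_follows i n : odd n = false -> run1 i n = sg i (pre (run1 i) n).
Proof.
move: n; apply: lt4_cases => r [|[|[|[|//]]]] //; rewrite odd4 //= => _ _.
  by rewrite run1_pre// take0 cats0 run1_4.
by rewrite run1_pre// run1_4.
Qed.

(** In every run the words beginning with [a] get the labels that the first player of game [a]
    chooses, and all runs have the digits in common, so the resulting point is the same. *)
Lemma out_run1 i j : out i (run1 i) = out j (run1 j).
Proof.
have e k a (w : seq 'I_D) : lab (run1 k (4 * size w + (a != k))) (a :: w) =
    lab (sg a (state1 (size w) a)) (a :: w).
  by rewrite run1_4; [case: eqVneq => [->|]|case: (_ != _)].
apply/funext => -[[[|[|[|a]]] n]|[|a w]] //=; last by rewrite !e.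
by rewrite !run1_4 // /round1 /= !digE //; exact: common_digitP.
Qed.

End FirstPlayer.

(* If the second player won game [i], then two copies of his strategy, played
   at the two ends of an edge [i], would both give the color [i]. *)
Section SecondPlayer.
Variables (i : 'I_D) (tau : seq move -> move).

Definition branch p : seq 'I_D -> nat := fun w =>
  if w is _ :: ((j :: w'') as w') then
    if j == i then 0%N else lab (nth mv0 p (4 * size w'' + 1)) w'
  else 0%N.

(** The run for the end [x] is one round ahead, because the other end has the digits of [x] without
    the first one, [digit0]. The zero labels of [mv0] make the edge [i] a shift at [x]. *)
Definition init2 : seq move :=
  let s2 := [:: mv0; tau [:: mv0]; mv0] in rcons s2 (tau s2).
Definition digit0 : nat := dig mv0 (nth mv0 init2 3).

Definition end_labels p : move :=
  (fun w => if w is [:: _] then digit0.+1 else branch p w, setT, 0%N).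

Definition set_move U : move := (fun=> 0%N, U, 0%N).

Definition common_sets (last : nat) p q : set nat * set nat :=
  xget (setT, setT) [set UU | [/\ Ult UU.1, Ult UU.2,
    dig (set_move UU.1) (tau (rcons p (set_move UU.1))) =
    dig (set_move UU.2) (tau (rcons q (set_move UU.2))) &
    (last < dig (set_move UU.1) (tau (rcons p (set_move UU.1))))%N]].

(** The order of the moves is forced: [b0] copies labels from earlier rounds of the first run, while
    [a0] needs the answer [b1] of the same round; the sets are chosen last, in both runs
    together. *)
Definition round2 (st : seq move * seq move * nat) : seq move * seq move * nat :=
  let b0 := end_labels st.1.1 in
  let b1 := tau (rcons st.1.2 b0) in
  let q := st.1.2 ++ [:: b0; b1] in
  let a0 := (branch q, setT, 0%N) in
  let a1 := tau (rcons st.1.1 a0) in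
  let p := st.1.1 ++ [:: a0; a1] in
  let UU := common_sets st.2 p q in
  let a2 := set_move UU.1 in let b2 := set_move UU.2 in
  let a3 := tau (rcons p a2) in let b3 := tau (rcons q b2) in
  ([:: a0; a1; a2; a3], [:: b0; b1; b2; b3], dig a2 a3).

Fixpoint state2 (r : nat) : seq move * seq move * nat :=
  if r is r'.+1 then
    let st := state2 r' in
    (st.1.1 ++ (round2 st).1.1, st.1.2 ++ (round2 st).1.2, (round2 st).2)
  else (init2, [::], digit0).

Definition runA : nat -> move :=
  play_of mv0 (fun r => if r is r'.+1 then (round2 (state2 r')).1.1 else init2).
Definition runB : nat -> move := play_of mv0 (fun r => (round2 (state2 r)).1.2).

(** Otherwise the complement of the set of answers would be a legal set, and the answer to it would
    lie in both. *)
Lemma answer_ultra (f : set nat -> nat) : (forall U, Ult U -> U (f U)) ->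
  Ult [set n | exists2 U, Ult U & f U = n].
Proof.
move=> h; have [//|uC] := in_ultra_setVsetC [set n | exists2 U, Ult U & f U = n] UltF.
by case: (h _ uC); exists (~` [set n | exists2 U, Ult U & f U = n]).
Qed.

Lemma dig_set U b : Ult U -> U (dig (set_move U) b).
Proof. exact: dig_in. Qed.

Lemma common_setsP last p q : let UU := common_sets last p q in
  dig (set_move UU.1) (tau (rcons p (set_move UU.1))) =
    dig (set_move UU.2) (tau (rcons q (set_move UU.2))) /\
  (last < dig (set_move UU.1) (tau (rcons p (set_move UU.1))))%N.
Proof.
have hA := answer_ultra (fun U h => dig_set (tau (rcons p (set_move U))) h).
have hB := answer_ultra (fun U h => dig_set (tau (rcons q (set_move U))) h).
have [n [ln [[U1 u1 e1] [U2 u2 e2]]]] :=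
  @filter_ex _ Ult _ _ (filterI (Ult_inf last) (filterI hA hB)).
suff [//] : [set UU | [/\ Ult UU.1, Ult UU.2,
    dig (set_move UU.1) (tau (rcons p (set_move UU.1))) =
    dig (set_move UU.2) (tau (rcons q (set_move UU.2))) &
    (last < dig (set_move UU.1) (tau (rcons p (set_move UU.1))))%N]] (common_sets last p q).
rewrite /common_sets; apply: (xgetPex (setT, setT)); exists (U1, U2); split=> //=.
  by rewrite e1 e2.
by rewrite e1.
Qed.

Lemma state2A r : (state2 r).1.1 = flatten [seq
  (if k is k'.+1 then (round2 (state2 k')).1.1 else init2) | k <- iota 0 r.+1].
Proof.
elim: r => [//|r IH].
by rewrite -[in RHS](addn1 r.+1) iotaD map_cat flatten_cat -IH add0n.
Qed.

Lemma state2B r : (state2 r).1.2 = flatten [seq (round2 (state2 k)).1.2 | k <- iota 0 r].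
Proof.
by elim: r => [//|r IH]; rewrite -[in RHS]addn1 iotaD map_cat flatten_cat -IH add0n.
Qed.

Lemma runA_pre (r j : nat) : (j <= 4)%N ->
  pre runA (4 * r.+1 + j) = (state2 r).1.1 ++ take j (round2 (state2 r)).1.1.
Proof. by move=> j4; rewrite state2A pre_play// => -[]. Qed.

Lemma runB_pre (r j : nat) : (j <= 4)%N ->
  pre runB (4 * r + j) = (state2 r).1.2 ++ take j (round2 (state2 r)).1.2.
Proof. by move=> j4; rewrite state2B pre_play. Qed.

Lemma runA4 (r j : nat) : (j < 4)%N -> runA (4 * r.+1 + j) = nth mv0 (round2 (state2 r)).1.1 j.
Proof. by move=> j4; rewrite [LHS]play_of4. Qed.

Lemma runB4 (r j : nat) : (j < 4)%N -> runB (4 * r + j) = nth mv0 (round2 (state2 r)).1.2 j.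
Proof. by move=> j4; rewrite [LHS]play_of4. Qed.

Lemma runA0 (j : nat) : (j < 4)%N -> runA (4 * 0 + j) = nth mv0 init2 j.
Proof. by move=> j4; rewrite [LHS]play_of4. Qed.

Lemma runB_follows n : odd n -> runB n = tau (pre runB n).
Proof.
move: n; apply: lt4_cases => r [|[|[|[|//]]]] //; rewrite odd4 //= => _ _;
by rewrite runB4// runB_pre//= -?cats1 -?catA.
Qed.

Lemma runA_follows n : odd n -> runA n = tau (pre runA n).
Proof.
move: n; apply: lt4_cases => -[|r] [|[|[|[|//]]]] //; rewrite odd4 //= => _ _.
- by rewrite runA4// runA_pre//= -?cats1 -?catA.
- by rewrite runA4// runA_pre//= -?cats1 -?catA.
Qed.

Lemma nth_pre z m n : (m < n)%N -> nth mv0 (pre z n) m = z m.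
Proof. exact: nth_mkseq. Qed.

Let x := out i runA.
Let y := out i runB.

Lemma dg_run r : dg y r = dg x r.+1.
Proof.
rewrite /dg /= runB4// runB4// runA4// runA4//=.
by have [-> _] := common_setsP (state2 r).2 ((state2 r).1.1 ++ [:: (branch ((state2 r).1.2 ++
 [:: end_labels (state2 r).1.1; tau (rcons (state2 r).1.2 (end_labels (state2 r).1.1))]), setT, 0%N);
   tau (rcons (state2 r).1.1 (branch ((state2 r).1.2 ++
 [:: end_labels (state2 r).1.1; tau (rcons (state2 r).1.2 (end_labels (state2 r).1.1))]), setT, 0%N))])
  ((state2 r).1.2 ++
 [:: end_labels (state2 r).1.1; tau (rcons (state2 r).1.2 (end_labels (state2 r).1.1))]).
Qed.

Lemma dg_runA r : dg x r = (state2 r).2.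
Proof.
case: r => [|r]; rewrite /dg /=.
  by rewrite (runA0 (j := 2))// (runA0 (j := 3)).
by rewrite runA4// runA4.
Qed.

Lemma incr_runA : incr x.
Proof.
exists 0%N => n _; rewrite !dg_runA [in X in (_ < X)%N]/=.
exact: (common_setsP _ _ _).2.
Qed.

Lemma branch_runA w : lab (runA (4 * size w)) (i :: w) =
  if w is j :: w' then if j == i then 0%N else lab (runB (4 * size w' + 1)) w else 0%N.
Proof.
case: w => [|j w]; first by rewrite -[(4 * size _)%N]/(4 * 0 + 0)%N runA0.
rewrite -[(4 * size _)%N]addn0 runA4//= /lab /=; case: (j == i) => //.
have -> : (state2 (size w)).1.2 ++ [:: end_labels (state2 (size w)).1.1;
  tau (rcons (state2 (size w)).1.2 (end_labels (state2 (size w)).1.1))] = pre runB (4 * size w + 2).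
  by rewrite runB_pre.
by rewrite nth_pre// ltn_add2l.
Qed.

Lemma branch_runB j w : lab (runB (4 * (size w).+1)) (i :: j :: w) =
  if j == i then 0%N else lab (runA (4 * size w + 1)) (j :: w).
Proof.
have e : (state2 (size w).+1).1.1 = pre runA (4 * (size w).+2 + 0).
  by rewrite runA_pre// take0 cats0.
rewrite -[(4 * _)%N]addn0 runB4// -[nth _ _ _]/(end_labels (state2 (size w).+1).1.1) e.
rewrite /lab /=; case: (j == i) => //.
by rewrite nth_pre// addn0 !mulnS addnA addnC ltn_add2r.
Qed.

Lemma gam_run : gam i x = y.
Proof.
have x0E : lb x [:: i] = 0%N.
  by rewrite /lb /x /= eqxx addn0; exact: (branch_runA [::]).
apply/funext => -[[[|[|[|a]]] n]|w] //.
  by rewrite -[LHS]/(dg (gam i x) n) dg_gam x0E -dg_run.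
rewrite -[LHS]/(if w == [:: i] then (if lb x w is _.+1 then 0%N else (dg x 0).+1)
  else lb x (swp i w)).
case: eqVneq => [->|wi].
  rewrite x0E dg_runA /y /= eqxx addn0 -[(4 * 0)%N]/(4 * 0 + 0)%N runB4//.
case: w wi => [//|a w] wi; rewrite /swp; have [ea|ai] := eqVneq a i => /=.
  subst a; case: w wi => [|j w] wi; first by rewrite eqxx in wi.
  rewrite /lb /x /y /=; have [->|ji] := eqVneq j i.
    by rewrite !eqxx /= !addn0 (branch_runA (i :: w)) (branch_runB i w) eqxx.
  by rewrite !eqxx /= ji !addn0 branch_runB (negbTE ji).
rewrite /lb /x /y /= eqxx /= ai addn0.
by rewrite (branch_runA (a :: w)) (negbTE ai).
Qed.

End SecondPlayer.

Lemma game_conflict (c : vtx D -> 'I_D) : (0 < D)%N -> (forall i, borel (fun x => c x = i)) ->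
  exists x i, [/\ incr x, c x = i, c (gam i x) = i & forall b n, b != 2 -> x (inl (b, n)) = x0 (inl (b, n))].
Proof.
move=> D0 bc; pose W i : set (nat -> move) := fun z => c (out i z) <> i.
have bW i : borel_seq (W i).
  apply: borel_seq_compl; exact: (mea_borel (borel_seq_salg move) (out_mea i) (bc i)).
have hsec i z b n : b != 2 -> out i z (inl (b, n)) = x0 (inl (b, n)) by case: b => [|[|[|]]].
have [[i [tau ht]]|nII] := pselect (exists i tau, forall z,
    (forall n, odd n = true -> z n = tau (pre z n)) -> ~ W i z).
  exists (out i (runA i tau)), i; split; [exact: incr_runA| | |exact: hsec].
    by apply: contrapT; apply: ht; exact: runA_follows.
  by rewrite gam_run; apply: contrapT; apply: ht; exact: runB_follows.
have hI i : exists sg, forall z, (forall n, odd n = false -> z n = sg (pre z n)) -> W i z.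
  have [//|[sg h]] := borel_determinacy mv0 (bW i).
  by case: nII; exists i, sg.
(* The point common to all runs has some color [i], which contradicts the victory of the first
   player in game [i]. *)
have {hI} [sg hs] := choice hI; exfalso; set i := c (out (Ordinal D0) (run1 sg (Ordinal D0))).
have := hs i _ (run1_follows sg i); rewrite /W (out_run1 sg i (Ordinal D0)); exact.
Qed.

End LowerBound.

Lemma color_conflict D (x0 : vtx D) (c : vtx D -> 'I_D) : (0 < D)%N ->
  (forall i, borel (fun x => c x = i)) ->
  exists x i, [/\ incr x, c x = i, c (gam i x) = i &
    forall b n, b != 2 -> x (inl (b, n)) = x0 (inl (b, n))].
Proof.
have [U [uU hU]] := @ultraFilterLemma nat \oo _.
apply: (@game_conflict D x0 U) => // N; apply: hU; exists N.+1 => // n.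
Qed.

Definition sect D (x0 x : vtx D) : Prop :=
  forall b n, b != 2 -> x (inl (b, n)) = x0 (inl (b, n)).

(** Outside [V], and where [c] is too large, the color is replaced by [nonfree_pick]. A conflict of
    the resulting map is a conflict of [c] inside the section, or one excluded by [nonfree_pick]. *)
Lemma H_not_colorable D (x0 : vtx D) (c : vtx D -> nat) : (0 < D)%N ->
  (forall k, borel (fun x => c x = k)) ->
  (forall x, V x -> sect x0 x -> (c x < D)%N) ->
  ~ (forall x i, V x -> sect x0 x -> c x <> c (gam i x)).
Proof.
case: D x0 c => [//|D] x0 c _ bc cD cN.
have hS := borel_salg (vtx D.+1); have [p [bp hp]] := @nonfree_pick D.+1 ord0.
pose c' x : 'I_D.+1 := if `[< V x /\ (c x < D.+1)%N >] then inord (c x) else p x.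
have [|x [i [ix e1 e2 sx]]] := @color_conflict D.+1 x0 c' isT.
  move=> i; apply: (@salg_ext _ (@borel (vtx D.+1))
    (fun x => (V x /\ c x = i) \/ (~ (V x /\ (c x < D.+1)%N) /\ p x = i))).
    move=> x; rewrite /c'; case: asboolP => h; split.
    - by case=> [[_ ->]|[/(_ h)]]; rewrite ?inord_val.
    - by move=> <-; left; case: h => Vx l; rewrite inordK.
    - by case=> [[Vx e]|[]//]; case: h; rewrite e.
    - by move=> e; right.
  apply: (salg_or hS); first by apply: (salg_and hS); [exact: V_borel|exact: bc].
  apply: (salg_and hS); last exact: bp.
  apply: (salg_not hS); apply: (salg_and hS); first exact: V_borel.
  exact: (salg_fiber hS (fun k => (k < D.+1)%N : Prop) bc).
have sx' : sect x0 (gam i x) by move=> [|[|[|b]]] n // _; exact: sx.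
have [Vx|nVx] := pselect (V x); last first.
  have nV y : ~ V y -> c' y = p y by move=> n; rewrite /c'; case: asboolP => // -[].
  apply: (hp x i ix); [by move=> fx; apply: nVx|by rewrite -nV|rewrite -nV//].
  by move=> /(@V_gam _ i); rewrite gamK.
have Vx' := V_gam i Vx; have l1 := cD _ Vx sx; have l2 := cD _ Vx' sx'.
have cE y : V y -> (c y < D.+1)%N -> c' y = inord (c y).
  by move=> h1 h2; rewrite /c'; case: asboolP => // -[].
apply: (cN x i Vx sx); have := congr1 (@nat_of_ord _) (etrans e1 (esym e2)).
by rewrite (cE x)// (cE (gam i x))// !inordK.
Qed.

(** * Three-colorings *)

Section ThreeColors.
Variable D : nat.
Implicit Types (x : vtx D) (b y : nat -> nat).

Definition good b x : Prop := forall N, exists p, (N <= p)%N /\ exists n, (dg x (p + n) < b n)%N.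

Fixpoint thr b n : nat := if n is m.+1 then (thr b m + (b n).+1)%N else (b 0).+1.

(* [u] and [v] lie in the same interval [[thr b n, thr b n.+1[]. *)
Definition same b (u v : nat) : Prop := forall n, (thr b n <= u)%N <-> (thr b n <= v)%N.

Definition hit b x (k : nat) : Prop :=
  same b (dg x k) (dg x k.+1) /\ ~ same b (dg x k.+1) (dg x k.+2).

Definition first_hit b x (k : nat) : Prop := hit b x k /\ forall j, (j < k)%N -> ~ hit b x j.

Definition col b x : nat := if xget 0%N (first_hit b x) is k.+1 then odd k.+1 else 2.

Lemma thr_gt b n : (b n < thr b n)%N.
Proof. by case: n => [|n] //=; rewrite leq_addl. Qed.

Lemma thrS_lt b n : (thr b n < thr b n.+1)%N.
Proof. by rewrite /= addnS ltnS leq_addr. Qed.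

Lemma thr_lt b m n : (m < n)%N -> (thr b m < thr b n)%N.
Proof. by move: m n; apply: (homo_ltn ltn_trans); exact: thrS_lt. Qed.

Lemma thr_ge b n : (n < thr b n)%N.
Proof. by elim: n => [//|n IH]; exact: leq_ltn_trans IH (thrS_lt b n). Qed.

Lemma incr_ge x N : (forall n, (N <= n)%N -> (dg x n < dg x n.+1)%N) ->
  forall j, (dg x N + j <= dg x (N + j))%N.
Proof.
move=> h; elim=> [|j IH]; first by rewrite !addn0.
by rewrite !addnS; apply: leq_ltn_trans IH (h _ (leq_addr _ _)).
Qed.

(** Otherwise consecutive late digits always lie in different intervals, so from any late start they
    pass the thresholds one by one and dominate [b], against [good]. *)
Lemma same_io b x N : incr x -> good b x ->
  exists m, (N <= m)%N /\ same b (dg x m) (dg x m.+1).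
Proof.
move=> [N0 inc] gb; apply: contrapT => no.
have sep m : (N0 <= m)%N -> (N <= m)%N -> exists n, (dg x m < thr b n <= dg x m.+1)%N.
  move=> m0 mN; apply: contrapT => ne; apply: no; exists m; split=> // n.
  split=> [h|h]; first exact: leq_trans h (ltnW (inc _ m0)).
  by rewrite leqNgt; apply/negP => l; apply: ne; exists n; rewrite l.
have pass M k : (N0 <= M)%N -> (N <= M)%N -> (thr b k <= dg x (M + k).+1)%N.
  move=> M0 MN; elim: k => [|k IH].
    have [n /andP[_ l]] := sep M M0 MN; rewrite addn0; apply: leq_trans l.
    by case: n => [//|n]; apply: ltnW; exact: thr_lt.
  have [||n /andP[l1 l2]] := sep (M + k).+1.
  - exact: leq_trans M0 (leqW (leq_addr _ _)).
  - exact: leq_trans MN (leqW (leq_addr _ _)).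
  rewrite addnS; apply: leq_trans l2; have kn : (k < n)%N.
    rewrite ltnNge; apply/negP => nk; have := leq_ltn_trans IH l1.
    by rewrite ltnNge; move: nk; rewrite leq_eqVlt => /orP[/eqP ->|/(thr_lt b)/ltnW ->]; rewrite ?leqnn.
  by move: kn; rewrite leq_eqVlt => /orP[/eqP ->|/(thr_lt b)/ltnW].
have [[|p] [Mp [n]]] := gb (maxn N0 N).+1 => //.
have /andP[p1 p2] : (N0 <= p)%N && (N <= p)%N by rewrite -geq_max.
rewrite addSn ltnNge => /negP; apply.
exact: leq_trans (ltnW (thr_gt b n)) (pass p n p1 p2).
Qed.

Lemma hit_ex b x : incr x -> good b x -> exists k, first_hit b x k.
Proof.
move=> ix gb; have [N inc] := ix; have [m [Nm sm]] := same_io N ix gb.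
suff ex : exists k, `[< hit b x k >].
  case: (ex_minnP ex) => k /asboolP hk mk; exists k; split=> // j jk hj.
  by have := mk j (introT (asboolP _) hj); rewrite leqNgt jk.
apply: contrapT => no.
have all j : same b (dg x (m + j)) (dg x (m + j).+1).
  elim: j => [|j IH]; first by rewrite addn0.
  by rewrite addnS; apply: contrapT => ns; apply: no; exists (m + j)%N; apply/asboolP.
have allm j : same b (dg x m) (dg x (m + j)).
  by elim: j => [|j IH] n; [rewrite addn0|rewrite addnS -(all j n); exact: IH].
have [_ h] := allm (thr b (dg x m)) (dg x m).
suff /h : (thr b (dg x m) <= dg x (m + thr b (dg x m)))%N by rewrite leqNgt thr_ge.
apply: leq_trans (incr_ge _ _); first exact: leq_addl.
by move=> n mn; apply: inc; exact: leq_trans Nm mn.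
Qed.

(** A shift lowers the first hit by one and so changes its parity. If the first hit is at [0], the
    first two digits after the shift lie in different intervals, so the shifted sequence has no hit
    at [0] and does not get the color [2]. *)
Lemma col_shift b x x' : incr x -> good b x -> (forall n, dg x' n = dg x n.+1) ->
  incr x' -> good b x' -> col b x <> col b x'.
Proof.
move=> ix gb e ix' gb'.
have eh k : hit b x' k <-> hit b x k.+1 by rewrite /hit !e.
have [k hk] := hit_ex ix gb; have [k' hk'] := hit_ex ix' gb'.
have u (y : vtx D) l l' : first_hit b y l -> first_hit b y l' -> l = l'.
  by move=> [h1 m1] [h2 m2]; have [/m2|/m1|] := ltngtP l l'.
have ek : xget 0%N (first_hit b x) = k.
  by have h := xgetPex 0%N (ex_intro (first_hit b x) k hk); exact: (u x _ _ h hk).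
have ek' : xget 0%N (first_hit b x') = k'.
  by have h := xgetPex 0%N (ex_intro (first_hit b x') k' hk'); exact: (u x' _ _ h hk').
rewrite /col ek ek'; case: k hk {ek} => [|k] [hk mk].
  case: k' hk' {ek'} => [|k'] [hk' _]; last by case: (odd _).
  by move/eh: hk' => [+ _]; case: hk.
have -> : k' = k.
  by apply: (u x' _ _ hk'); split=> [|j jk]; [exact/eh|move=> /eh; exact: mk].
by case: k {hk mk} => [//|k] /=; case: (odd k).
Qed.

Lemma good_gam b x i : good b x -> good b (gam i x).
Proof.
move=> h N; case E: (lb x [:: i]) => [|k].
  have [[|p] [Np [n l]]] := h N.+1 => //; exists p; split=> //; exists n.
  by rewrite dg_gam E -addSn.
have [p [Np [n l]]] := h N; exists p.+1; split; first exact: leqW.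
by exists n; rewrite dg_gam E addSn.
Qed.

Lemma col_proper b x i : incr x -> good b x -> col b x <> col b (gam i x).
Proof.
move=> ix gb; have ix' := incr_gam i ix; have gb' := good_gam i gb.
case E: (lb x [:: i]) => [|k].
  by apply: col_shift => // n; rewrite dg_gam E.
by apply/nesym; apply: col_shift => // n; rewrite dg_gam E.
Qed.

Lemma col_lt3 b x : (col b x < 3)%N.
Proof. by rewrite /col; case: xget => // k; case: odd. Qed.

Section Borel.
Context {T : Type} (S : set (set T)) (b : T -> nat -> nat) (x : T -> vtx D).
Hypotheses (hS : salg S) (hb : mea S b) (hx : mea S x).

Lemma thr_mea : mea S (fun t => thr (b t)).
Proof.
elim=> [|n IH] k /=; first exact: (salg_fiber hS (fun m => m.+1 = k) (hb 0)).
exact: (salg_rel2 (fun u v => (u + v.+1)%N = k) hS (IH) (hb n.+1)).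
Qed.

Lemma good_mea : S (fun t => good (b t) (x t)).
Proof.
apply: (salg_allc hS) => N; apply: (salg_exc hS) => p.
apply: (salg_and hS); first exact: (salg_const hS).
apply: (salg_exc hS) => n.
exact: (salg_rel2 (fun u v => (u < v)%N) hS (hx _) (hb n)).
Qed.

Lemma same_mea k l : S (fun t => same (b t) (dg (x t) k) (dg (x t) l)).
Proof.
apply: (salg_allc hS) => n.
have h m : S (fun t => (thr (b t) n <= dg (x t) m)%N).
  exact: (salg_rel2 (fun u v => (u <= v)%N) hS (@thr_mea n) (hx _)).
exact: salg_iff.
Qed.

Lemma first_hit_mea k : S (fun t => first_hit (b t) (x t) k).
Proof.
have hh j : S (fun t => hit (b t) (x t) j).
  by apply: (salg_and hS); [exact: same_mea|apply: (salg_not hS); exact: same_mea].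
apply: (salg_and hS) => //; apply: (salg_allc hS) => j.
by apply: (salg_imp hS); [exact: (salg_const hS)|exact: (salg_not hS)].
Qed.

Lemma col_mea c : S (fun t => col (b t) (x t) = c).
Proof.
pose f (k : nat) : nat := if k is k'.+1 then odd k'.+1 else 2.
apply: (@salg_ext _ S (fun t => (exists k, first_hit (b t) (x t) k /\ f k = c) \/
   ((forall k, ~ first_hit (b t) (x t) k) /\ f 0 = c))).
  move=> t; rewrite /col -/(f _); case: xgetP => [k -> hk|no]; split.
  - case=> [[l [hl <-]]|[/(_ _ hk)//]]; congr f.
    by case: hl hk => [h1 m1] [h2 m2]; set z := xget _ _ in h2 m2 *; have [/m1|/m2|] := ltngtP z l.
  - by move=> <-; left; eexists; split; [exact: hk|].
  - by case=> [[l [/no]]|[]].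
  - by move=> <-; right.
apply: (salg_or hS).
  apply: (salg_exc hS) => k; apply: (salg_and hS); first exact: first_hit_mea.
  exact: (salg_const hS).
apply: (salg_and hS); last exact: (salg_const hS).
by apply: (salg_allc hS) => k; apply: (salg_not hS); exact: first_hit_mea.
Qed.

End Borel.

(* [good b x] only depends on the component of [x], hence so does [chosen x]. *)
Definition chosen x : nat -> nat := xget (fun=> 0%N) [set b | good b x].

Lemma chosen_good x : good (chosen x) x.
Proof.
(* At [p = n = N] this bound exceeds the digit number [p + n]. *)
apply: (@xgetPex _ (fun=> 0%N) [set b | good b x]); exists (fun n => (dg x (n + n)).+1) => N.
by exists N; split=> //; exists N.
Qed.

Lemma chosen_gam x i : chosen (gam i x) = chosen x.
Proof.
rewrite /chosen; congr xget; apply/predeqP => b; split=> [/(good_gam i)|]; last exact: good_gam.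
by rewrite gamK.
Qed.

(** The set is closed, and every neighbourhood contains points with one late digit changed so as to
    break monotonicity. Hence [incr] is meager, and with it [V]. *)
Lemma nowhere_incr N : @nowhere_dense (vtx D) [set x | forall n, (N <= n)%N -> (dg x n < dg x n.+1)%N].
Proof.
set E := [set x | _].
have cE : closed E.
  rewrite -[E]setCK; apply: open_closedC.
  rewrite (_ : ~` E = \bigcup_n [set x : vtx D | (N <= n)%N /\ ~ (dg x n < dg x n.+1)%N]).
    apply: bigcup_open => n _; have [Nn|nN] := leqP N n; last first.
      rewrite (_ : [set x | _] = set0) ?predeqE; first exact: open0.
      by move=> x; split=> // -[].
    apply/openP_cyl => x [_ h]; exists [:: inl (2, n); inl (2, n.+1)] => x' e; split=> //.
    by rewrite /dg !e ?inE ?eqxx ?orbT.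
  apply/predeqP => x; split=> [h|[n _ [Nn h]] /(_ n Nn)//].
  by apply: contrapT => no; apply: h => n Nn; apply: contrapT => l; apply: no; exists n.
rewrite /nowhere_dense -(closure_id E).1//; apply/predeqP => x; split=> //.
rewrite /interior /= => /nbhs_cyl[J hJ].
pose bd (c : idx D) := if c is inl (_, n) then n else 0%N.
pose m := (N + \max_(c <- J) bd c).+1.
pose x' : vtx D := fun c => if c is inl (2, n) then (if n == m then (dg x m.+1) else dg x n) else x c.
have : E x'.
  apply: hJ => -[[[|[|[|a]]] n]|w] // cJ; rewrite /x'; case: eqP => // e.
  have := @leq_bigmax_seq _ J xpredT bd _ cJ isT; rewrite /= e /m leqNgt ltnS.
  by rewrite leq_addl.
have Nm : (N <= m)%N by rewrite /m leqW// leq_addr.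
by move=> /(_ m Nm); rewrite /dg /x' eqxx (gtn_eqF (ltnSn m)) ltnn.
Qed.

End ThreeColors.

(** * Bounds for chromatic numbers *)

Section Chromatic.
Variables (X : topologicalType) (M : set (set X)) (E : set (X * X)).

Lemma chromatic_le k : candidate k -> colorable M E k -> cc_le (chromatic_number M E) k.
Proof.
move=> ck hk; rewrite /chromatic_number; case: xgetP => [l _ [_ _ h]|]; first exact: h.
have [[m [m0 hm]]|no] := pselect (exists m, (0 < m)%N /\ colorable M E (Fin m)).
  have ex : exists m, `[< (0 < m)%N /\ colorable M E (Fin m) >] by exists m; exact/asboolP.
  case: (ex_minnP ex) => l /asboolP[l0 hl] ml /(_ (Fin l))[]; split=> // -[l'||] //= l'0 hl'.
  by apply: ml; apply/asboolP.
case: k ck hk => [m|//|//] m0 hm; first by case: no; exists m.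
move=> /(_ Aleph0)[]; split=> // -[l'||] //= l'0 hl'.
by case: no; exists l'.
Qed.

Lemma chromatic_eq n : (0 < n)%N -> colorable M E (Fin n) ->
  (forall m, (m < n)%N -> ~ colorable M E (Fin m)) -> chromatic_number M E = Fin n.
Proof.
move=> n0 hn no; rewrite /chromatic_number; case: xgetP => [l _ [cl hl ml]|].
  have := ml (Fin n) n0 hn; case: l cl hl ml => [m|//|//] m0 hm ml /= mn; congr Fin.
  by apply/eqP; rewrite eqn_leq mn leqNgt; apply/negP => /no.
move=> /(_ (Fin n))[]; split=> // -[m||] //= m0 hm.
by rewrite leqNgt; apply/negP => /no.
Qed.

Lemma chromatic_ltP n : (1 < n)%N ->
  cc_lt (chromatic_number M E) (Fin n) <-> colorable M E (Fin n.-1).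
Proof.
case: n => [//|n] n1 /=; split=> [|h]; last first.
  have := chromatic_le (n1 : candidate (Fin n)) h; rewrite /cc_lt.
  by case: (chromatic_number M E) => //= m; rewrite -ltnNge ltnS.
rewrite /chromatic_number; case: xgetP => [l _ [cl hl ml]|//].
case: l cl hl ml => [m|//|//] m0 [c [h1 h2 h3]] _; rewrite /cc_lt /= -ltnNge ltnS => mn.
by exists c; split=> // x; exact: leq_trans (h1 x) mn.
Qed.
End Chromatic.

(** * Three colors up to meager and null sets *)

Section Measures.
Variable D : nat.
Local Notation X := (vtx D).

Lemma meager_sub (A : set X) : A `<=` @incr D -> meager A.
Proof.
move=> Ai; pose E N := [set x : X | forall n, (N <= n)%N -> (dg x n < dg x n.+1)%N].
exists (fun N => A `&` E N).
  move=> N; have := @nowhere_incr D N; rewrite /nowhere_dense => h.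
  apply/predeqP => x; split=> // hx; rewrite -h.
  by apply: (interiorS _ hx); apply: closureS => y [].
by apply/predeqP => x; split=> [Ax|[N _ []//]]; have [N hN] := Ai _ Ax; exists N.
Qed.

(** As [V] is meager, colors on it do not affect the Baire property, so the bound may be chosen for
    each component without any definability. *)
Lemma chi_BM_le : cc_le (chi_BM (@walk_graph D)) (Fin 3).
Proof.
rewrite /chi_BM; apply: chromatic_le => //.
pose c (x : X) := if `[< V x >] then col (chosen x) x else 0%N.
have c0 (x : X) : ~ incr x -> c x = 0%N by move=> n; rewrite /c; case: asboolP => // -[].
exists c; split.
- by move=> x /=; rewrite /c; case: asboolP => // _; exact: col_lt3.
- move=> A; have [A0|nA0] := pselect (A 0%N).
    exists setT; first exact: openT.
    apply: meager_sub => x hx; apply: contrapT => /c0 e.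
    by case: hx => -[]; rewrite /= ?e.
  exists set0; first exact: open0.
  apply: meager_sub => x hx; apply: contrapT => /c0 e.
  by case: hx => -[]; rewrite /= ?e.
- move=> x y [/= Vx [i ->]]; have Vy := V_gam i Vx.
  rewrite /c; case: asboolP => // _; case: asboolP => // _; rewrite chosen_gam.
  by apply: col_proper; [case: Vx|exact: chosen_good].
Qed.

End Measures.

Definition pvtx (D : nat) : Type := prod_topology (fun _ : idx D => nat).
HB.instance Definition _ (D : nat) := Pointed.on (pvtx D).
HB.instance Definition _ (D : nat) := Topological.on (pvtx D).

Section Measure.
Variables (R : realType) (D : nat) (mu : probability (borel_space (pvtx D)) R).
Implicit Types (x : vtx D) (b : nat -> nat).
Local Open Scope ereal_scope.

Lemma measurable_borel (A : set (vtx D)) : borel A -> measurable (A : set (borel_space (pvtx D))).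
Proof. by []. Qed.

(** Borel-Cantelli: [b n] is taken so large that the digit number [n + n] reaches it with
    probability at most [2^-(n+2)]. For almost every point this digit is below [b n] for all late
    [n], and [p = n] witnesses [good]. *)
Lemma dominating : exists b, mu.-negligible [set x | ~ good b x].
Proof.
pose F n k : set (borel_space (pvtx D)) := [set x | (k <= dg x (n + n)%N)%N].
have mF n k : measurable (F n k).
  apply: measurable_borel; have hS := borel_salg (vtx D).
  exact: (salg_fiber hS (fun m => (k <= m)%N : Prop) (@borel_coord _ _)).
have bnd n : exists k, mu (F n k) <= (2^-1 / (2 ^ n.+1)%:R)%:E.
  have cv : mu \o F n @ \oo --> mu (\bigcap_k F n k).
    apply: nonincreasing_cvg_mu => //.
    - exact: le_lt_trans (probability_le1 _ _) (ltry _).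
    - exact: bigcapT_measurable.
    - by move=> k l kl; apply/subsetPset => x /=; exact: leq_trans.
  rewrite (_ : \bigcap_k F n k = set0) ?measure0 in cv; last first.
    apply/predeqP => x; split=> // /(_ (dg x (n + n)).+1 I) /=.
    by rewrite /F /= ltnn.
  have e0 : (0 < 2^-1 / (2 ^ n.+1)%:R :> R)%R by rewrite divr_gt0 ?invr_gt0 ?ltr0n ?expn_gt0.
  have /fine_cvgP[_ /cvgrPdist_lt /(_ _ e0)[N _ hN]] := cv.
  exists N; have := hN N (leqnn N); rewrite /= sub0r normrN => h.
  rewrite -[mu _]fineK ?fin_num_measure// lee_fin; apply: le_trans (ltW h).
  exact: ler_norm.
have {bnd} [b hb] := choice bnd; exists b.
exists (lim_sup_set (fun n => F n (b n))); split.
- by apply: bigcap_measurable => // k _; exact: bigcup_measurable.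
- apply: lim_sup_set_cvg0 => //.
  apply: (@le_lt_trans _ _ (2^-1)%:E%R); last exact: ltry.
  apply: le_trans (epsilon_trick0 xpredT _); last by rewrite invr_ge0.
  apply: lee_nneseries => n *; last exact: hb.
  exact: (measure_ge0 mu).
- move=> x /= ng N _; apply: contrapT => no; apply: ng => M.
  exists (maxn M N); split; first exact: leq_maxl.
  exists (maxn M N); rewrite ltnNge; apply/negP => l.
  by apply: no; exists (maxn M N) => //=; exact: leq_maxr.
Qed.

(** A single bound [b] gives a Borel coloring on the set [good b], which is a union of components;
    on the remaining null set the bound is chosen for each component. *)
Lemma chi_mu_le : cc_le (chi_mu mu (@walk_graph D)) (Fin 3).
Proof.
rewrite /chi_mu; apply: chromatic_le => //; have [b nb] := dominating.
pose c x := if `[< V x >] then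
  (if `[< good b x >] then col b x else col (chosen x) x) else 0%N.
exists c; split.
- by move=> x /=; rewrite /c; case: asboolP => // _; case: asboolP => _; exact: col_lt3.
- move=> A; exists [set x | if `[< V x >] then good b x /\ A (col b x) else A 0%N].
    apply: measurable_borel; have hS := borel_salg (vtx D).
    have bc : mea (@borel (vtx D)) (fun=> b) by move=> i k; exact: salg_const.
    apply: (@salg_ext _ (@borel (vtx D)) (fun x => (V x /\ (good b x /\ A (col b x))) \/
      (~ V x /\ A 0%N))).
      by move=> x /=; case: asboolP => h; split=> [[[]|[]]//|]; [left|right].
    apply: (salg_or hS); apply: (salg_and hS).
    + exact: V_borel.
    + apply: (salg_and hS); first exact: (good_mea hS bc (@mea_id _)).
      exact: (salg_fiber hS A (fun k => col_mea hS bc (@mea_id _) k)).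
    + by apply: (salg_not hS); exact: V_borel.
    + exact: salg_const.
  exists [set x | V x /\ ~ good b x /\ A (col (chosen x) x)].
    by apply: negligibleS nb => x /= [_ []].
  apply/predeqP => x; rewrite /c /=; case: asboolP => Vx; last first.
    by split=> [[//|[]]//|]; left.
  case: asboolP => gx; split.
  + by case=> [[]|[_ []]].
  + by left.
  + by case=> [[]|[_ []]].
  + by right.
- move=> x y [/= Vx [i ->]]; have Vy := V_gam i Vx; have [ix _] := Vx.
  have cE z : V z -> c z = if `[< good b z >] then col b z else col (chosen z) z.
    by rewrite /c; case: asboolP.
  rewrite (cE x)// (cE (gam i x))//.
  case: (asboolP (good b x)) => gx; case: (asboolP (good b (gam i x))) => gy.
  + exact: col_proper.
  + by case: gy; exact: good_gam.
  + by case: gx; have := @good_gam _ _ _ i gy; rewrite gamK.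
  + by rewrite chosen_gam; apply: col_proper => //; exact: chosen_good.
Qed.

End Measure.

(** * Analytic sets *)

Notation natp K := (prod_topology (fun _ : K => nat) : topologicalType).

Lemma cts_pair (T U W : topologicalType) (f : T -> U) (g : T -> W) :
  continuous f -> continuous g -> continuous (fun t => (f t, g t)).
Proof. by move=> cf cg t; apply: cvg_pair; [exact: cf|exact: cg]. Qed.

Lemma cts_comp (T U W : topologicalType) (f : T -> U) (g : U -> W) :
  continuous f -> continuous g -> continuous (fun t => g (f t)).
Proof. by move=> cf cg t; apply: (@continuous_comp _ _ _ f g); [exact: cf|exact: cg]. Qed.

Lemma cts_fst (T U : topologicalType) : continuous (@fst T U).
Proof. by move=> p; exact: cvg_fst. Qed.

Lemma cts_snd (T U : topologicalType) : continuous (@snd T U).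
Proof. by move=> p; exact: cvg_snd. Qed.

Lemma closed_pre (T U : topologicalType) (f : T -> U) (F : set U) : continuous f ->
  closed F -> closed (fun t => F (f t)).
Proof. by move=> cf; apply: closed_comp => t _; exact: cf. Qed.

Definition pull (I J : countType) (e : I -> J) (z : natp J) : natp I := fun i => z (e i).

Lemma cts_pull (I J : countType) (e : I -> J) : continuous (pull e).
Proof. by apply: cts_nat => i k; exact: (coord_open (e i) [set k]). Qed.

Lemma pull_surj (I J : countType) (e : I -> J) (r : natp I) : injective e ->
  exists z : natp J, pull e z = r.
Proof.
move=> ei; exists (fun j => if pselect (exists i, e i = j) is left h then r (projT1 (cid h)) else 0%N).
apply/funext => i; rewrite /pull; case: pselect => [h|[]]; last by exists i.
by case: (cid h) => i' /= /ei ->.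
Qed.

Definition pull2 (I J : countType) (z : baire_space) : natp I * natp J :=
  (pull (fun i => pickle (inl i : I + J)) z, pull (fun j => pickle (inr j : I + J)) z).

Lemma pull2_surj (I J : countType) (r : natp I) (q : natp J) : exists z, pull2 I J z = (r, q).
Proof.
have [z hz] := @pull_surj (I + J)%type nat pickle
  (fun k => match k with inl i => r i | inr j => q j end) (pcan_inj pickleK).
by exists z; congr pair; apply/funext => i; rewrite -[LHS]/(pull pickle z _) hz.
Qed.

Lemma cts_pull2 (I J : countType) : continuous (@pull2 I J).
Proof. by apply: cts_pair; exact: cts_pull. Qed.

Lemma coord_closed (I : countType) (i : I) (A : set nat) : closed [set x : natp I | A (x i)].
Proof. by rewrite -[X in closed X]setCK; apply: open_closedC; exact: (coord_open i (~` A)). Qed.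

Section Sigma.
Variable T : topologicalType.
Implicit Types A : set T.

Lemma sig_closed A : closed A -> sigma11 A.
Proof.
move=> cA; exists (fun p => A p.1); first exact: (closed_pre (@cts_fst T _) cA).
by apply/predeqP => t; split=> [At|[[t' z] /= At <-//]]; exists (t, (fun=> 0%N) : baire_space).
Qed.

Lemma sig_bigU (A : nat -> set T) : (forall i, sigma11 (A i)) ->
  sigma11 (fun t => exists i, A i t).
Proof.
move=> hA; have {hA} [F hF] := choice (fun i => let: ex_intro2 F cF e := hA i in
  ex_intro (fun F => closed F /\ A i = fst @` F) F (conj cF e)).
pose g (p : T * baire_space) := (p.1, pull (I := nat) S p.2 : baire_space).
have cg : continuous g.
  by apply: cts_pair; [exact: cts_fst|exact: (cts_comp (@cts_snd _ _) (@cts_pull nat nat S))].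
exists (\bigcap_k [set p : T * baire_space | p.2 0%N <> k \/ F k (g p)]).
  apply: closed_bigI => k _; apply: closedU; last exact: (closed_pre cg (hF k).1).
  exact: (closed_pre (@cts_snd T baire_space) (@coord_closed nat 0%N (fun m => m <> k))).
apply/predeqP => t; split=> [[i]|[[t' z] h /= <-]].
  rewrite (hF i).2 => -[[t' z] Fz /= <-].
  exists (t', (fun n => if n is m.+1 then z m else i) : baire_space) => // k _.
  have [ik|ne] := pselect (i = k); [right|by left]; rewrite -ik.
  by rewrite (_ : g _ = (t', z))//; congr pair; apply/funext.
exists (z 0%N); rewrite (hF _).2; exists (g (t', z)) => //.
by have [] := h (z 0%N) I.
Qed.

Lemma sig_bigI (A : nat -> set T) : (forall i, sigma11 (A i)) ->
  sigma11 (fun t => forall i, A i t).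
Proof.
move=> hA; have {hA} [F hF] := choice (fun i => let: ex_intro2 F cF e := hA i in
  ex_intro (fun F => closed F /\ A i = fst @` F) F (conj cF e)).
pose g (i : nat) (p : T * baire_space) := (p.1, pull (fun n : nat => pickle (i, n)) p.2 : baire_space).
have cg i : continuous (g i).
  apply: cts_pair; first exact: cts_fst.
  exact: (cts_comp (@cts_snd _ _) (@cts_pull nat nat _)).
exists (\bigcap_i [set p | F i (g i p)]).
  by apply: closed_bigI => i _; exact: (closed_pre (cg i) (hF i).1).
apply/predeqP => t; split=> [h|[[t' z] h /= <-] i]; last first.
  by rewrite (hF i).2; exists (g i (t', z)) => //; exact: h.
have {h} h i : exists z : baire_space, F i (t, z).
  by have := h i; rewrite (hF i).2 => -[[t' z] Fz /= <-]; exists z.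
have [z hz] := choice h; have [w hw] := @pull_surj (nat * nat)%type nat pickle
  (fun p => z p.1 p.2) (pcan_inj pickleK).
exists (t, w) => // i _ /=; rewrite (_ : g i _ = (t, z i))//; congr pair.
by apply/funext => n; rewrite -[LHS]/(pull pickle w (i, n)) hw.
Qed.

Lemma sig_or A A' : sigma11 A -> sigma11 A' -> sigma11 (fun t => A t \/ A' t).
Proof.
move=> h h'; rewrite (_ : (fun t => _) = fun t => exists i, (if i is 0%N then A else A') t).
  by apply: sig_bigU => -[].
apply/predeqP => t; split=> [[]|[[|i]]]; [by exists 0%N|by exists 1%N|by left|by right].
Qed.

Lemma sig_and A A' : sigma11 A -> sigma11 A' -> sigma11 (fun t => A t /\ A' t).
Proof.
move=> h h'; rewrite (_ : (fun t => _) = fun t => forall i, (if i is 0%N then A else A') t).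
  by apply: sig_bigI => -[].
by apply/predeqP => t; split=> [[? ?] [|i]//|h0]; split; [exact: (h0 0%N)|exact: (h0 1%N)].
Qed.

Lemma sig_proj (K : countType) (P : set (T * natp K)) : sigma11 P ->
  sigma11 (fun t => exists r, P (t, r)).
Proof.
move=> [F cF ->]; pose g (p : T * baire_space) :=
  ((p.1, (pull2 K nat p.2).1), (pull2 K nat p.2).2 : baire_space).
have c2 : continuous (fun p : T * baire_space => pull2 K nat p.2).
  exact: (cts_comp (@cts_snd _ _) (@cts_pull2 K nat)).
have cg : continuous g.
  apply: cts_pair; last exact: (cts_comp c2 (@cts_snd _ _)).
  by apply: cts_pair; [exact: cts_fst|exact: (cts_comp c2 (@cts_fst _ _))].
exists (fun p => F (g p)); first exact: closed_pre.
apply/predeqP => t; split=> [[r [[[t' r'] z] Fz /= [<- _]]]|[[t' z] Fz /= <-]].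
  have [w hw] := pull2_surj r' (z : natp nat).
  have e : g (t', w) = ((t', r'), z) by rewrite /g -[(t', w).2]/w hw.
  by exists (t', w) => //; rewrite /mkset e.
by exists (pull2 K nat z).1, (g (t', z)).
Qed.

End Sigma.

Lemma sig_pre (T U : topologicalType) (f : T -> U) (A : set U) : continuous f ->
  sigma11 A -> sigma11 (fun t => A (f t)).
Proof.
move=> cf [F cF ->]; pose g (p : T * baire_space) := (f p.1, p.2).
have cg : continuous g.
  by apply: cts_pair; [exact: (cts_comp (@cts_fst _ _) cf)|exact: cts_snd].
exists (fun p => F (g p)); first exact: closed_pre.
apply/predeqP => t; split=> [[[u z] Fz /= e]|[[t' z] Fz /= <-]].
  by exists (t, z) => //; move: Fz; rewrite e.
by exists (g (t', z)).
Qed.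

(** The class Delta11. Since it satisfies [salg], a condition built by countable operations can be
    assembled freely before a projection is taken. *)
Definition bian (T : topologicalType) (A : set T) : Prop := sigma11 A /\ sigma11 (fun t => ~ A t).

Lemma bian_salg (T : topologicalType) : salg (@bian T).
Proof.
split.
- split; apply: sig_closed; first exact: closedT.
  rewrite (_ : (fun t => _) = set0); first exact: closed0.
  by apply/predeqP => t; split=> // -[].
- move=> P [h1 h2]; split=> //; rewrite (_ : (fun t => _) = P)//.
  by apply/predeqP => t; split=> [/contrapT//|h n]; exact: n.
- move=> P hP; split; first by apply: sig_bigU => i; case: (hP i).
  rewrite (_ : (fun t => _) = fun t => forall i, ~ P i t).
    by apply: sig_bigI => i; case: (hP i).
  by apply/predeqP => t; split=> [h i Pi|h [i]]; [apply: h; exists i|exact: h].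
Qed.

Lemma bian_pre (T U : topologicalType) (f : T -> U) (A : set U) : continuous f ->
  bian A -> bian (fun t => A (f t)).
Proof. by move=> cf [h1 h2]; split; [exact: sig_pre|exact: (@sig_pre _ _ f (fun t => ~ A t) cf h2)]. Qed.

Lemma bian_mea (T : topologicalType) (I : countType) (f : T -> natp I) : continuous f ->
  mea (@bian T) f.
Proof.
move=> cf i k; apply: (@bian_pre _ _ f (fun r => r i = k) cf).
by split; apply: sig_closed; [exact: (@coord_closed I i (fun m => m = k))|exact: (@coord_closed I i (fun m => m <> k))].
Qed.

Lemma bian_mea_fst (T U : topologicalType) (I : countType) (f : T -> natp I) :
  mea (@bian T) f -> mea (@bian (T * U)%type) (fun p => f p.1).
Proof. by move=> hf i k; exact: (@bian_pre _ _ fst (fun t => f t i = k) (@cts_fst T U) (hf i k)). Qed.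

(** * Suslin's theorem *)

Section Suslin.
Variable I : countType.
Local Notation X := (natp I).
Implicit Types (A B : set X) (s : seq nat) (F : set baire_space).

Definition separated A B : Prop := exists C, [/\ borel C, A `<=` C & forall x, C x -> ~ B x].

Lemma separated_bigU (A B : nat -> set X) : (forall i j, separated (A i) (B j)) ->
  separated (\bigcup_i A i) (\bigcup_j B j).
Proof.
move=> h; have [C hC] := choice (fun p : nat * nat => h p.1 p.2).
have hS := borel_salg X; exists (fun x => exists i, forall j, C (i, j) x); split.
- apply: (salg_ex hS) => i; apply: (salg_allc hS) => j; by case: (hC (i, j)).
- by move=> x [i _ Ax]; exists i => j; case: (hC (i, j)) => _ + _; apply.
- by move=> x [i Cx] [j _ Bx]; case: (hC (i, j)) => _ _ /(_ x (Cx j)).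
Qed.

Definition part (e : I -> nat) F s : set X :=
  [set x | exists z : baire_space, [/\ F z, pre z (size s) = s & pull e z = x]].

Lemma part_bigU e F s : part e F s = \bigcup_n part e F (rcons s n).
Proof.
apply/predeqP => x; split=> [[z [Fz zs zx]]|[n _ [z [Fz zs zx]]]].
  by exists (z (size s)) => //; exists z; split=> //; rewrite size_rcons preS zs.
by exists z; split=> //; move: zs; rewrite size_rcons preS => /rcons_inj[].
Qed.

Lemma part_closed e F (z : baire_space) : closed F -> ~ F z ->
  exists n, part e F (pre z n) = set0.
Proof.
move=> cF nF; have oF : open (~` F) by exact: closed_openC.
have [J hJ] := (@openP_cyl nat (~` F)).1 oF z nF.
exists (\max_(j <- J) j).+1; apply/predeqP => x; split=> // -[w [Fw]].
rewrite size_pre => e' _; apply: (hJ w) Fw => j jJ.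
have jm : (j < (\max_(j <- J) j).+1)%N by rewrite ltnS; exact: (@leq_bigmax_seq _ J xpredT id).
by rewrite -(nth_mkseq 0%N w jm) -/(pre w _) e' nth_mkseq.
Qed.

(** Lusin separation. If [A] and its complement cannot be separated, neither can some parts of them
    with ever longer initial segments; closedness puts the limits [z] and [w] into the two sets, so
    their points differ at a coordinate, and one cylinder separates late parts. *)
Lemma suslin A : sigma11 A -> sigma11 (~` A) -> borel A.
Proof.
pose e i : nat := pickle (inl i : I + nat).
have nf A' : sigma11 A' -> exists F, closed F /\ A' = part e F [::].
  move=> [F cF ->]; exists (fun z => F (pull2 I nat z)); split.
    exact: (closed_pre (@cts_pull2 I nat) cF).
  apply/predeqP => x; split=> [[[x' z] Fz /= <-]|[z [Fz _ <-]]]; last by exists (pull2 I nat z).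
  by have [w hw] := pull2_surj x' (z : natp nat); exists w; rewrite hw; split=> //; case: hw.
move=> /nf[F [cF eA]] /nf[G [cG eB]].
suff [C [bC AC CB]] : separated A (~` A).
  suff -> : A = C by []; apply/predeqP => x; split=> [/AC//|/CB h].
  exact: contrapT.
rewrite [A in separated A _]eA eB; apply: contrapT => ns.
have step (p : seq nat * seq nat) : exists q : nat * nat,
    ~ separated (part e F p.1) (part e G p.2) ->
    ~ separated (part e F (rcons p.1 q.1)) (part e G (rcons p.2 q.2)).
  have [sp|nsp] := pselect (separated (part e F p.1) (part e G p.2)); first by exists (0, 0)%N.
  apply: contrapT => no; apply: nsp; rewrite part_bigU (part_bigU e G).
  by apply: separated_bigU => i j; apply: contrapT => nij; apply: no; exists (i, j).
have {step} [nx hnx] := choice step.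
pose st := fix st k := if k is k'.+1 then
  (rcons (st k').1 (nx (st k')).1, rcons (st k').2 (nx (st k')).2) else ([::], [::]) : seq nat * seq nat.
have hst k : ~ separated (part e F (st k).1) (part e G (st k).2).
  by elim: k => [//|k IH] /=; exact: hnx.
pose z : baire_space := fun k => (nx (st k)).1; pose w : baire_space := fun k => (nx (st k)).2.
have ez k : pre z k = (st k).1 by elim: k => [//|k IH]; rewrite preS IH.
have ew k : pre w k = (st k).2 by elim: k => [//|k IH]; rewrite preS IH.
have b0 : borel (set0 : set X) by exact: (salg_const (borel_salg X) False).
have Fz : F z.
  apply: contrapT => /(part_closed e cF)[n]; rewrite ez => h; apply: (hst n).
  by rewrite h; exists set0; split.
have Gw : G w.
  apply: contrapT => /(part_closed e cG)[n]; rewrite ew => h; apply: (hst n).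
  by rewrite h; exists setT; split=> //; [exact: (salgT (borel_salg X))|move=> x _ []].
have Az : A (pull e z) by rewrite eA; exists z.
have Bw : (~` A) (pull e w) by rewrite eB; exists w.
have [i zw] : exists i, z (e i) <> w (e i).
  apply: contrapT => no; apply: Bw; rewrite (_ : pull e w = pull e z)//.
  by apply/funext => i; apply: contrapT => ne; apply: no; exists i => h; apply: ne.
have hp (u : baire_space) E x : part e E (pre u (e i).+1) x -> x i = u (e i).
  move=> [v [_ ev <-]]; rewrite size_pre in ev.
  by rewrite /pull -(nth_mkseq 0%N v (ltnSn (e i))) -/(pre v _) ev nth_mkseq.
apply: (hst (e i).+1); rewrite -ez -ew; exists (fun x => x i = z (e i)); split.
- exact: borel_coord.
- by move=> x /hp.
- by move=> x xz /hp xw; apply: zw; rewrite -xz -xw.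
Qed.

End Suslin.

(** * Borel codes and their evaluations *)

(* A basic code is its own component, so that [okv] can quantify over all words. *)
Definition kid (c : baire_space) (i : nat) : baire_space :=
  if c 0%N == 0%N then c else if c 0%N == 1%N then Defs.shift c else code_section (Defs.shift c) i.

Definition sub_code (c : baire_space) (s : seq nat) : baire_space := foldl kid c s.

Definition wfc (c : baire_space) : Prop := forall p : nat -> nat, exists n, sub_code c (pre p n) 0%N = 0%N.

Section Codes.
Context {Y : Type} (U : nat -> set Y).
Implicit Types (c : baire_space) (A : set Y) (z : Y) (v : seq nat -> nat).

Definition den c z : Prop := exists2 A, borel_code U c A & A z.

(** [v] is a table of truth values of all subcodes at the point [z], nonzero meaning true. For a
    well-founded code every table gives the same answer at the root, so membership and its negation
    both become existential statements over tables. *)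
Definition okv c z v : Prop := forall s, let a := sub_code c s in
  [/\ (a 0%N = 0%N -> (v s <> 0%N <-> U (a 1%N) z)),
      (a 0%N = 1%N -> (v s <> 0%N <-> v (rcons s 0%N) = 0%N)) &
      ((1 < a 0)%N -> (v s <> 0%N <-> exists i, v (rcons s i) <> 0%N))].

Lemma okv_kid c z v i : okv c z v -> okv (kid c i) z (fun s => v (i :: s)).
Proof. by move=> h s; have := h (i :: s). Qed.

Lemma kid_basic c i : c 0%N = 0%N -> kid c i = c.
Proof. by rewrite /kid => ->. Qed.

Lemma kid_compl c i : c 0%N = 1%N -> kid c i = Defs.shift c.
Proof. by rewrite /kid => ->. Qed.

Lemma kid_union c i : (1 < c 0)%N -> kid c i = code_section (Defs.shift c) i.
Proof. by rewrite /kid; case: (c 0%N) => [|[|k]]. Qed.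

Lemma kinds c : [\/ c 0%N = 0%N, c 0%N = 1%N | (1 < c 0)%N].
Proof. by case E: (c 0%N) => [|[|k]]; [constructor 1|constructor 2|constructor 3]. Qed.

Lemma code_wfc c A : borel_code U c A -> wfc c.
Proof.
have cons c' (p : nat -> nat) n : sub_code (kid c' (p 0%N)) (pre (fun k => p k.+1) n) 0%N = 0%N ->
    exists n, sub_code c' (pre p n) 0%N = 0%N.
  move=> e; exists n.+1.
  suff -> : sub_code c' (pre p n.+1) = sub_code (kid c' (p 0%N)) (pre (fun k => p k.+1) n) by [].
  by rewrite [pre p n.+1]/pre /mkseq /= (iotaDl 1 0 n : iota 1 n = _) -map_comp.
elim=> {c A} [c c0 p|c A c1 _ IH p|c A c2 _ IH p]; first by exists 0%N.
  have [n] := IH (fun k => p k.+1); rewrite -(kid_compl (p 0%N) c1); exact: cons.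
have [n] := IH (p 0%N) (fun k => p k.+1); rewrite -(kid_union (p 0%N) c2); exact: cons.
Qed.

Lemma wfc_code c : wfc c -> exists A, borel_code U c A.
Proof.
move=> wf; apply: contrapT => nA.
pose bad c := ~ exists A, borel_code U c A.
have step c' : exists i, bad c' -> bad (kid c' i) /\ c' 0%N <> 0%N.
  have [g|b] := pselect (exists A, borel_code U c' A); first by exists 0%N => /(_ g).
  case: (kinds c') => [c0|c1|c2].
  - by case: b; exists (U (c' 1%N)); constructor.
  - exists 0%N => _; rewrite c1 kid_compl//; split=> // -[A hA].
    by apply: b; exists (~` A); apply: code_compl.
  - apply: contrapT => no; apply: b.
    have h i : exists A, borel_code U (code_section (Defs.shift c') i) A.
      apply: contrapT => nAi; apply: no; exists i => _; rewrite kid_union//; split=> //.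
      by move=> e; rewrite e in c2.
    have [A hA] := choice h; exists (\bigcup_i A i); exact: code_union.
have {step} [f hf] := choice step.
pose st := fix st k := if k is k'.+1 then kid (st k') (f (st k')) else c.
pose p k := f (st k).
have e k : sub_code c (pre p k) = st k.
  by elim: k => [//|k IH]; rewrite preS /sub_code foldl_rcons -/(sub_code _ _) IH.
have b k : bad (st k) by elim: k => [//|k IH]; case: (hf _ IH).
have [n] := wf p; rewrite e; have [_] := hf _ (b n); exact.
Qed.

Lemma okv_ex c A z : borel_code U c A -> exists v, okv c z v.
Proof.
have glue c' (r : nat) (w : nat -> seq nat -> nat) : (forall i, okv (kid c' i) z (w i)) ->
    [/\ (c' 0%N = 0%N -> (r <> 0%N <-> U (c' 1%N) z)),
        (c' 0%N = 1%N -> (r <> 0%N <-> w 0%N [::] = 0%N)) &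
        ((1 < c' 0)%N -> (r <> 0%N <-> exists i, w i [::] <> 0%N))] ->
    okv c' z (fun s => if s is i :: s' then w i s' else r).
  by move=> hw hr [|i s] //; exact: (hw i s).
have dec (P : Prop) : exists r : nat, r <> 0%N <-> P.
  by have [h|h] := pselect P; [exists 1%N|exists 0%N].
elim=> {c A} [c c0|c A c1 hA [v hv]|c A c2 hA IH].
- have [r hr] := dec (U (c 1%N) z); exists (fun=> r) => s /=.
  have -> : sub_code c s = c by elim: s => [//|i s IH]; rewrite /= kid_basic.
  by split=> //; rewrite c0.
- have [r hr] := dec (v [::] = 0%N).
  exists (fun s => if s is i :: s' then v s' else r); apply: (glue _ _ (fun=> v)).
    by move=> i; rewrite kid_compl.
  by split=> //; rewrite c1.
- have [w hw] := choice IH; have [r hr] := dec (exists i, w i [::] <> 0%N).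
  exists (fun s => if s is i :: s' then w i s' else r); apply: glue.
    by move=> i; rewrite kid_union.
  by split=> // e; rewrite e in c2.
Qed.

Lemma okv_val c A z v : borel_code U c A -> okv c z v -> v [::] <> 0%N <-> A z.
Proof.
move=> hA; elim: hA v => {c A} [c c0|c A c1 _ IH|c A c2 _ IH] v hv.
- by have [h _ _] := hv [::]; exact: h.
- have [_ h _] := hv [::]; have h1 := h c1; have hk := okv_kid 0 hv.
  rewrite (kid_compl 0 c1) in hk; have h2 := IH _ hk.
  split=> [/h1 e /h2|nA]; first by rewrite e.
  by apply/h1; apply: contrapT => /h2.
- have [_ _ h] := hv [::]; have /= h1 := h c2.
  have h2 i : v [:: i] <> 0%N <-> A i z.
    by have hk := okv_kid i hv; rewrite (kid_union i c2) in hk; exact: IH hk.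
  by split=> [/h1[i /h2 Ai]|[i _ /h2 vi]]; [exists i|apply/h1; exists i].
Qed.

Lemma denP c z v : wfc c -> okv c z v -> den c z <-> v [::] <> 0%N.
Proof.
move=> /wfc_code[A hA] hv; split=> [[B hB Bz]|/(okv_val hA hv) Az]; last by exists A.
exact/(okv_val hB hv).
Qed.

Lemma den_code c A : borel_code U c A -> forall z, den c z <-> A z.
Proof.
move=> hA z; have [v hv] := okv_ex z hA.
by have h1 := denP (code_wfc hA) hv; have h2 := okv_val hA hv; tauto.
Qed.

Section CodeMea.
Context {T : Type} (S : set (set T)) (hS : salg S).

Lemma kid_mea (c : T -> baire_space) i : mea S c -> mea S (fun t => kid (c t) i).
Proof.
move=> hc n k.
apply: (@salg_ext _ S (fun t => (c t 0%N = 0%N /\ c t n = k) \/ ((c t 0%N = 1%N /\ c t n.+1 = k) \/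
   ((1 < c t 0)%N /\ c t (pickle (i, n)).+1 = k)))).
  move=> t; case: (kinds (c t)) => h;
    rewrite ?(kid_basic _ h) ?(kid_compl _ h) ?(kid_union _ h) /code_section /Defs.shift.
  - by split=> [[[]//|[[]|[]]]|e]; rewrite ?h //; left.
  - by split=> [[[]|[[]//|[]]]|e]; rewrite ?h //; right; left.
  - split=> [[[e]|[[e]|[]//]]|e]; [by rewrite e in h|by rewrite e in h|by right; right].
apply: (salg_or hS); first exact: (salg_and hS (hc _ _) (hc _ _)).
apply: (salg_or hS); first exact: (salg_and hS (hc _ _) (hc _ _)).
apply: (salg_and hS) => //; exact: (salg_fiber hS (fun m => (1 < m)%N : Prop) (hc 0%N)).
Qed.

Lemma sub_mea s (c : T -> baire_space) : mea S c -> mea S (fun t => sub_code (c t) s).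
Proof. by elim: s c => [//|i s IH] c hc; exact: (IH _ (kid_mea i hc)). Qed.

Lemma okv_mea (c : T -> baire_space) (z : T -> Y) (v : T -> seq nat -> nat) :
  mea S c -> mea S v -> (forall m, S (fun t => U m (z t))) -> S (fun t => okv (c t) (z t) (v t)).
Proof.
move=> hc hv hU.
have nz (f : T -> nat) : (forall k, S (fun t => f t = k)) -> S (fun t => f t <> 0%N).
  by move=> hf; exact: (salg_not hS).
apply: (@salg_ext _ S (fun t => forall s, let a := sub_code (c t) s in
  ((a 0%N = 0%N -> (v t s <> 0%N <-> U (a 1%N) (z t))) /\
   ((a 0%N = 1%N -> (v t s <> 0%N <-> v t (rcons s 0%N) = 0%N)) /\
    ((1 < a 0)%N -> (v t s <> 0%N <-> exists i, v t (rcons s i) <> 0%N)))))).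
  by move=> t; split=> h s; [have [h1 [h2 h3]] := h s|have [h1 h2 h3] := h s].
apply: (salg_allc hS) => s /=; have ha := sub_mea s hc.
apply: (salg_and hS); [|apply: (salg_and hS)]; apply: (salg_imp hS) => //.
- apply: (salg_iff hS); first exact: nz.
  apply: (@salg_ext _ S (fun t => exists m, sub_code (c t) s 1%N = m /\ U m (z t))).
    by move=> t; split=> [[m [-> ]]//|h]; exists (sub_code (c t) s 1%N).
  by apply: (salg_ex hS) => m; apply: (salg_and hS).
- by apply: (salg_iff hS); [exact: nz|].
- exact: (salg_fiber hS (fun m => (1 < m)%N : Prop) (ha 0%N)).
- apply: (salg_iff hS); first exact: nz.
  by apply: (salg_ex hS) => i; exact: nz.
Qed.

End CodeMea.
End Codes.

Lemma code_borel (Y : topologicalType) (U : nat -> set Y) c A : (forall m, open (U m)) ->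
  borel_code U c A -> borel A.
Proof.
move=> oU; have hS := borel_salg Y; elim=> {c A} [c _|c A _ _ IH|c A _ _ IH].
- exact: borel_open.
- exact: (salg_not hS).
- apply: (@salg_ext _ (@borel Y) (fun t => exists i, A i t)).
    by move=> t; split=> [[i h]|[i _ h]]; exists i.
  exact: (salg_ex hS).
Qed.

Lemma nwfc_sig (T : topologicalType) (c : T -> baire_space) : mea (@bian T) c ->
  sigma11 (fun t => ~ wfc (c t)).
Proof.
move=> hc; rewrite (_ : (fun t => _) = fun t => exists p : natp nat, forall n,
    sub_code (c t) (pre p n) 0%N <> 0%N); last first.
  apply/predeqP => t; split=> [h|[p h] /(_ p)[n /h]//]; apply: contrapT => no; apply: h => p.
  by apply: contrapT => nn; apply: no; exists p => n e; apply: nn; exists n.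
pose P (q : T * natp nat) := forall n, sub_code (c q.1) (pre q.2 n) 0%N <> 0%N.
suff [h _] : bian P by exact: (sig_proj h).
have hS := bian_salg (T * natp nat)%type.
have h2 : mea (@bian (T * natp nat)%type) snd by apply: bian_mea; exact: cts_snd.
have h1 : mea (@bian (T * natp nat)%type) (fun q => c q.1) := @bian_mea_fst T (natp nat) nat c hc.
apply: (salg_allc hS) => n.
apply: (@salg_ext _ (@bian (T * natp nat)%type) (fun q => forall s, pre q.2 n = s -> sub_code (c q.1) s 0%N <> 0%N)).
  by move=> q; split=> [h|h s <-]; [exact: (h _ erefl)|].
apply: (salg_allc hS) => s; apply: (salg_imp hS); last by apply: (salg_not hS); exact: sub_mea.
elim: n s => [|n IH] s; first by apply: (@salg_ext _ (@bian _) (fun=> [::] = s)) => //; exact: salg_const.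
case/lastP: s => [|s k].
  apply: (@salg_ext _ (@bian (T * natp nat)%type) (fun=> False)); last exact: (salg_const hS).
  by move=> q; rewrite preS; split=> // /(congr1 size); rewrite size_rcons.
apply: (@salg_ext _ (@bian (T * natp nat)%type) (fun q => pre q.2 n = s /\ q.2 n = k)).
  by move=> q; rewrite preS; split=> [[-> ->]//|/rcons_inj[]].
by apply: (salg_and hS).
Qed.

(** * Continuous families of codes *)

Section Coded.
Context {Z Y : topologicalType} (U : nat -> set Y).

(** Codes of the sections, continuous in the parameter. As these families form a [salg], a graph
    defined from clopen sets of parameters and Borel sets of vertices obtains its code map from the
    shape of its definition. *)
Definition coded (P : set (Z * Y)) : Prop := exists f : Z -> baire_space,
  continuous f /\ forall s, borel_code U (f s) (fun z => P (s, z)).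

Lemma coded_not P : coded P -> coded (fun p => ~ P p).
Proof.
move=> [f [cf hf]]; exists (fun s n => if n is m.+1 then f s m else 1%N); split.
  apply: (@cts_nat nat) => -[|m] k.
    have [e|ne] := pselect (1%N = k); first by rewrite (_ : [set t | _] = setT) ?predeqE//; exact: openT.
    by rewrite (_ : [set t | _] = set0) ?predeqE//; exact: open0.
  apply: (@open_comp _ _ f [set c : natp nat | c m = k]); last exact: (coord_open m [set k]).
  by move=> s _; exact: cf.
by move=> s; exact: (@code_compl _ U (fun n => if n is m.+1 then f s m else 1%N) (fun z => P (s, z)) erefl (hf s)).
Qed.

Lemma coded_ex (P : nat -> set (Z * Y)) : (forall i, coded (P i)) -> coded (fun p => exists i, P i p).
Proof.
move=> /choice[f hf].
pose g (s : Z) : baire_space := fun n => if n is m.+1 then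
   (if unpickle m is Some (i, k) then f i s k else 0%N) else 2.
exists g; split.
  apply: (@cts_nat nat) => n k.
  have const (a : nat) : open [set s : Z | a = k].
    have [e|ne] := pselect (a = k); first by rewrite (_ : [set s | _] = setT) ?predeqE//; exact: openT.
    by rewrite (_ : [set s | _] = set0) ?predeqE//; exact: open0.
  case: n => [|m]; rewrite /g //=; case: (unpickle m) => [[i l]|//].
  apply: (@open_comp _ _ (f i) [set c : natp nat | c l = k]); last exact: (coord_open l [set k]).
  by move=> s _; exact: (hf i).1.
move=> s; rewrite (_ : (fun z => _) = \bigcup_i (fun z => P i (s, z))).
  apply: code_union => // i.
  rewrite (_ : code_section (Defs.shift (g s)) i = f i s); first exact: (hf i).2.
  by apply/funext => n; rewrite /code_section /Defs.shift /g pickleK.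
by apply/predeqP => z; split=> [[i h]|[i _ h]]; exists i.
Qed.

Lemma coded_basic m : coded (fun p => U m p.2).
Proof.
exists (fun=> fun n => if n is 1 then m else 0%N); split; first by move=> s; exact: cvg_cst.
by move=> s; exact: (@code_basic _ U (fun n => if n is 1 then m else 0%N)).
Qed.

Lemma coded_salg : salg coded.
Proof.
split; [|exact: coded_not|exact: coded_ex].
rewrite (_ : (fun=> True) = fun p => exists i, (if i is 0%N then fun p : Z * Y => U 0%N p.2 else fun p => ~ U 0%N p.2) p).
  by apply: coded_ex => -[|i]; [exact: coded_basic|apply: coded_not; exact: coded_basic].
apply/predeqP => p; split=> // _.
by have [h|h] := pselect (U 0%N p.2); [exists 0%N|exists 1%N].
Qed.

Lemma coded_open (O : set Y) : (forall z, O z -> exists m, U m z /\ U m `<=` O) ->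
  coded (fun p => O p.2).
Proof.
move=> h; apply: (@salg_ext _ coded (fun p => exists m, (U m `<=` O) /\ U m p.2)).
  by move=> p; split=> [[m []]|/h[m []]]; [exact|exists m].
apply: (salg_ex coded_salg) => m; apply: (salg_and coded_salg); last exact: coded_basic.
exact: (salg_const coded_salg).
Qed.

(** The code switches between a code of the whole space and a code of the empty set according to
    [C s]; this switch is continuous because [C] is clopen. *)
Lemma coded_clopen (C : set Z) : clopen C -> coded (fun p => C p.1).
Proof.
move=> [oC cC].
have [cT [kT hT]] := salg_const coded_salg True; have [cF [kF hF]] := salg_const coded_salg False.
have op (f : Z -> baire_space) n k : continuous f -> open [set s | f s n = k].
  move=> cf; apply: (@open_comp _ _ f [set c : natp nat | c n = k]); last exact: (coord_open n [set k]).
  by move=> s _; exact: cf.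
exists (fun s => if `[< C s >] then cT s else cF s); split; last first.
  by move=> s; case: asboolP => Cs; [have := hT s|have := hF s];
    rewrite (_ : (fun z => _) = (fun z => C (s, z).1))//; apply/predeqP.
apply: (@cts_nat nat) => n k.
rewrite (_ : [set s | _] = (C `&` [set s | cT s n = k]) `|` (~` C `&` [set s | cF s n = k])).
  by apply: openU; apply: openI => //; [exact: op|exact: closed_openC|exact: op].
apply/predeqP => s /=; case: asboolP => Cs; split.
- by move=> h; left.
- by case=> -[].
- by move=> h; right.
- by case=> -[].
Qed.

End Coded.

(** * Colorings coded by sequences *)

Section Colorings.
Variables (I : countType) (D : nat).
Hypothesis D0 : (0 < D)%N.
Local Notation X := (natp I).
Implicit Types (d : baire_space) (x : X) (u : nat -> Prop) (G : X -> X -> Prop).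

Definition cylB (m : nat) : set X := if unpickle m is Some c then @cyl I c else set0.

(** The least true index, with default [0]: every [d] with well-founded sections then codes a total
    map into [D] colors, and only conflicts remain to be excluded. *)
Definition color_of u (k : nat) : Prop :=
  ((k < D)%N /\ u k /\ forall j, (j < k)%N -> ~ u j) \/ (k = 0%N /\ forall j, (j < D)%N -> ~ u j).

Definition dcol d x (j : nat) : Prop := den cylB (code_section d j) x.

Definition bad G d : Prop := (exists j, (j < D)%N /\ ~ wfc (code_section d j)) \/
  exists x x', G x x' /\ exists k, color_of (dcol d x) k /\ color_of (dcol d x') k.

Lemma cylB_open m : open (cylB m).
Proof. by rewrite /cylB; case: unpickle => [c|]; [exact: cyl_open|exact: open0]. Qed.

Lemma color_of_ext u u' k : (forall j, (j < D)%N -> (u j <-> u' j)) -> color_of u k -> color_of u' k.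
Proof.
move=> e [[kD [uk mk]]|[-> no]]; [left|right]; last by split=> // j jD /(e j jD) /no; exact.
split=> //; split=> [|j jk /(e j (ltn_trans jk kD))]; [exact/(e k kD)|exact: mk].
Qed.

Lemma color_of_ex u : exists k, color_of u k.
Proof.
have [[j [jD uj]]|no] := pselect (exists j, (j < D)%N /\ u j); last first.
  by exists 0%N; right; split=> // j jD uj; apply: no; exists j.
have ex : exists j, `[< u j >] by exists j; exact/asboolP.
case: (ex_minnP ex) => k /asboolP uk mk; exists k; left; split.
  by apply: leq_ltn_trans jD; apply: mk; exact/asboolP.
by split=> // i ik ui; have := mk i (introT (asboolP _) ui); rewrite leqNgt ik.
Qed.

Lemma color_of_lt u k : color_of u k -> (k < D)%N.
Proof. by case=> [[]|[->]]. Qed.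

Lemma color_of_uniq u k l : color_of u k -> color_of u l -> k = l.
Proof.
case=> [[kD [uk mk]]|[-> nk]] [[lD [ul ml]]|[-> nl]] //.
- by have [/ml|/mk|] := ltngtP k l.
- by case: (nl _ kD).
- by case: (nk _ lD).
Qed.

Section ColMea.
Context {T : Type} (S : set (set T)) (hS : salg S).
Lemma color_of_mea (u : T -> nat -> Prop) k : (forall j, (j < D)%N -> S (fun t => u t j)) ->
  S (fun t => color_of (u t) k).
Proof.
move=> hu; have hn j : S (fun t => (j < D)%N -> ~ u t j).
  case: (ltnP j D) => jD; last by apply: (@salg_ext _ S (fun=> True)) (salgT hS) => t; split.
  by apply: (@salg_ext _ S (fun t => ~ u t j)) (salg_not hS (hu j jD)) => t;
    split=> [h _|h]; [exact: h|exact: (h isT)].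
apply: (salg_or hS); last first.
  by apply: (salg_and hS); [exact: (salg_const hS)|exact: (salg_allc hS)].
case: (ltnP k D) => kD; last first.
  by apply: (@salg_ext _ S (fun=> False)) (salg_const hS False) => t; split=> // -[].
apply: (salg_and hS); first exact: (salg_const hS).
apply: (salg_and hS); first exact: hu.
apply: (salg_allc hS) => j; case: (ltnP j k) => jk; last first.
  by apply: (@salg_ext _ S (fun=> True)) (salgT hS) => t; split.
apply: (@salg_ext _ S (fun t => ~ u t j)) (salg_not hS (hu j (ltn_trans jk kD))) => t.
by split=> [h _|h]; [exact: h|exact: (h isT)].
Qed.
End ColMea.

Lemma cylB_mea (T : Type) (S : set (set T)) (x : T -> X) m : salg S -> mea S x -> S (fun t => cylB m (x t)).
Proof. by move=> hS hx; apply: (mea_borel hS hx); apply: borel_open; exact: cylB_open. Qed.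

Lemma section_mea (T : Type) (S : set (set T)) (d : T -> baire_space) j : mea S d ->
  mea S (fun t => code_section (d t) j).
Proof. by move=> hd n k; exact: hd. Qed.

Lemma den_pull d x (w : natp (nat * seq nat)) :
  (forall j, (j < D)%N -> wfc (code_section d j)) ->
  (forall j, (j < D)%N -> okv cylB (code_section d j) x (fun s => w (j, s))) ->
  forall k, color_of (dcol d x) k <-> color_of (fun j => w (j, [::]) <> 0%N) k.
Proof.
move=> wf hw k; have e j : (j < D)%N -> dcol d x j <-> w (j, [::]) <> 0%N.
  by move=> jD; exact: (denP (wf j jD) (hw j jD)).
by split; apply: color_of_ext => j /e ej; split=> /ej.
Qed.

Lemma val_ex d x : (forall j, (j < D)%N -> wfc (code_section d j)) ->
  exists w : natp (nat * seq nat),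
    forall j, (j < D)%N -> okv cylB (code_section d j) x (fun s => w (j, s)).
Proof.
move=> wf; have h j : exists v, (j < D)%N -> okv cylB (code_section d j) x v.
  case: (ltnP j D) => jD; last by exists (fun=> 0%N).
  by have [A /(okv_ex x)[v hv]] := wfc_code cylB (wf j jD); exists v.
by have [v hv] := choice h; exists (fun p => v p.1 p.2).
Qed.

(** With the two vertices and their truth tables guessed, a conflict becomes a countable condition.
    Tables exist only for well-founded codes, but otherwise the first alternative of [bad] already
    holds. *)
Lemma bad_sig (T : topologicalType) (d : T -> baire_space) (G : T -> X -> X -> Prop) :
  mea (@bian T) d ->
  sigma11 (fun q : T * (natp I * natp I) => G q.1 q.2.1 q.2.2) ->
  sigma11 (fun t => bad (G t) (d t)).
Proof.
move=> hd hG.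
(* One element of this power holds both vertices and both truth tables, so that a single projection
   suffices. *)
pose K : countType := (I + I + (nat * seq nat + nat * seq nat))%type.
pose xa (r : natp K) : natp I := pull (fun i => inl (inl i)) r.
pose xb (r : natp K) : natp I := pull (fun i => inl (inr i)) r.
pose wa (r : natp K) : natp (nat * seq nat) := pull (fun i => inr (inl i)) r.
pose wb (r : natp K) : natp (nat * seq nat) := pull (fun i => inr (inr i)) r.
have ca : continuous xa by exact: cts_pull. have cb : continuous xb by exact: cts_pull.
have cwa : continuous wa by exact: cts_pull. have cwb : continuous wb by exact: cts_pull.
pose ok t r := forall j, (j < D)%N -> okv cylB (code_section (d t) j) (xa r) (fun s => wa r (j, s)) /\
  okv cylB (code_section (d t) j) (xb r) (fun s => wb r (j, s)).
pose P (q : T * natp K) := G q.1 (xa q.2) (xb q.2) /\ (ok q.1 q.2 /\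
  exists k, color_of (fun j => wa q.2 (j, [::]) <> 0%N) k /\ color_of (fun j => wb q.2 (j, [::]) <> 0%N) k).
rewrite (_ : (fun t => _) = (fun t => (exists j, (j < D)%N /\ ~ wfc (code_section (d t) j)) \/
   exists r, P (t, r))); last first.
  apply/predeqP => t; have [h|h] := pselect (exists j, (j < D)%N /\ ~ wfc (code_section (d t) j)).
    by split=> _; left.
  have wf j : (j < D)%N -> wfc (code_section (d t) j).
    by move=> jD; apply: contrapT => n; apply: h; exists j.
  split=> -[//|]; right.
    case: b => x [x' [Gx [k [k1 k2]]]].
    have [w hw] := val_ex x wf; have [w' hw'] := val_ex x' wf.
    exists (fun i => match i with inl (inl i) => x i | inl (inr i) => x' i
                     | inr (inl i) => w i | inr (inr i) => w' i end).
    split=> //; split; first by move=> j jD; split; [exact: hw|exact: hw'].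
    by exists k; split; [exact/(den_pull wf hw)|exact/(den_pull wf hw')].
  case: b => r [/= Gr [okr [k [k1 k2]]]]; exists (xa r), (xb r); split=> //; exists k; split.
    by apply/(den_pull (w := wa r) wf) => // j /okr[].
  by apply/(den_pull (w := wb r) wf) => // j /okr[].
apply: sig_or.
  apply: sig_bigU => j; apply: sig_and.
    by have [] := salg_const (bian_salg T) (j < D)%N.
  by apply: nwfc_sig; exact: section_mea.
apply: sig_proj; apply: sig_and.
  apply: (@sig_pre _ _ (fun q : T * natp K => (q.1, (xa q.2, xb q.2)))) hG.
  apply: cts_pair; first exact: cts_fst.
  by apply: cts_pair; [exact: (cts_comp (@cts_snd _ _) ca)|exact: (cts_comp (@cts_snd _ _) cb)].
suff [] : bian (fun q : T * natp K => ok q.1 q.2 /\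
  exists k, color_of (fun j => wa q.2 (j, [::]) <> 0%N) k /\ color_of (fun j => wb q.2 (j, [::]) <> 0%N) k) by [].
have hS := bian_salg (T * natp K)%type.
have m1 : mea (@bian (T * natp K)%type) (fun q => d q.1) := @bian_mea_fst T (natp K) nat d hd.
have mxa : mea (@bian (T * natp K)%type) (fun q => xa q.2) by apply: bian_mea; exact: (cts_comp (@cts_snd _ _) ca).
have mxb : mea (@bian (T * natp K)%type) (fun q => xb q.2) by apply: bian_mea; exact: (cts_comp (@cts_snd _ _) cb).
have mwa : mea (@bian (T * natp K)%type) (fun q => wa q.2) by apply: bian_mea; exact: (cts_comp (@cts_snd _ _) cwa).
have mwb : mea (@bian (T * natp K)%type) (fun q => wb q.2) by apply: bian_mea; exact: (cts_comp (@cts_snd _ _) cwb).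
apply: (salg_and hS).
  apply: (salg_allc hS) => j; apply: (salg_imp hS); first exact: (salg_const hS).
  have ms := section_mea j m1.
  apply: (salg_and hS).
    by apply: (okv_mea hS ms); [move=> s k; exact: mwa|move=> m; exact: cylB_mea].
  by apply: (okv_mea hS ms); [move=> s k; exact: mwb|move=> m; exact: cylB_mea].
apply: (salg_ex hS) => k; apply: (salg_and hS); apply: (color_of_mea hS) => j _;
  by apply: (salg_not hS).
Qed.

Lemma notbad_color G d : ~ bad G d -> exists c : X -> nat,
  [/\ forall k, borel (fun x => c x = k), forall x, (c x < D)%N,
      forall x k, c x = k <-> color_of (dcol d x) k & forall x x', G x x' -> c x <> c x'].
Proof.
move=> nb; have wf j : (j < D)%N -> wfc (code_section d j).
  by move=> jD; apply: contrapT => n; apply: nb; left; exists j.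
have [c hc] := choice (fun x => color_of_ex (dcol d x)).
have e x k : c x = k <-> color_of (dcol d x) k.
  by split=> [<-//|h]; exact: (color_of_uniq (hc x) h).
have hS := borel_salg X; exists c; split=> // [k|x|x x' Gx ecc].
- apply: (@salg_ext _ (@borel X) (fun x => color_of (dcol d x) k)); first by move=> x; rewrite e.
  apply: (color_of_mea hS) => j jD; have [A hA] := wfc_code cylB (wf j jD).
  apply: (@salg_ext _ (@borel X) A); last exact: (code_borel cylB_open hA).
  by move=> x; rewrite /dcol (den_code hA).
- exact: color_of_lt (hc x).
- by apply: nb; right; exists x, x'; split=> //; exists (c x); split=> //; rewrite ecc.
Qed.

Lemma borel_coded A : borel A -> exists c, borel_code cylB c A.
Proof.
move=> bA; have : coded cylB (fun p : baire_space * X => A p.2).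
  apply: (borel_min (salg_pre snd (coded_salg cylB)) _ bA) => O oO.
  apply: coded_open => x Ox; have [|c [cx cO]] := @cyl_nbhs I O x; first exact: open_nbhs_nbhs.
  by exists (pickle c); rewrite /cylB pickleK.
by move=> [f [_ /(_ (fun=> 0%N))]]; exists (f (fun=> 0%N)).
Qed.

Lemma color_notbad G (c : X -> nat) : (forall k, borel (fun x => c x = k)) ->
  (forall x, (c x < D)%N) -> (forall x x', G x x' -> c x <> c x') -> exists d, ~ bad G d.
Proof.
move=> bc cD cG; have [f hf] := choice (fun j => borel_coded (bc j)).
have [d hd] := @pull_surj (nat * nat)%type nat pickle (fun p => f p.1 p.2) (pcan_inj pickleK).
have es j : code_section d j = f j.
  by apply/funext => n; rewrite -[LHS]/(pull pickle d (j, n)) hd.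
have e x k : color_of (dcol d x) k -> c x = k.
  have ej j : dcol d x j <-> c x = j by rewrite /dcol es (den_code (hf j)).
  by case=> [[_ [/ej]]|[-> /(_ _ (cD x))[]]]//; exact/ej.
exists d => -[[j [_]]|[x [x' [Gx [k [/e e1 /e e2]]]]]].
  by rewrite es; apply; exact: (code_wfc (hf j)).
by apply: (cG _ _ Gx); rewrite e1 e2.
Qed.

End Colorings.

(** * The complexity of the set of codes *)

Section Upper.
Variables (D : nat) (U : nat -> set (vtx D * vtx D)).
Hypotheses (D0 : (0 < D)%N) (oU : forall m, open (U m)).
Local Notation X := (vtx D).
Local Notation Hg := (@walk_graph D).
Implicit Types (c d : baire_space) (x : X).

Definition small_codes : set baire_space :=
  [set c | exists G, [/\ borel_code U c G, borel_subgraph G Hg & cc_lt (chi_B G) (Fin D.+1)]].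

Lemma colorable_small (G : set (X * X)) : cc_lt (chi_B G) (Fin D.+1) <->
  exists c : X -> nat, [/\ forall k, borel (fun x => c x = k), forall x, (c x < D)%N &
    forall x x', G (x, x') -> c x <> c x'].
Proof.
rewrite /chi_B chromatic_ltP//; split=> -[c [h1 h2 h3]]; exists c; split=> //.
- by move=> k; exact: (h2 [set k]).
- by move=> A; exact: (salg_fiber (borel_salg X) A h1).
Qed.

Definition coded_edge c x x' : Prop := exists v : natp (seq nat), okv U c (x, x') v /\ v [::] <> 0%N.

(** Irreflexivity is inherited from the ambient graph, so only symmetry and inclusion can fail. That
    the reverse edge is absent is expressed by a table with value zero, to keep the condition
    analytic. *)
Definition not_subgraph c : Prop := exists x x', coded_edge c x x' /\
  ((exists v : natp (seq nat), okv U c (x', x) v /\ v [::] = 0%N) \/ ~ Hg (x, x')).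

Definition small_witness (q : baire_space * baire_space) : Prop :=
  ~ (~ wfc q.1 \/ (not_subgraph q.1 \/ bad D (coded_edge q.1) q.2)).

Lemma coded_edgeE c G : borel_code U c G -> coded_edge c = fun x x' => G (x, x').
Proof.
move=> hG; apply/funext => x; apply/funext => x'; apply/propext; split.
  by move=> [v [hv vn]]; exact/(okv_val hG hv).
by move=> Gx; have [v hv] := okv_ex (x, x') hG; exists v; split=> //; exact/(okv_val hG hv).
Qed.

(** A Borel coloring is replaced by a real that codes it, which leaves one existential quantifier in
    front of a coanalytic condition. *)
Lemma small_codesE : small_codes = fst @` [set q | small_witness q].
Proof.
apply/predeqP => c; split.
  move=> [G [hG [[bG sG _] GH] /colorable_small[k [bk kD kG]]]].
  have [d hd] := @color_notbad (idx D) D (fun x x' => G (x, x')) k bk kD kG.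
  exists (c, d) => //; rewrite /small_witness /= (coded_edgeE hG); case; first by case; exact: code_wfc hG.
  case=> // -[x [x' []]]; rewrite (coded_edgeE hG) => Gx []; last by apply; exact: GH.
  by move=> [v [/(okv_val hG) hv v0]]; apply: (hv.2 (sG _ _ Gx)).
move=> [[c' d] /= nw <-]; have wf : wfc c' by apply: contrapT => n; apply: nw; left.
have [G hG] := wfc_code U wf; move: nw; rewrite /small_witness /= => nw; exists G.
have GH : G `<=` Hg.
  move=> [x x'] Gx; apply: contrapT => nH; apply: nw; right; left; exists x, x'.
  by rewrite (coded_edgeE hG); split=> //; right.
split=> //.
  split=> //; split; first exact: (code_borel oU hG).
    move=> x x' Gx; apply: contrapT => nG; apply: nw; right; left; exists x, x'.
    rewrite (coded_edgeE hG); split=> //; left; have [v hv] := okv_ex (x', x) hG.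
    by exists v; split=> //; apply: contrapT => /(okv_val hG hv).
  by move=> x /GH; exact: H_irr.
apply/colorable_small; have [|k [h1 h2 _ h4]] := @notbad_color (idx D) D D0 (coded_edge c') d.
  by move=> b; apply: nw; right; right.
by exists k; split=> // x x' Gx; apply: h4; rewrite (coded_edgeE hG).
Qed.

Lemma edge_bian (T : topologicalType) (c : T -> baire_space) (x x' : T -> X)
    (v : T -> natp (seq nat)) : mea (@bian T) c -> mea (@bian T) x -> mea (@bian T) x' ->
  mea (@bian T) v -> bian (fun t => okv U (c t) (x t, x' t) (v t)).
Proof.
move=> hc hx hx' hv; have hS := bian_salg T; apply: (okv_mea hS hc hv) => m.
by apply: (mea_borel2 hS hx hx'); exact: borel_open.
Qed.

Lemma coded_edge_sig (T : topologicalType) (c : T -> baire_space) (x x' : T -> X) :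
  mea (@bian T) c -> mea (@bian T) x -> mea (@bian T) x' ->
  sigma11 (fun t => coded_edge (c t) (x t) (x' t)).
Proof.
move=> hc hx hx'; apply: (@sig_proj T (seq nat : countType)
  (fun q => okv U (c q.1) (x q.1, x' q.1) q.2 /\ q.2 [::] <> 0%N)).
have m2 : mea (@bian (T * natp (seq nat))%type) snd by apply: bian_mea; exact: cts_snd.
suff [] : bian (fun q : T * natp (seq nat) => okv U (c q.1) (x q.1, x' q.1) q.2 /\ q.2 [::] <> 0%N) by [].
have hS := bian_salg (T * natp (seq nat))%type; apply: (salg_and hS); last exact: (salg_not hS).
by apply: edge_bian => //; apply: bian_mea_fst.
Qed.

Lemma small_witness_pi : pi11 [set q | small_witness q].
Proof.
pose T : topologicalType := (baire_space * baire_space)%type.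
have m1 : mea (@bian T) fst by apply: (@bian_mea T nat); exact: cts_fst.
have m2 : mea (@bian T) snd by apply: (@bian_mea T nat); exact: cts_snd.
rewrite /pi11 (_ : ~` _ = fun q : T => ~ wfc q.1 \/ (not_subgraph q.1 \/ bad D (coded_edge q.1) q.2)).
  apply: sig_or; first exact: nwfc_sig.
  apply: sig_or; last first.
    apply: (@bad_sig (idx D) D T snd (fun q => coded_edge q.1)) => //.
    apply: coded_edge_sig.
    - exact: (@bian_mea_fst T (X * X)%type nat fst m1).
    - by apply: bian_mea; apply: (cts_comp (@cts_snd T (X * X)%type)); exact: cts_fst.
    - by apply: bian_mea; apply: (cts_comp (@cts_snd T (X * X)%type)); exact: cts_snd.
  pose T2 : topologicalType := (T * natp (idx D) * natp (idx D))%type.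
  have n1 : mea (@bian T2) (fun q => q.1.1.1).
    exact: (@bian_mea_fst _ (natp (idx D)) nat (fun q => q.1.1) (@bian_mea_fst T (natp (idx D)) nat fst m1)).
  have n2 : mea (@bian T2) (fun q => q.1.2).
    by apply: bian_mea; apply: (cts_comp (@cts_fst _ _)); exact: cts_snd.
  have n3 : mea (@bian T2) (fun q => q.2) by apply: bian_mea; exact: cts_snd.
  suff h : sigma11 (fun q : T2 => coded_edge q.1.1.1 q.1.2 q.2 /\
      ((exists v : natp (seq nat), okv U q.1.1.1 (q.2, q.1.2) v /\ v [::] = 0%N) \/ ~ Hg (q.1.2, q.2))).
    apply: (@sig_proj T (idx D) (fun q => exists x', coded_edge q.1.1 q.2 x' /\
      ((exists v : natp (seq nat), okv U q.1.1 (x', q.2) v /\ v [::] = 0%N) \/ ~ Hg (q.2, x')))).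
    exact: (@sig_proj (T * natp (idx D))%type (idx D) _ h).
  apply: sig_and; first exact: coded_edge_sig.
  apply: sig_or; last first.
    have hS := bian_salg T2; have [_] := mea_borel2 hS n2 n3 (@H_borel D); exact.
  apply: (@sig_proj T2 (seq nat : countType)
    (fun q => okv U q.1.1.1.1 (q.1.2, q.1.1.2) q.2 /\ q.2 [::] = 0%N)).
  have k2 : mea (@bian (T2 * natp (seq nat))%type) snd by apply: bian_mea; exact: cts_snd.
  suff [] : bian (fun q : T2 * natp (seq nat) => okv U q.1.1.1.1 (q.1.2, q.1.1.2) q.2 /\ q.2 [::] = 0%N) by [].
  have hS := bian_salg (T2 * natp (seq nat))%type; apply: (salg_and hS) => //.
  apply: edge_bian => //.
  - exact: (@bian_mea_fst T2 (natp (seq nat)) nat _ n1).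
  - exact: (@bian_mea_fst T2 (natp (seq nat)) (idx D) _ n3).
  - exact: (@bian_mea_fst T2 (natp (seq nat)) (idx D) _ n2).
by apply/predeqP => q; split=> [/contrapT|h n]; [|exact: n].
Qed.

Lemma small_codes_sigma12 : sigma12 small_codes.
Proof. by exists [set q | small_witness q]; [exact: small_witness_pi|exact: small_codesE]. Qed.

End Upper.

(** * Trees of approximations *)

Lemma nth_pre0 (b : nat -> nat) m n : (m < n)%N -> nth 0%N (pre b n) m = b m.
Proof. exact: nth_mkseq. Qed.

Lemma eq_pre (x y : nat -> nat) n : (forall k, (k < n)%N -> x k = y k) -> pre x n = pre y n.
Proof.
by elim: n => [//|n IH] h; rewrite !preS h// IH// => k kn; apply: h; exact: ltnW.
Qed.

Lemma pre_eq (x y : nat -> nat) m n : (m < n)%N -> pre x n = pre y n -> x m = y m.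
Proof. by move=> mn e; rewrite -(nth_pre0 x mn) e nth_pre0. Qed.

Section ClosedTree.
Variables (W : topologicalType) (ap : nat -> W -> W -> Prop) (F : set (W * baire_space)).
Hypotheses (apW : forall m n w w', (m <= n)%N -> ap n w w' -> ap m w w')
  (ap_refl : forall n w, ap n w w)
  (ap_open : forall (O : set W) w, open O -> O w -> exists n, forall w', ap n w w' -> O w')
  (cF : closed F).

(** A tree whose branches are the section of [F] at [w]. A node asks only for some point of [F] near
    by, so its condition on [w] involves finitely much of [w]; since [F] is closed, the
    approximations converge into [F]. *)
Definition tr (w : W) (t : seq nat) : Prop :=
  exists p, [/\ F p, ap (size t) w p.1 & pre p.2 (size t) = t].

Lemma tr_take w t m : tr w t -> tr w (take m t).
Proof.
have [mt|tm] := leqP m (size t); last by rewrite take_oversize// ltnW.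
move=> [p [Fp a e]]; exists p; rewrite size_takel//; split=> //; first exact: apW a.
by rewrite -[in RHS]e take_pre.
Qed.

Lemma tr_branch w (b : baire_space) : (forall n, tr w (pre b n)) <-> F (w, b).
Proof.
split=> [h|Fwb n]; last by exists (w, b); rewrite size_pre; split.
apply: contrapT => nF; have oF : open (~` F) by apply: closed_openC.
have : nbhs (w, b) (~` F) by apply: open_nbhs_nbhs; split.
move=> [[A1 A2] [/= n1 n2] sA].
have [V [oV Vw] VA] : exists2 V, open_nbhs w V & V `<=` A1 by move: n1; rewrite nbhsE.
have [k1 hk1] := ap_open oV Vw.
have [J hJ] := (@nbhs_cyl nat b A2).1 n2.
pose k2 := (\max_(j <- J) j).+1.
have [p [Fp]] := h (k1 + k2)%N; rewrite size_pre => a e.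
apply: (sA p _ Fp); split.
  by apply: VA; apply: hk1; apply: apW a; exact: leq_addr.
apply: hJ => j jJ; apply: (pre_eq _ e); apply: leq_trans (leq_addl _ _); rewrite /k2 ltnS.
exact: (@leq_bigmax_seq _ J xpredT id).
Qed.

End ClosedTree.

Section WfTree.
Variable P : seq nat -> Prop.
Hypotheses (P_take : forall t m, P t -> P (take m t))
  (P_wf : forall b : nat -> nat, ~ forall n, P (pre b n)).

Definition child (t' t : seq nat) : Prop := P t' /\ exists j, t' = rcons t j.

Lemma child_acc t : Acc child t.
Proof.
apply: contrapT => nA.
have step u : exists j, ~ Acc child u -> P (rcons u j) /\ ~ Acc child (rcons u j).
  have [a|na] := pselect (Acc child u); first by exists 0%N.
  apply: contrapT => no; apply: na; constructor => u' [Pu' [j ej]].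
  by apply: contrapT => na'; apply: no; exists j => _; rewrite -ej.
have [f hf] := choice step.
pose st := fix st k := if k is k'.+1 then rcons (st k') (f (st k')) else t.
have hst k : ~ Acc child (st k) by elim: k => [//|k IH]; case: (hf _ IH).
have Pst k : P (st k.+1) by case: (hf _ (hst k)).
pose b n := nth 0%N (st n.+1) n.
have sst k : size (st k) = (size t + k)%N.
  by elim: k => [|k IH]; rewrite ?addn0//= size_rcons IH addnS.
have tst k l : take (size (st k)) (st (k + l)) = st k.
  elim: l => [|l IH]; first by rewrite addn0 take_size.
  by rewrite addnS /= take_rcons_le// !sst leq_add2l leq_addr.
have tst' k l : (k <= l)%N -> take (size (st k)) (st l) = st k.
  by move=> kl; rewrite -(subnKC kl) tst.
apply: (P_wf (b := b)) => n.
suff -> : pre b n = take n (st n.+1) by apply: P_take; exact: Pst.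
apply: (@eq_from_nth _ 0%N).
  rewrite size_pre size_takel// sst; exact: leq_trans (leqnSn n) (leq_addl _ _).
move=> k; rewrite size_pre => kn; rewrite nth_pre0// nth_take//.
rewrite /b -(tst' k.+1 n.+1 (leqW kn)) nth_take//.
by rewrite sst addnS ltnS leq_addl.
Qed.

(** Well-founded induction bounds the lengths above a node [u]: only its children [j] with
    [j <= z (size u)] matter, and these are finitely many. *)
Lemma koenig (z : nat -> nat) : ~ forall n, exists t,
  [/\ size t = n, P t & forall k, (k < n)%N -> (nth 0%N t k <= z k)%N].
Proof.
move=> h; pose Q u n := exists t, [/\ size t = n, P t,
  forall k, (k < n)%N -> (nth 0%N t k <= z k)%N & take (size u) t = u].
have down u m n : (size u <= m)%N -> (m <= n)%N -> Q u n -> Q u m.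
  move=> um mn [t [st Pt tz tu]]; exists (take m t); rewrite size_takel ?st//; split=> //.
  - exact: P_take.
  - by move=> k km; rewrite nth_take//; apply: tz; exact: leq_trans km mn.
  - by rewrite take_takel.
suff key u : exists n, (size u <= n)%N /\ ~ Q u n.
  have [n [_]] := key [::]; apply; have [t [st Pt tz]] := h n.
  by exists t; split=> //; rewrite take0.
have := child_acc u; elim=> {}u _ IH.
have {}IH j : exists n, (size u < n)%N /\ ~ Q (rcons u j) n.
  have [Pj|nPj] := pselect (P (rcons u j)).
    by have [|n [l nq]] := IH (rcons u j); [split=> //; exists j|exists n; rewrite size_rcons in l].
  exists (size u).+1; split=> // -[t [st Pt _]]; rewrite size_rcons => e.
  by apply: nPj; rewrite -e; exact: P_take.
have [f hf] := choice IH; pose n := \max_(j < (z (size u)).+1) f j.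
have un : (size u < n)%N.
  by apply: leq_trans (leq_bigmax ord0); case: (hf (@ord0 (z (size u)))).
exists n; split; first exact: ltnW.
move=> [t [st Pt tz tu]]; pose j := nth 0%N t (size u).
have jz : (j < (z (size u)).+1)%N by rewrite ltnS; exact: tz.
have [l nq] := hf j; apply: nq; apply: (@down _ _ n).
- by rewrite size_rcons.
- exact: (leq_bigmax (Ordinal jz)).
- by exists t; split=> //; rewrite size_rcons (take_nth 0%N) ?st// tu.
Qed.

End WfTree.

(** * Level-preserving maps of trees *)

Section Emb.
Variable P : seq nat -> Prop.
Hypothesis P_take : forall t m, P t -> P (take m t).

Inductive emb (R : seq nat -> Prop) (t r : seq nat) : Prop :=
  Emb of forall j, P (rcons t j) -> exists m, R (rcons r m) /\ emb R (rcons t j) (rcons r m).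

Lemma embP R t r : emb R t r <->
  forall j, P (rcons t j) -> exists m, R (rcons r m) /\ emb R (rcons t j) (rcons r m).
Proof. by split=> [[]|] // h; constructor. Qed.

Lemma emb_branch (R : seq nat -> Prop) (b : nat -> nat) : (forall n, R (pre b n)) ->
  forall t, Acc (child P) t -> emb R t (pre b (size t)).
Proof.
move=> hb t; elim=> {}t _ IH; constructor => j Pj; exists (b (size t)); rewrite -preS; split=> //.
have := IH (rcons t j) (conj Pj (ex_intro _ j erefl)); rewrite size_rcons; exact.
Qed.

(** The least suitable extension is taken so that the map depends on [R] in a Borel way. *)
Definition least_ext (R : seq nat -> Prop) t j r : nat :=
  xget 0%N [set m | (R (rcons r m) /\ emb R (rcons t j) (rcons r m)) /\
    forall m', (m' < m)%N -> ~ (R (rcons r m') /\ emb R (rcons t j) (rcons r m'))].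

Definition enc R t : seq nat :=
  (foldl (fun p j => (rcons p.1 j, rcons p.2 (least_ext R p.1 j p.2))) ([::], [::]) t).2.

Lemma enc_rcons R t j : enc R (rcons t j) = rcons (enc R t) (least_ext R t j (enc R t)).
Proof.
rewrite /enc foldl_rcons /=; set p := foldl _ _ t.
suff -> : p.1 = t by [].
by rewrite /p; elim/last_ind: t {p} => [//|t i IH]; rewrite foldl_rcons /= IH.
Qed.

Lemma size_enc R t : size (enc R t) = size t.
Proof. by elim/last_ind: t => [//|t j IH]; rewrite enc_rcons !size_rcons IH. Qed.

Lemma enc_ok R t : R [::] -> emb R [::] [::] -> P t -> R (enc R t) /\ emb R t (enc R t).
Proof.
move=> R0 e0; elim/last_ind: t => [//|t j IH] Pt.
have [] := IH; first by have := P_take (size t) Pt; rewrite -cats1 take_size_cat.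
move=> _ /embP /(_ j Pt) [m hm]; rewrite enc_rcons /least_ext.
have ex : exists m, `[< R (rcons (enc R t) m) /\ emb R (rcons t j) (rcons (enc R t) m) >].
  by exists m; exact/asboolP.
case: xgetP => [k _ []//|]; case: (ex_minnP ex) => k /asboolP hk mk /(_ k)[]; split=> // m' mk' hm'.
by have := mk m' (introT (asboolP _) hm'); rewrite leqNgt mk'.
Qed.

Section Mea.
Context {T : Type} (S : set (set T)) (R : T -> seq nat -> Prop).
Hypotheses (hS : salg S) (hR : forall r, S (fun t => R t r)) (acc : forall t, Acc (child P) t).

(** The recursion runs along the well-founded tree [P], which does not vary with the parameter; only
    [R] does, and each stage is a countable operation. *)
Lemma emb_mea u r : S (fun t => emb (R t) u r).
Proof.
elim: (acc u) r => {}u _ IH r; apply: (@salg_ext _ S (fun t => forall j, P (rcons u j) ->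
  exists m, R t (rcons r m) /\ emb (R t) (rcons u j) (rcons r m))).
  by move=> t; exact: iff_sym (embP _ _ _).
apply: (salg_allc hS) => j; have [Pj|nP] := pselect (P (rcons u j)); last first.
  by apply: (@salg_ext _ S (fun=> True)) (salgT hS) => t; split.
apply: (salg_imp hS); first exact: (salg_const hS).
by apply: (salg_ex hS) => m; apply: (salg_and hS) => //; apply: IH; split=> //; exists j.
Qed.

Lemma least_ext_mea u j r m : S (fun t => least_ext (R t) u j r = m).
Proof.
pose Q t m := R t (rcons r m) /\ emb (R t) (rcons u j) (rcons r m).
have hQ k : S (fun t => Q t k) by apply: (salg_and hS) => //; exact: emb_mea.
have hL k : S (fun t => Q t k /\ forall m', (m' < k)%N -> ~ Q t m').
  apply: (salg_and hS) => //; apply: (salg_allc hS) => m'.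
  by apply: (salg_imp hS); [exact: (salg_const hS)|exact: (salg_not hS)].
apply: (@salg_ext _ S (fun t => (Q t m /\ forall m', (m' < m)%N -> ~ Q t m') \/
  (m = 0%N /\ forall k, ~ (Q t k /\ forall m', (m' < k)%N -> ~ Q t m')))).
  move=> t; rewrite /least_ext -/(Q t); case: xgetP => [k _ [Qk mk]|no]; split.
  - case=> [[Qm mm]|[_ /(_ k)[]]//]; by have [/mm|/mk|] := ltngtP k m.
  - by move=> <-; left.
  - by case=> [/no|[->]].
  - by move=> <-; right; split=> // k; exact: no.
apply: (salg_or hS) => //; apply: (salg_and hS); first exact: (salg_const hS).
by apply: (salg_allc hS) => k; exact: (salg_not hS).
Qed.

Lemma enc_mea u r : S (fun t => enc (R t) u = r).
Proof.
elim/last_ind: u r => [|u j IH] r; first exact: (salg_const hS ([::] = r)).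
apply: (@salg_ext _ S (fun t => exists q m, enc (R t) u = q /\ (least_ext (R t) u j q = m /\ r = rcons q m))).
  move=> t; rewrite enc_rcons; split=> [[q [m [-> [-> ->]]]]//|<-].
  by exists (enc (R t) u), (least_ext (R t) u j (enc (R t) u)).
apply: (salg_exc hS) => q; apply: (salg_exc hS) => m; apply: (salg_and hS) => //.
by apply: (salg_and hS); [exact: least_ext_mea|exact: (salg_const hS)].
Qed.

End Mea.
End Emb.

(** * The tree of attempts *)

Notation scode := CodeSeq.code.

(** Codes dominate lengths: a node that is due at stage [scode u] consults only entries with smaller
    numbers. Both the attempts and the self-reference rest on this. *)
Lemma size_scode (t : seq nat) : (size t <= scode t)%N.
Proof.
elim: t => [//|n t IH] /=; apply: leq_trans (_ : (scode t).*2.+1 <= _)%N.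
  by rewrite ltnS -addnn; apply: leq_trans IH (leq_addr _ _).
by rewrite -[X in (X <= _)%N]mul1n leq_mul// expn_gt0.
Qed.

Definition dec (m : nat) : nat * seq nat := odflt (0%N, [::]) (unpickle m).

Lemma decK p : dec (pickle p) = p.
Proof. by rewrite /dec pickleK. Qed.

Section Attempts.
Variables (TT : (nat -> nat) -> seq nat -> Prop) (R : seq nat -> Prop).
Hypothesis TT_ext : forall x y t, (forall k, (k < size t)%N -> x k = y k) -> TT x t -> TT y t.
Implicit Types (t u : seq nat) (b x : nat -> nat).

Definition guess t : nat -> nat := fun k => (dec (nth 0%N t k)).1.
Definition image t (k : nat) : seq nat := (dec (nth 0%N t k)).2.

(* A node records an initial segment of a real [x] together with a
   level-preserving map, defined on the first few nodes of the tree [TT x],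
   into [R]. *)
Definition attempt t : Prop := forall u, (scode u < size t)%N -> TT (guess t) u ->
  [/\ R (image t (scode u)), size (image t (scode u)) = size u &
    forall u' j, u = rcons u' j -> (scode u' < size t)%N ->
      image t (scode u') = take (size u') (image t (scode u))].

Lemma attempt_take t m : attempt t -> attempt (take m t).
Proof.
have [mt|tm] := leqP m (size t); last by rewrite take_oversize// ltnW.
have im k : (k < m)%N -> image (take m t) k = image t k by move=> km; rewrite /image nth_take.
move=> h u; rewrite size_takel// => um Tu; have ut := leq_trans um mt.
have [|h1 h2 h3] := h u ut.
  apply: TT_ext Tu => k ku; rewrite /guess nth_take//.
  exact: leq_ltn_trans (leq_trans (ltnW ku) (size_scode u)) um.
rewrite !im//; split=> // u' j eu u'm; rewrite im//; apply: (h3 u' j eu).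
exact: leq_trans u'm mt.
Qed.

(** A branch of attempts gives a real and a map defined on its whole tree [TT]; a branch of that
    tree is mapped to a branch of [R]. *)
Lemma attempt_branch b (b' : nat -> nat) : (forall n, attempt (pre b n)) ->
  (forall n, TT (fun k => (dec (b k)).1) (pre b' n)) -> exists c : nat -> nat, forall n, R (pre c n).
Proof.
move=> hb hT; pose e n := (dec (b (scode (pre b' n)))).2.
have key n : [/\ R (e n), size (e n) = n & e n = take n (e n.+1)].
  pose N := (maxn (scode (pre b' n)) (scode (pre b' n.+1))).+1.
  have im k : (k < N)%N -> image (pre b N) k = (dec (b k)).2.
    by move=> kN; rewrite /image nth_pre0.
  have l1 : (scode (pre b' n) < N)%N by rewrite ltnS leq_maxl.
  have l2 : (scode (pre b' n.+1) < N)%N by rewrite ltnS leq_maxr.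
  have Tg m : (scode (pre b' m) < N)%N -> TT (guess (pre b N)) (pre b' m).
    move=> mN; apply: TT_ext (hT m) => k; rewrite size_pre => km; rewrite /guess nth_pre0//.
    apply: leq_ltn_trans mN; apply: leq_trans (size_scode _); rewrite size_pre; exact: ltnW.
  have := hb N (pre b' n); rewrite size_pre => /(_ l1 (Tg n l1)); rewrite im// => -[h1 h2 _].
  have := hb N (pre b' n.+1); rewrite size_pre => /(_ l2 (Tg n.+1 l2)); rewrite im// => -[_ _].
  move=> /(_ (pre b' n) (b' n) (preS _ _) l1); rewrite !im// size_pre => h3.
  by split=> //; rewrite size_pre in h2.
exists (fun n => nth 0%N (e n.+1) n) => n.
suff -> : pre (fun n => nth 0%N (e n.+1) n) n = e n by case: (key n).
elim: n => [|n IH]; first by have [_ /size0nil ->] := key 0%N.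
have [_ s _] := key n.+1; have [_ _ t] := key n.
by rewrite preS IH t -(take_nth 0%N) ?s// take_oversize ?s.
Qed.

Lemma attempt_enc x (P := TT x) : (forall t m, P t -> P (take m t)) -> R [::] ->
  emb P R [::] [::] ->
  forall n, attempt (pre (fun k => pickle (x k, enc P R (CodeSeq.decode k))) n).
Proof.
move=> Pt R0 e0 n; set b := fun k => _ => u; rewrite size_pre => un Tu.
have im k : (k < n)%N -> image (pre b n) k = enc P R (CodeSeq.decode k).
  by move=> kn; rewrite /image nth_pre0// decK.
have Pu : P u.
  apply: TT_ext Tu => k ku; rewrite /guess nth_pre0 ?decK//.
  exact: leq_ltn_trans (leq_trans (ltnW ku) (size_scode u)) un.
rewrite im// CodeSeq.codeK size_enc; split=> //; first by case: (enc_ok Pt R0 e0 Pu).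
move=> u' j -> u'n; rewrite im// CodeSeq.codeK enc_rcons.
by rewrite take_rcons_le ?size_enc// take_oversize ?size_enc.
Qed.

End Attempts.

(** [Q y t] depends only on values of [y] below [size t], and [size t <= scode t], so [y] can be
    defined by recursion on codes. *)
Lemma self_reference (Q : (nat -> nat) -> seq nat -> Prop) :
  (forall y y' t, (forall k, (k < size t)%N -> y k = y' k) -> Q y t -> Q y' t) ->
  exists y : nat -> nat, forall t, y (scode t) <> 0%N <-> Q y t.
Proof.
move=> hQ; pose nx (s : seq nat) : nat := `[< Q (nth 0%N s) (CodeSeq.decode (size s)) >].
pose st := fix st k := if k is k'.+1 then rcons (st k') (nx (st k')) else [::].
pose y k := nx (st k); exists y => t.
have ey k : pre y k = st k by elim: k => [//|k IH]; rewrite preS IH.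
have e k : (k < size t)%N -> nth 0%N (st (scode t)) k = y k.
  by move=> kt; rewrite -ey nth_pre0//; exact: leq_trans kt (size_scode t).
rewrite /y /nx -{2}ey size_pre CodeSeq.codeK; case: asboolP => h; split=> //.
- by move=> _; exact: hQ h.
- by move=> h'; case: h; apply: hQ h' => k /e.
Qed.

(** * Hardness *)

(** The balls around a countable dense set are countably many, and one clopen set is chosen between
    two of them whenever there is one; by the clopen basis these form a base. *)
Lemma clopen_sequence (R : realType) (Z : topologicalType) : polish R Z -> clopen_basis Z ->
  exists C : nat -> set Z, (forall k, clopen (C k)) /\
    forall (O : set Z) z, open O -> O z -> exists k, C k z /\ C k `<=` O.
Proof.
move=> [[Q cQ dQ] [M [f [g [cf cg fg gf _]]]]] [_ cb].
have /countable_injP[e einj] := cQ.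
pose Bl (p : nat * nat) : set Z := [set z | exists d, [/\ Q d, e d = p.1 &
  ball (f d) (p.2.+1%:R^-1 : R)%R (f z)]].
have loc (O : set Z) z : nbhs z O -> exists p, [/\ Bl p z, nbhs z (Bl p) & Bl p `<=` O].
  move=> nO; have : nbhs (f z) (fun m => O (g m)) by apply: cg; rewrite /= fg.
  rewrite -nbhs_ballE => -[r /= r0 hr].
  have r2 : (0 < r / 2 :> R)%R by rewrite divr_gt0.
  have /ltr_add_invr[m] := r2; rewrite add0r => mr.
  pose h : R := (m.+1%:R^-1 / 2)%R; have h0 : (0 < h)%R by rewrite divr_gt0// invr_gt0.
  have nb : nbhs z [set z' | ball (f z) h (f z')] by apply: cf; exact: nbhsx_ballx.
  have [V [oV Vz] VA] : exists2 V, open_nbhs z V & V `<=` [set z' | ball (f z) h (f z')].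
    by move: nb; rewrite nbhsE.
  have [d [Vd Qd]] := dQ V (ex_intro _ z Vz) oV.
  have hd : ball (f d) h (f z) by apply: ball_sym; exact: VA.
  have hh : (h + h = m.+1%:R^-1)%R by rewrite -splitr.
  have key z' : ball (f z) h (f z') -> Bl (e d, m) z'.
    by move=> hz'; exists d; split=> //=; rewrite -hh; exact: ball_triangle hd hz'.
  exists (e d, m); split; first by apply: key; exact: ballxx.
    by apply: (@filterS _ (nbhs z) _ _ _ _ nb) => z' /key.
  move=> z' [d' [Qd' ed' hz']].
  have ? : d' = d by apply: einj => //; rewrite ?inE.
  subst d'; rewrite -(fg z'); apply: hr; rewrite (splitr r).
  apply: (@ball_triangle _ _ (f d)); apply: le_ball (ltW mr) _ _ => //=.
  by rewrite -hh; apply: ball_sym; apply: le_ball hd; rewrite lerDl ltW.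
pose good_clopen (p : (nat * nat) * (nat * nat)) (W : set Z) :=
  [/\ clopen W, Bl p.1 `<=` W & W `<=` Bl p.2].
pose C k : set Z := if unpickle k is Some p then xget set0 (good_clopen p) else set0.
exists C; split.
  move=> k; rewrite /C; case: unpickle => [p|]; last by split; [exact: open0|exact: closed0].
  by case: xgetP => [W _ [] //|_]; split; [exact: open0|exact: closed0].
move=> O z oO Oz; have [p [_ np pO]] := loc O z (open_nbhs_nbhs (conj oO Oz)).
have [W [cW Wz] Wp] := cb z _ np.
have [q [qz _ qW]] := loc W z (open_nbhs_nbhs (conj cW.1 Wz)).
have hW : good_clopen (q, p) W by [].
exists (pickle (q, p)); rewrite /C pickleK.
have [_ h1 h2] := xgetPex set0 (ex_intro (good_clopen (q, p)) W hW).
by split; [exact: h1|move=> z' /h2 /pO].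
Qed.

Lemma pre_mea (T : Type) (S : set (set T)) (y : T -> nat -> nat) : salg S -> mea (I := nat) S y ->
  forall n l, S (fun t => pre (y t) n = l).
Proof.
move=> hS hy; elim=> [|n IH] l; first exact: (salg_const hS ([::] = l)).
case/lastP: l => [|l k].
  apply: (@salg_ext _ S (fun=> False)); last exact: (salg_const hS).
  by move=> t; rewrite preS; split=> // /(congr1 size); rewrite size_rcons.
apply: (@salg_ext _ S (fun t => pre (y t) n = l /\ y t n = k)).
  by move=> t; rewrite preS; split=> [[-> ->]//|/rcons_inj[]].
exact: (salg_and hS).
Qed.

Section Hardness.
Variables (D : nat) (U : nat -> set (vtx D * vtx D)).
Hypotheses (D2 : (2 < D)%N) (oU : forall m, open (U m))
  (bU : forall (O : set (vtx D * vtx D)) z, open O -> O z -> exists m, U m z /\ U m `<=` O).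
Variables (Z : topologicalType) (C : nat -> set Z) (F : set (Z * baire_space * baire_space)).
Hypotheses (hC : forall k, clopen (C k))
  (bC : forall (O : set Z) z, open O -> O z -> exists k, C k z /\ C k `<=` O) (cF : closed F).
Local Notation X := (vtx D).
Implicit Types (s : Z) (u e : seq nat) (d : baire_space).

(** The parameter space is known only through its clopen basis, so nearness is one-sided: [w'] lies
    in those of the first [n] basic sets that contain [w]. *)
Definition apZ (n : nat) (w w' : Z * baire_space) : Prop :=
  (forall k, (k < n)%N -> C k w.1 -> C k w'.1) /\ pre w'.2 n = pre w.2 n.

Definition apB (n : nat) (w w' : baire_space * baire_space) : Prop :=
  pre w'.1 n = pre w.1 n /\ pre w'.2 n = pre w.2 n.

Lemma pre_le (a b : nat -> nat) m n : (m <= n)%N -> pre a n = pre b n -> pre a m = pre b m.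
Proof. by move=> mn h; rewrite -(take_pre a mn) h take_pre. Qed.

Lemma apZ_le m n w w' : (m <= n)%N -> apZ n w w' -> apZ m w w'.
Proof.
move=> mn [h1 h2]; split; last exact: pre_le h2.
by move=> k km; apply: h1; exact: leq_trans km mn.
Qed.

Lemma apB_le m n w w' : (m <= n)%N -> apB n w w' -> apB m w w'.
Proof. by move=> mn [h1 h2]; split; [exact: pre_le h1|exact: pre_le h2]. Qed.

Lemma nbhs_pre (b : baire_space) (A : set baire_space) : nbhs b A ->
  exists n, forall b', pre b' n = pre b n -> A b'.
Proof.
move=> /(@nbhs_cyl nat b A)[J hJ]; exists (\max_(j <- J) j).+1 => b' h; apply: hJ => j jJ.
by apply: (pre_eq _ h); rewrite ltnS; exact: (@leq_bigmax_seq _ J xpredT id).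
Qed.

Lemma apZ_open (O : set (Z * baire_space)) w : open O -> O w -> exists n, forall w', apZ n w w' -> O w'.
Proof.
move=> oO Ow; have : nbhs w O by apply: open_nbhs_nbhs.
case: w Ow => w1 w2 Ow [[A1 A2] [/= n1 n2] sA].
have [V [oV Vw] VA] : exists2 V, open_nbhs w1 V & V `<=` A1 by move: n1; rewrite nbhsE.
have [k [Ck kV]] := bC oV Vw; have [m hm] := nbhs_pre n2.
exists (k.+1 + m)%N => -[w1' w2'] [/= h1 h2]; apply: sA; split=> /=.
  by apply: VA; apply: kV; apply: h1 => //; exact: leq_addr.
by apply: hm; apply: pre_le h2; exact: leq_addl.
Qed.

Lemma apB_open (O : set (baire_space * baire_space)) w : open O -> O w ->
  exists n, forall w', apB n w w' -> O w'.
Proof.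
move=> oO Ow; have : nbhs w O by apply: open_nbhs_nbhs.
case: w Ow => w1 w2 Ow [[A1 A2] [/= n1 n2] sA].
have [k hk] := nbhs_pre n1; have [m hm] := nbhs_pre n2.
exists (k + m)%N => -[w1' w2'] [/= h1 h2]; apply: sA; split=> /=.
  by apply: hk; apply: pre_le h1; exact: leq_addr.
by apply: hm; apply: pre_le h2; exact: leq_addl.
Qed.

(** ** The graphs *)

Definition dpart (x : X) : baire_space := fun n => x (inl (0, n)).
Definition tpart (x : X) : baire_space := fun n => x (inl (1, n)).

(** The levelwise form of domination of a branch of [T]; for trees the two are equivalent by
    compactness, and this one is visibly Borel. *)
Definition bounds (T : nat -> nat) (z : nat -> nat) : Prop := forall n, exists t,
  [/\ size t = n, T (scode t) <> 0%N & forall k, (k < n)%N -> (nth 0%N t k <= z k)%N].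

Definition unbounded (x : X) : Prop := forall N, exists p, (N <= p)%N /\
  ~ bounds (tpart x) (fun n => dg x (p + n)).

Lemma tpart_gam i x : tpart (gam i x) = tpart x. Proof. by []. Qed.

Lemma unbounded_gam i x : unbounded x -> unbounded (gam i x).
Proof.
move=> h N; rewrite tpart_gam; case E: (lb x [:: i]) => [|k].
  have [[|p] [Np nb]] := h N.+1 => //; exists p; split=> //.
  rewrite (_ : (fun n => dg (gam i x) (p + n)) = fun n => dg x (p.+1 + n))//.
  by apply/funext => n; rewrite dg_gam E addSn.
have [p [Np nb]] := h N; exists p.+1; split; first exact: leqW.
rewrite (_ : (fun n => dg (gam i x) (p.+1 + n)) = fun n => dg x (p + n))//.
by apply/funext => n; rewrite dg_gam E addSn.
Qed.

Definition section_graph (q : baire_space * baire_space) (x x' : X) : Prop :=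
  ((dpart x = q.1 /\ tpart x = q.2) /\ unbounded x) /\ @walk_graph D (x, x').

Section Mea.
Context {T : Type} (S : set (set T)) (x : T -> X).
Hypotheses (hS : salg S) (hx : mea S x).

Lemma dpart_mea : mea (I := nat) S (fun t => dpart (x t)). Proof. by move=> n k; exact: hx. Qed.
Lemma tpart_mea : mea (I := nat) S (fun t => tpart (x t)). Proof. by move=> n k; exact: hx. Qed.

Lemma unbounded_mea : S (fun t => unbounded (x t)).
Proof.
apply: (salg_allc hS) => N; apply: (salg_ex hS) => p; apply: (salg_and hS).
  exact: (salg_const hS).
apply: (salg_not hS); apply: (salg_allc hS) => n; apply: (salg_exc hS) => u.
apply: (@salg_ext _ S (fun t => size u = n /\ (tpart (x t) (scode u) <> 0%N /\
    forall k, (k < n)%N -> (nth 0%N u k <= dg (x t) (p + k))%N))).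
  by move=> t; split=> [[? []]|[]].
apply: (salg_and hS); first exact: (salg_const hS).
apply: (salg_and hS); first by apply: (salg_not hS); exact: tpart_mea.
apply: (salg_allc hS) => k; apply: (salg_imp hS); first exact: (salg_const hS).
exact: (salg_fiber hS (fun m => (nth 0%N u k <= m)%N : Prop) (hx _)).
Qed.
End Mea.

Definition section_bad (q : baire_space * baire_space) : Prop := bad D (section_graph q) q.1.

Lemma section_bad_sig : sigma11 section_bad.
Proof.
pose B2 : topologicalType := (baire_space * baire_space)%type.
have m1 : mea (@bian B2) fst by apply: (@bian_mea B2 nat); exact: cts_fst.
have m2 : mea (@bian B2) snd by apply: (@bian_mea B2 nat); exact: cts_snd.
apply: (@bad_sig (idx D) D B2 fst section_graph m1).
pose T : topologicalType := (B2 * (X * X))%type.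
have hS := bian_salg T.
have n1 : mea (@bian T) (fun q => q.1.1) by exact: (@bian_mea_fst B2 (X * X)%type nat fst m1).
have n2 : mea (@bian T) (fun q => q.1.2) by exact: (@bian_mea_fst B2 (X * X)%type nat snd m2).
have x1 : mea (@bian T) (fun q => q.2.1).
  by apply: bian_mea; apply: (cts_comp (@cts_snd B2 (X * X)%type)); exact: cts_fst.
have x2 : mea (@bian T) (fun q => q.2.2).
  by apply: bian_mea; apply: (cts_comp (@cts_snd B2 (X * X)%type)); exact: cts_snd.
suff [] : bian (fun q : T => section_graph q.1 q.2.1 q.2.2) by [].
apply: (salg_and hS); last exact: (mea_borel2 hS x1 x2 (@H_borel D)).
apply: (salg_and hS); last exact: unbounded_mea.
apply: (salg_and hS).
  exact: (@mea_eq T (@bian T) hS nat (fun q => dpart q.2.1) (fun q => q.1.1) (dpart_mea x1) n1).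
exact: (@mea_eq T (@bian T) hS nat (fun q => tpart q.2.1) (fun q => q.1.2) (tpart_mea x1) n2).
Qed.

Variable F' : set (baire_space * baire_space * baire_space).
Hypotheses (cF' : closed F') (eF' : section_bad = fst @` F').

(* The branches of [RR (d, T)] show that [d] does not code a coloring of the
   section with parameters [d] and [T]. *)
Definition TT s (x : nat -> nat) t : Prop := tr apZ F (s, x : baire_space) t.
Definition RR (q : baire_space * baire_space) e : Prop := tr apB F' q e.

Lemma TT_take s (x : nat -> nat) t m : TT s x t -> TT s x (take m t).
Proof. by apply: tr_take => *; apply: apZ_le; eassumption. Qed.

Lemma TT_branch s (x : nat -> nat) (b : baire_space) : (forall n, TT s x (pre b n)) <-> F ((s, x), b).
Proof.
apply: (tr_branch _ _ _ cF); [exact: apZ_le|by move=> n w; split|exact: apZ_open].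
Qed.

Lemma RR_branch q (b : baire_space) : (forall n, RR q (pre b n)) <-> F' (q, b).
Proof.
apply: (tr_branch _ _ _ cF'); [exact: apB_le|by move=> n w; split|exact: apB_open].
Qed.

Lemma TT_ext s (x y : nat -> nat) t : (forall k, (k < size t)%N -> x k = y k) -> TT s x t -> TT s y t.
Proof. by move=> h [p [Fp [a1 a2] e]]; exists p; split=> //; split=> //; rewrite a2; exact: eq_pre. Qed.

Lemma RR_ext d (y y' : nat -> nat) e : (forall k, (k < size e)%N -> y k = y' k) ->
  RR (d, y : baire_space) e -> RR (d, y' : baire_space) e.
Proof. by move=> h [p [Fp [a1 a2] ep]]; exists p; split=> //; split=> //; rewrite a2; exact: eq_pre. Qed.

Definition attempts s d (y : nat -> nat) t : Prop := attempt (TT s) (RR (d, y : baire_space)) t.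

Lemma attempts_ext s d (y y' : nat -> nat) t : (forall k, (k < size t)%N -> y k = y' k) ->
  attempts s d y t -> attempts s d y' t.
Proof.
move=> h a u ut Tu; have [h1 h2 h3] := a u ut Tu; split=> //; apply: RR_ext h1 => k.
rewrite h2 => ku; apply: h; exact: leq_ltn_trans (leq_trans (ltnW ku) (size_scode u)) ut.
Qed.

Definition self_ref s x : Prop :=
  forall t, tpart x (scode t) <> 0%N <-> attempts s (dpart x) (tpart x) t.

Definition red_graph s : set (X * X) := [set p | (self_ref s p.1 /\ unbounded p.1) /\ @walk_graph D p].

Lemma RR_mea (T : Type) (S : set (set T)) (x : T -> X) e : salg S -> mea S x ->
  S (fun t => RR (dpart (x t), tpart (x t)) e).
Proof.
(* [RR] sees its parameters only through initial segments of length [size e], which are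
   enumerated. *)
move=> hS hx; apply: (@salg_ext _ S (fun t => exists l l' : seq nat,
  pre (dpart (x t)) (size e) = l /\ (pre (tpart (x t)) (size e) = l' /\
  exists p, [/\ F' p, pre p.1.1 (size e) = l /\ pre p.1.2 (size e) = l' & pre p.2 (size e) = e]))).
  move=> t; split=> [[l [l' [<- [<- h]]]]//|h].
  by exists (pre (dpart (x t)) (size e)), (pre (tpart (x t)) (size e)).
apply: (salg_exc hS) => l; apply: (salg_exc hS) => l'.
apply: (salg_and hS); first by apply: (pre_mea hS); exact: dpart_mea.
apply: (salg_and hS); first by apply: (pre_mea hS); exact: tpart_mea.
exact: (salg_const hS).
Qed.

Lemma TT_mea (T : Type) (S : set (set T)) (f : T -> Z) (x : nat -> nat) u : salg S ->
  (forall k, S (fun t => C k (f t))) -> S (fun t => TT (f t) x u).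
Proof.
(* [w] lists at least the relevant basic sets that contain [f t]; once it is given, the condition on
   [p] no longer involves [t]. *)
move=> hS hf; apply: (@salg_ext _ S (fun t => exists w : seq nat,
  (forall k, (k < size u)%N -> C k (f t) -> k \in w) /\
  exists p, [/\ F p, forall k, (k < size u)%N -> k \in w -> C k p.1.1,
    pre p.1.2 (size u) = pre x (size u) & pre p.2 (size u) = u])).
  move=> t; split=> [[w [hw [p [Fp h1 h2 h3]]]]|[p [Fp [h1 h2] h3]]].
    by exists p; split=> //; split=> // k ku Ck; apply: h1 => //; exact: hw.
  exists [seq k <- iota 0 (size u) | `[< C k (f t) >]]; split.
    by move=> k ku Ck; rewrite mem_filter mem_iota add0n ku; apply/andP; split=> //; exact/asboolP.
  exists p; split=> // k ku; rewrite mem_filter => /andP[/asboolP Ck _]; exact: h1.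
apply: (salg_exc hS) => w; apply: (salg_and hS); last exact: (salg_const hS).
apply: (salg_allc hS) => k; apply: (salg_imp hS); first exact: (salg_const hS).
by apply: (salg_imp hS) => //; exact: (salg_const hS).
Qed.

Lemma red_graph_coded : coded U (fun p : Z * (X * X) => red_graph p.1 p.2).
Proof.
have hS := @coded_salg Z (X * X)%type U.
have hb (A : set (X * X)) : borel A -> coded U (fun p : Z * (X * X) => A p.2).
  by apply: (borel_min (salg_pre snd hS)) => O oO; apply: coded_open => z; exact: bU.
have hx : mea (@coded Z _ U) (fun p => p.2.1).
  move=> i k; apply: (hb (fun z => z.1 i = k)).
  exact: (@mea_cts (X * X)%type (idx D) fst (@cts_fst X X) i k).
apply: (salg_and hS); last by apply: hb; exact: H_borel.
apply: (salg_and hS); last exact: unbounded_mea.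
apply: (salg_allc hS) => t; apply: (salg_iff hS).
  by apply: (salg_not hS); exact: tpart_mea.
apply: (salg_allc hS) => u; apply: (salg_imp hS); first exact: (salg_const hS).
apply: (salg_imp hS); first by apply: (TT_mea _ _ hS) => k; exact: coded_clopen.
pose e := image t (scode u).
apply: (@salg_ext _ (@coded Z _ U) (fun p => RR (dpart p.2.1, tpart p.2.1) e /\
  (size e = size u /\ forall u' j, u = rcons u' j -> (scode u' < size t)%N ->
      image t (scode u') = take (size u') e))).
  by move=> p; split=> [[? []]|[]].
by apply: (salg_and hS); [exact: RR_mea|exact: (salg_const hS)].
Qed.

Lemma red_graph_sub s : red_graph s `<=` @walk_graph D.
Proof. by move=> p []. Qed.

Lemma red_graph_sym s x y : red_graph s (x, y) -> red_graph s (y, x).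
Proof.
move=> [[/= fs ub] hH]; have [_ [i /= e]] := hH; subst y.
by split; [split=> //; exact: unbounded_gam|exact: H_sym].
Qed.

Lemma wf_of_coloring s (c : X -> nat) : (forall k, borel (fun x => c x = k)) ->
  (forall x, (c x < D)%N) -> (forall x x', red_graph s (x, x') -> c x <> c x') ->
  exists x : baire_space, forall b, ~ F ((s, x), b).
Proof.
move=> bc cD cG; apply: contrapT => nB.
have {}nB (x : baire_space) : exists b, F ((s, x), b).
  by apply: contrapT => no; apply: nB; exists x => b Fb; apply: no; exists b.
have [d nd] := @color_notbad (idx D) D (fun x x' => red_graph s (x, x')) c bc cD cG.
(* Diagonalization: the code [d] of the given coloring becomes a parameter of the section on which
   this coloring has to fail. *)
have [y hy] := @self_reference (attempts s d) (@attempts_ext s d).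
have sg x x' : section_graph (d, y : baire_space) x x' -> red_graph s (x, x').
  move=> [[[/= ed et] ub] hH]; split=> //; split=> //= t.
  by rewrite ed et; exact: hy.
have nbad : ~ section_bad (d, y : baire_space).
  move=> [b|[x [x' [/sg hG hk]]]]; first by apply: nd; left.
  by apply: nd; right; exists x, x'.
have nbr (b : nat -> nat) : ~ forall n, y (scode (pre b n)) <> 0%N.
  move=> hb; have [b' Fb'] := nB (fun k => (dec (b k)).1).
  have [|c' hc'] := @attempt_branch (TT s) (RR (d, y : baire_space)) (@TT_ext s) b b'
    (fun n => (hy _).1 (hb n)).
    by move=> n; exact: (TT_branch s (fun k => (dec (b k)).1) b').2 Fb' n.
  have Fc : F' ((d, y : baire_space), c' : baire_space) by apply/RR_branch.
  by apply: nbad; rewrite eF'; exists ((d, y : baire_space), c' : baire_space).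
have yt t m : y (scode t) <> 0%N -> y (scode (take m t)) <> 0%N.
  by move=> /hy h; apply/hy; apply: attempt_take h; exact: TT_ext.
pose x0 : X := fun a => match a with inl (0, n) => d n | inl (1, n) => y n | _ => 0%N end.
apply: (@H_not_colorable D x0 c) => // [|x i Vx sx]; first exact: leq_trans D2.
have ed : dpart x = d by apply/funext => n; rewrite /dpart sx.
have et : tpart x = y by apply/funext => n; rewrite /tpart sx.
apply: cG; split; last by split=> //; exists i.
split; first by move=> t; rewrite /= ed et; exact: hy.
(* Since the tree [y] has no branch, no digit sequence bounds it, so no vertex of this section has
   been removed. *)
move=> N; exists N; split=> //=; rewrite et.
exact: (@koenig (fun t => y (scode t) <> 0%N) yt nbr).
Qed.

Section WellFounded.
Variables (s : Z) (r : baire_space).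
Hypothesis wf : forall b, ~ F ((s, r), b).
Local Notation P := (TT s r).

Lemma P_take t m : P t -> P (take m t). Proof. exact: TT_take. Qed.

Lemma P_acc t : Acc (child P) t.
Proof. by apply: (child_acc P_take) => b /TT_branch; exact: wf. Qed.

Definition RX x : seq nat -> Prop := RR (dpart x, tpart x).
Definition large x : Prop := RX x [::] /\ emb P (RX x) [::] [::].
Definition path_of x : nat -> nat := fun k => pickle (r k, enc P (RX x) (CodeSeq.decode k)).

(** A refutation of [d] would be a branch of [RR], and the well-founded tree maps into any tree with
    a branch, level by level along it. *)
Lemma large_bad x : ~ large x -> ~ section_bad (dpart x, tpart x).
Proof.
move=> nl; rewrite eF' => -[[q b] Fb /= eq]; subst q; apply: nl.
have hb := (RR_branch _ _).2 Fb; split; first exact: (hb 0%N).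
exact: (emb_branch hb (P_acc [::])).
Qed.

Lemma large_mea (T : Type) (S : set (set T)) (x : T -> X) : salg S -> mea S x ->
  S (fun t => large (x t)).
Proof.
move=> hS hx; apply: (salg_and hS); first exact: RR_mea.
by apply: (emb_mea (R := fun t => RX (x t)) hS _ P_acc) => e; exact: RR_mea.
Qed.

Lemma path_mea (T : Type) (S : set (set T)) (x : T -> X) : salg S -> mea S x ->
  mea (I := nat) S (fun t => path_of (x t)).
Proof.
move=> hS hx k m; apply: (@salg_ext _ S (fun t => exists q,
  enc P (RX (x t)) (CodeSeq.decode k) = q /\ pickle (r k, q) = m)).
  by move=> t; split=> [[q [<- ]]//|e]; eexists.
apply: (salg_exc hS) => q; apply: (salg_and hS); last exact: (salg_const hS).
by apply: (enc_mea (R := fun t => RX (x t)) hS _ P_acc) => e; exact: RR_mea.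
Qed.

(** By self-reference the attempts for the real [r] form a branch of [tpart x]. Digits dominating
    this branch from some tail on would bound the tree, which [unbounded] excludes for infinitely
    many tails. *)
Lemma path_good x : self_ref s x -> unbounded x -> large x -> good (path_of x) x.
Proof.
move=> fs ub [R0 e0] N; have [p [Np nb]] := ub N; exists p; split=> //.
apply: contrapT => no; apply: nb => n; exists (pre (path_of x) n); split.
- exact: size_pre.
- by apply/fs; exact: (attempt_enc (TT := TT s) (@TT_ext s) P_take R0 e0).
- move=> k kn; rewrite nth_pre0// leqNgt; apply/negP => l; apply: no; by exists k.
Qed.

(** The code varies with [x], so evaluation alone yields no Borel set. Off [large] all the codes are
    well-founded, so both the set and its complement are described by existence of a truth table,
    and Suslin's theorem applies. *)
Lemma dcol_borel j : (j < D)%N -> borel (fun x => ~ large x /\ dcol (dpart x) x j).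
Proof.
move=> jD; have hS := bian_salg X.
have mi : mea (@bian X) (fun x => x) by apply: bian_mea => x A.
have wfd x : ~ large x -> wfc (code_section (dpart x) j).
  by move=> /large_bad nb; apply: contrapT => n; apply: nb; left; exists j.
have [lg nlg] : bian large := large_mea hS mi.
pose ok (q : X * natp (seq nat)) := okv (@cylB (idx D)) (code_section (dpart q.1) j) q.1 q.2.
have bok : bian ok.
  have hS2 := bian_salg (X * natp (seq nat))%type.
  have m1 : mea (@bian (X * natp (seq nat))%type) fst by apply: bian_mea; exact: cts_fst.
  apply: (okv_mea hS2); [exact: (section_mea j (dpart_mea m1))|by apply: bian_mea; exact: cts_snd|].
  by move=> m; exact: cylB_mea.
have bv : bian (fun q : X * natp (seq nat) => q.2 [::] = 0%N).
  by apply: (@bian_mea (X * natp (seq nat))%type (seq nat : countType) snd (@cts_snd _ _)).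
have vex x : ~ large x -> exists v : natp (seq nat), ok (x, v).
  by move=> /wfd w; have [A /(okv_ex x)[v hv]] := wfc_code (@cylB (idx D)) w; exists v.
apply: suslin.
  rewrite (_ : (fun x => _) = fun x => ~ large x /\ exists v, ok (x, v) /\ v [::] <> 0%N).
    apply: sig_and => //; apply: (@sig_proj X (seq nat : countType) (fun q => ok q /\ q.2 [::] <> 0%N)).
    by apply: sig_and; [case: bok|case: bv].
  apply/predeqP => x; split=> -[nl h]; split=> //.
    have [v hv] := vex x nl; exists v; split=> //; exact/(denP (wfd x nl) hv).
  by case: h => v [hv v0]; exact/(denP (wfd x nl) hv).
rewrite (_ : ~` _ = fun x => large x \/ exists v, ok (x, v) /\ v [::] = 0%N).
  apply: sig_or => //; apply: (@sig_proj X (seq nat : countType) (fun q => ok q /\ q.2 [::] = 0%N)).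
  by apply: sig_and; [case: bok|case: bv].
apply/predeqP => x; split.
  move=> n; have [l|nl] := pselect (large x); [by left|right].
  have [v hv] := vex x nl; exists v; split=> //; apply: contrapT => v0; apply: n; split=> //.
  exact/(denP (wfd x nl) hv).
move=> [l|[v [hv v0]]] [nl] //; rewrite /dcol => h.
by apply: ((denP (wfd x nl) hv).1 h).
Qed.

Lemma coloring_of_wf : exists c : X -> nat, [/\ forall k, borel (fun x => c x = k),
  forall x, (c x < D)%N & forall x x', red_graph s (x, x') -> c x <> c x'].
Proof.
have [kk hkk] := choice (fun x => @color_of_ex D (dcol (dpart x) x)).
pose c x := if `[< large x >] then col (path_of x) x else kk x.
have hS := borel_salg X; have mi := @mea_id (idx D).
exists c; split.
- move=> k; apply: (@salg_ext _ (@borel X) (fun x => (large x /\ col (path_of x) x = k) \/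
    (~ large x /\ color_of D (fun j => ~ large x /\ dcol (dpart x) x j) k))).
    move=> x; rewrite /c; case: asboolP => l; split.
    + by case=> [[]|[]].
    + by left.
    + case=> [[]//|[_ h]]; apply: (color_of_uniq (hkk x)).
      by apply: (color_of_ext _ h) => j _; split=> [[]|].
    + by move=> <-; right; split=> //; apply: (color_of_ext _ (hkk x)) => j _; split=> [|[]].
  apply: (salg_or hS); apply: (salg_and hS).
  + exact: large_mea.
  + by apply: (col_mea hS); [exact: path_mea|exact: mi].
  + by apply: (salg_not hS); exact: large_mea.
  + by apply: (color_of_mea hS) => j; exact: dcol_borel.
- move=> x; rewrite /c; case: asboolP => _; last exact: (color_of_lt (leq_trans _ D2) (hkk x)).
  exact: leq_trans (col_lt3 _ _) D2.
move=> x x' [[/= fs ub] hH]; have [[ix fx] [i /= e]] := hH; subst x'.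
(* Both hold by computation, since an edge preserves the parameters [dpart] and [tpart]. *)
have le : large (gam i x) = large x by [].
have pe : path_of (gam i x) = path_of x by [].
rewrite /c le pe; case: asboolP => l; first by apply: col_proper => //; exact: path_good.
move=> ek; apply: (large_bad l); right; exists x, (gam i x); split.
  by split=> //.
by exists (kk x); split; [exact: hkk|rewrite ek; exact: (hkk (gam i x))].
Qed.

End WellFounded.

Lemma reduction : exists f : Z -> baire_space, continuous f /\
  forall s, (exists x : baire_space, forall b, ~ F ((s, x), b)) <-> small_codes U (f s).
Proof.
have [f [cf hf]] := red_graph_coded; exists f; split=> // s.
have hG : borel_code U (f s) (red_graph s) := hf s.
split=> [[x wf]|[G [hG' _ /colorable_small[|c [h1 h2 h3]]]]]; last 2 first.
- exact: leq_trans D2.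
- apply: (wf_of_coloring h1 h2) => x x' gx; apply: h3.
  exact/(den_code hG')/(den_code hG).
exists (red_graph s); split=> //.
- split; last exact: red_graph_sub.
  split; [exact: (code_borel oU hG)|exact: red_graph_sym|].
  by move=> y /red_graph_sub; exact: H_irr.
- apply/colorable_small; first exact: leq_trans D2.
  exact: coloring_of_wf wf.
Qed.

End Hardness.

Theorem theorem1p1 (R : realType) (n : nat) (hn : (4 <= n)%N) :
  exists (X : ptopologicalType) (H : set (X * X)),
    [/\ polish R X, borel_graph H, bounded_degree H & acyclic H] /\
    [/\ cc_le (chi_BM H) (Fin 3),
        forall mu : probability (borel_space X) R, cc_le (chi_mu mu H) (Fin 3),
        cc_lt (Fin 3) (chi_B H)
      & chi_B H = Fin n] /\
    (forall U : nat -> set (X * X), basis (range U) ->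
      sigma12_complete R
        [set c : baire_space | exists G : set (X * X),
          [/\ borel_code U c G, borel_subgraph G H
            & cc_lt (chi_B G) (Fin n)]]).
Proof.
case: n hn => [//|D]; rewrite ltnS => D2.
have D0 : (0 < D)%N by exact: leq_trans D2.
have chi : chi_B (@walk_graph D) = Fin D.+1.
  apply: chromatic_eq => //; first exact: H_colorable.
  move=> m mD [c [h1 h2 h3]].
  (* Any section will do, so the parameters are taken to be zero. *)
  apply: (@H_not_colorable D (fun=> 0%N) c D0).
  - by move=> k; exact: (h2 [set k]).
  - by move=> x _ _; exact: leq_trans (h1 x) _.
  - by move=> x i Vx _; apply: h3; split=> //; exists i.
exists (pvtx D), (@walk_graph D); split; last split.
- split; [exact: (polish_nat R (idx D))|exact: H_borel_graph|exact: H_bounded|exact: H_acyclic].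
- split; [exact: chi_BM_le|move=> mu; exact: chi_mu_le| |exact: chi].
  by rewrite chi /cc_lt /= -ltnNge ltnS.
move=> U [oU bU]; have oU' m : open (U m) by apply: oU; exists m.
have bU' (O : set (vtx D * vtx D)) z : open O -> O z -> exists m, U m z /\ U m `<=` O.
  move=> oO Oz; have [V [[m _ <-] Vz] VO] := bU z O (open_nbhs_nbhs (conj oO Oz)).
  by exists m.
split; first exact: (small_codes_sigma12 D0 oU').
(* The complement of [P] is the projection of the closed set [F], so [P (s, x)] means that the tree
   [TT s x] has no branch. *)
move=> Z pZ cZ B [P [F cF eF] eB]; have [C [hC bC]] := clopen_sequence pZ cZ.
have [F' cF' eF'] := section_bad_sig D.
have [f [cf hf]] := reduction D2 oU' bU' hC bC cF cF' eF'.
exists f => //; apply/predeqP => s; rewrite /preimage /=.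
rewrite -[X in _ <-> X]/(small_codes U (f s)) -hf eB; split.
  move=> [[s' x] Px /= <-]; exists x => b Fb.
  have : (~` P) (s', x) by rewrite eF; exists (s', x, b).
  exact.
move=> [x hx]; exists (s, x) => //; apply: contrapT => nP.
have : (~` P) (s, x) by [].
by rewrite eF => -[[q b] Fb /= eq]; subst q; exact: (hx b).
Qed.
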